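(* Let $t\ge 2$, $k\ge 2$, and $0\le a\le t-1$ be integers such that $$(t+1,\,tk-a)\notin\{(3,2s-1),\,(s+1,s+1),\,(s+1,s+2): s\in\mathbb{Z},\ s\ge 2\}\cup\{(4,7)\}.$$ Then the limit below exists and $$\lim_{n\to\infty}\frac{U_{t+1}(n,tk-a)}{n^k}=\frac{1}{k!}\cdot\frac{1}{\binom{tk-a}{k}-m(tk-a,k,t-a-1)}.$$
   Context: An $r$-graph (an $r$-uniform hypergraph) is a family $\mathcal{H}\subseteq\binom{V(\mathcal{H})}{r}$ of distinct $r$-subsets (edges) of a finite vertex set $V(\mathcal{H})$. For a positive integer $s$, an $r$-graph $\mathcal{H}$ is called $s$-union-free if for any two distinct subsets $\mathcal{A},\mathcal{B}\subseteq\mathcal{H}$, each consisting of at most $s$ edges, $\bigcup_{A\in\mathcal{A}}A\neq\bigcup_{B\in\mathcal{B}}B$. $U_s(n,r)$ denotes the maximum number of edges in an $s$-union-free $r$-graph on $n$ vertices. For integers $r,k\ge 1$ and $\lambda\ge 0$, $m(r,k,\lambda)$ denotes the maximum number of edges in a $k$-graph on $r$ vertices that contains no $\lambda+1$ pairwise disjoint edges (so $m(r,k,0)=0$). *)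

(* Defs.v *)
From mathcomp Require Import all_boot.

Set Implicit Arguments.
Unset Strict Implicit.
Unset Printing Implicit Defensive.

Definition uniform (T : finType) (r : nat) (H : {set {set T}}) : bool :=
  [forall E in H, #|E| == r].

(* The subfamilies A and B may overlap and may be empty. *)
Definition union_free (T : finType) (s : nat) (H : {set {set T}}) : bool :=
  [forall A : {set {set T}}, forall B : {set {set T}},
    [&& A \subset H, B \subset H, #|A| <= s, #|B| <= s & A != B] ==>
    (\bigcup_(E in A) E != \bigcup_(E in B) E)].

Definition has_matching (T : finType) (l : nat) (H : {set {set T}}) : bool :=
  [exists M : {set {set T}}, [&& M \subset H, #|M| == l & trivIset M]].

Definition max_union_free (s n r : nat) : nat :=
  \max_(H : {set {set 'I_n}} | uniform r H && union_free s H) #|H|.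

Definition max_matching_free (r k l : nat) : nat :=
  \max_(H : {set {set 'I_r}} | uniform k H && ~~ has_matching l.+1 H) #|H|.

(* Main.v *)
(** Put [r = t * k - a], let [F] be an extremal family for [m(r, k, t - a - 1)],
    [G] the set of the other [k]-subsets of ['I_r], and [g = #|G|].

    Upper bound. Call a subset of an edge [E] own if no other edge contains it.
    Suppose that [E] has no own [(k-1)]-subset. Then its non-own [k]-subsets
    contain no [t - a] disjoint members: together with [a] non-own
    [(k-1)]-subsets these would cover [E] by [t] other edges. So [E] has at
    least [g] own [k]-subsets, and [g * (#|H| - 'C(n, k.-1)) <= 'C(n, k)].

    Lower bound. Outside the excluded cases both [2 * a <= (t - 2) * k] and [3 *
    a < (2 * t - 3) * k] hold. Under these inequalities a system of [r]-sets is
    union-free as soon as (i) few edges always span as many vertices as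
    possible, (ii) the [k]-point traces of the other edges on an edge [E] lie in
    a copy of [F], and (iii) if [E] and [E'] meet in [k] points, no edge meets
    both [E \ E'] and [E' \ E]. Such a system in which almost every [k]-set lies
    in a copy of [G] is obtained by a random choice followed by Pippenger's
    nibble: colour all vertex sets at random and keep a random sparse set of
    those injections ['I_r -> V] for which every [F]-position receives the
    colour prescribed by a code. The code takes so few values that two chosen
    injections rarely share an [F]-set and have the same coordinates outside it;
    otherwise equality of the codes forces (iii), because the vertices of [E \
    E'] and [E' \ E] then agree in some coordinate, which no two vertices of an
    edge do. *)

Require Import Defs.
From mathcomp Require Import all_boot all_order all_algebra fingroup perm.
From mathcomp Require Import reals ring lra zify.
Import Order.TTheory GRing.Theory Num.Theory.
Set Implicit Arguments.
Unset Strict Implicit.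
Unset Printing Implicit Defensive.

(** Condition (iii) is there because the trace argument excludes only covers by [t] other edges,
    while two competing families have [t + 1] members. The two inequalities serve to rule out the
    other configurations.

    The obstacle to (iii) is that almost all [k]-sets are spent on copies of [G], so the few
    low-coloured ones carry all copies of [F] and are typically shared by many edges. A code
    recording the words outside an [F]-set exactly would have as many values as there are tuples of
    words, up to a constant, and pairs of edges with the same [F]-set and the same words would not
    be rare. Identifying [2 ^ e] tuples makes them rarer by that factor, and column exchanges are an
    identification under which distinct tuples of a class still agree crosswise. *)

(** * Elementary facts on finite sets and binomial coefficients *)

Lemma set_ind (T : finType) (P : {set T} -> Prop) :
  P set0 -> (forall x (B : {set T}), x \notin B -> P B -> P (x |: B)) -> forall B, P B.
Proof.
move=> P0 PU B; have [n] := ubnP #|B|; elim: n B => // n IH B leBn.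
have [-> // | [x xB]] := set_0Vmem B.
rewrite -(setD1K xB); apply: PU; first by rewrite !inE eqxx.
by apply: IH; move: leBn; rewrite (cardsD1 x) xB.
Qed.

Lemma leq_card_bigcup (I T : finType) (P : {pred I}) (F : I -> {set T}) :
  (#|\bigcup_(i in P) F i| <= \sum_(i in P) #|F i|)%N.
Proof.
elim/big_rec2: _ => [|i n U _ IH]; first by rewrite cards0.
by rewrite (leq_trans (leq_card_setU _ _).1) // leq_add2l.
Qed.

Lemma ffact_le_expn (n j : nat) : n ^_ j <= n ^ j.
Proof.
rewrite ffact_prod; apply: leq_trans (_ : \prod_(i < j) n <= _).
  by apply: leq_prod => i _; rewrite leq_subr.
by rewrite prod_nat_const card_ord.
Qed.

Lemma bin_le_expn (n j : nat) : 'C(n, j) <= n ^ j.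
Proof.
by apply: leq_trans (ffact_le_expn n j); rewrite -bin_ffact leq_pmulr ?fact_gt0.
Qed.

(** * Sparse systems are union-free *)

Lemma exists_subset_card (T : finType) (A : {set T}) (l : nat) :
  l <= #|A| -> exists2 B : {set T}, B \subset A & #|B| = l.
Proof.
elim: l => [_|l IH lA]; first by exists set0; rewrite ?sub0set ?cards0.
have [B BA cB] := IH (ltnW lA).
have /set0Pn[x] : A :\: B != set0.
  by rewrite -card_gt0 cardsD (setIidPr BA) cB subn_gt0.
rewrite inE => /andP[xB xA]; exists (x |: B); first by rewrite subUset sub1set xA.
by rewrite cardsU1 xB cB.
Qed.

Lemma has_matching_leq (T : finType) (l : nat) (H M : {set {set T}}) :
  M \subset H -> l <= #|M| -> trivIset M -> has_matching l H.
Proof.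
move=> MH lM tM; have [N NM cN] := exists_subset_card lM.
apply/existsP; exists N; rewrite (subset_trans NM MH) cN eqxx /=.
exact: trivIsetS NM tM.
Qed.

Lemma union_freeP (T : finType) (s : nat) (H : {set {set T}}) :
  reflect (forall A B : {set {set T}}, A \subset H -> B \subset H ->
             #|A| <= s -> #|B| <= s -> cover A = cover B -> A = B)
          (union_free s H).
Proof.
apply: (iffP forallP) => [uf A B AH BH As Bs AB|uf A].
  apply/eqP; apply: contraT => nAB.
  have /forallP/(_ B)/implyP := uf A.
  by rewrite AH BH As Bs nAB => /(_ isT)/eqP[].
apply/forallP => B; apply/implyP => /and5P[AH BH As Bs]; apply: contraNN.
by move=> /eqP AB; apply/eqP; apply: uf.
Qed.

Section SparseSystem.
Variables (V : finType) (t k a : nat) (H : {set {set V}}).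
Variable Fam : {set V} -> {set {set V}}.
Local Notation r := (t * k - a).
Hypothesis k_gt0 : 0 < k.
Hypothesis uniH : {in H, forall E : {set V}, #|E| = r}.
Hypothesis interH : {in H &, forall E E' : {set V}, E != E' -> #|E :&: E'| <= k}.
Hypothesis famH : {in H &, forall E E' : {set V}, E != E' -> #|E :&: E'| = k ->
  E :&: E' \in Fam E}.
Hypothesis matchH : {in H, forall E : {set V}, ~~ has_matching (t - a) (Fam E)}.

(* A maximal disjoint family of [k]-point traces on [E] has fewer than [t - a]
   members, and all further edges of [B] add at most [k.-1] points each. *)
Lemma cover_free (E : {set V}) (B : {set {set V}}) :
  E \in H -> B \subset H -> E \notin B -> #|B| <= t -> ~~ (E \subset cover B).
Proof.
move=> EH BH EB Bt; apply/negP => Ecov.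
pose P (M : {set {set V}}) := [&& M \subset B,
  [forall b in M, #|E :&: b| == k] &
  [forall b in M, forall b' in M, (b != b') ==> [disjoint E :&: b & E :&: b']]].
have P0 : P set0.
  rewrite /P sub0set /=; apply/andP; split; apply/forall_inP => b; by rewrite inE.
case: (arg_maxnP (fun M : {set {set V}} => #|M|) P0) => M /and3P[MB /forall_inP Mk /forall_inP Mdis] Mmax.
have neqE b : b \in B -> E != b by move=> bB; apply: contraNneq EB => ->.
have leB b : b \in B -> #|E :&: b| <= k.
  by move=> bB; apply: interH => //; [exact: (subsetP BH)|exact: neqE].
pose U := \bigcup_(b in M) (E :&: b).
have leD b : b \in B :\: M -> #|(E :&: b) :\: U| <= k.-1.
  rewrite inE => /andP[bM bB]; have := leB b bB.
  rewrite leq_eqVlt => /orP[/eqP kb|ltk]; last first.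
    by rewrite -ltnS prednK // (leq_ltn_trans _ ltk) // subset_leq_card // subsetDl.
  rewrite -ltnS prednK // -kb; rewrite ltnNge; apply/negP => le.
  have dis : [disjoint E :&: b & U].
    have /eqP e : (E :&: b) :\: U == E :&: b by rewrite eqEcard subsetDl.
    by rewrite -e disjoints_subset setDE subsetIr.
  have Pb : P (b |: M).
    rewrite /P subUset sub1set bB MB /=; apply/andP; split.
      by apply/forall_inP => b' /setU1P[->|/Mk //]; apply/eqP.
    have disM b' : b' \in M -> [disjoint E :&: b & E :&: b'].
      move=> b'M; apply: disjointWr dis; exact: (bigcup_sup b').
    apply/forall_inP => b1 /setU1P[->|b1M]; apply/forall_inP => b2 /setU1P[->|b2M].
    - by rewrite eqxx.
    - by rewrite disM // implybT.
    - by rewrite disjoint_sym disM // implybT.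
    - by have /forall_inP := Mdis _ b1M; apply.
  by have := Mmax _ Pb; rewrite cardsU1 bM /= add1n ltnn.
have cardE : #|E| <= #|M| * k + (#|B| - #|M|) * k.-1.
  have -> : #|B| - #|M| = #|B :\: M| by rewrite cardsD (setIidPr MB).
  apply: leq_trans (_ : #|U :|: \bigcup_(b in B :\: M) ((E :&: b) :\: U)| <= _).
    apply: subset_leq_card; apply/subsetP => x xE.
    rewrite inE; case: (boolP (x \in U)) => //= xU.
    have /bigcupP[b bB xb] := subsetP Ecov x xE.
    apply/bigcupP; exists b; last by rewrite !inE xU xE.
    rewrite inE bB andbT; apply: contraNN xU => bM.
    by apply/bigcupP; exists b; rewrite // inE xE.
  apply: leq_trans (leq_card_setU _ _).1 _; apply: leq_add.
    apply: leq_trans (leq_card_bigcup _ _) _.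
    by rewrite (eq_bigr (fun=> k)) ?sum_nat_const // => b /Mk/eqP.
  apply: leq_trans (leq_card_bigcup _ _) _.
  by rewrite -sum_nat_const; apply: leq_sum => b; apply: leD.
(* With [#|B| <= t] the count reads [t * k - a <= t * (k - 1) + #|M|]. *)
have Mta : t - a <= #|M|.
  move: cardE; rewrite uniH //; have := subset_leq_card MB.
  by move: #|M| #|B| Bt k_gt0; clear; nia.
have /negP[] := matchH EH.
have Mne b : b \in M -> E :&: b != set0.
  by move=> /Mk/eqP kb; rewrite -card_gt0 kb.
have injM : {in M &, injective (fun b => E :&: b)}.
  move=> b b' bM b'M /= e; apply/eqP; apply: contraT => nb.
  have /forall_inP/(_ b' b'M) := Mdis b bM.
  by rewrite nb e -setI_eq0 setIid (negbTE (Mne b' b'M)).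
apply: (has_matching_leq (M := [set E :&: b | b in M])).
- apply/subsetP => _ /imsetP[b bM ->]; have bB := subsetP MB b bM.
  by apply: famH; rewrite ?neqE //; [exact: (subsetP BH)|apply/eqP/Mk].
- by rewrite card_in_imset.
- apply/trivIsetP => _ _ /imsetP[b bM ->] /imsetP[b' b'M ->] nb.
  have /forall_inP/(_ b' b'M)/implyP := Mdis b bM; apply.
  by apply: contraNneq nb => ->.
Qed.

Hypothesis t_gt1 : 1 < t.
Hypothesis a_small : 2 * a <= (t - 2) * k.
Hypothesis a_small3 : 3 * a < (2 * t - 3) * k.
Hypothesis crossH : {in H & &, forall E E' D : {set V}, E != E' ->
  #|E :&: E'| = k -> forall y y', y \in E :\: E' -> y' \in E' :\: E ->
  y \in D -> y' \notin D}.
Hypothesis sparseH : forall S : {set {set V}}, S \subset H ->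
  2 <= #|S| <= 2 * t + 2 -> #|S| * (r - k) + k <= #|cover S|.

(** By [cover_free] both families have exactly [t + 1] members, so [A :\: B] and [B :\: A] have a
    common size [p]. Sparseness of [A :|: B] bounds [#|cover A|] from below, the sizes of the
    members of [A] bound it from above, and the comparison restricts both [p] and the overlap of the
    private edges with the common ones. *)
Lemma sparse_union_free : union_free (t + 1) H.
Proof.
suff main (A B : {set {set V}}) : A \subset H -> B \subset H ->
    #|A| <= t + 1 -> #|B| <= t + 1 -> cover A = cover B -> A \subset B.
  apply/union_freeP => A B AH BH At Bt AB.
  by apply/eqP; rewrite eqEsubset; apply/andP; split; apply: main.
move=> AH BH At Bt AB; rewrite -setD_eq0; apply: contraT => nAB.
have /set0Pn[E ED] := nAB.
have [EA EB] : E \in A /\ E \notin B by move: ED; rewrite inE => /andP[].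
have EH := subsetP AH E EA.
have Ecov : E \subset cover B by rewrite -AB; apply: bigcup_sup.
have cB : #|B| = (t + 1)%N.
  apply/eqP; rewrite eqn_leq Bt /= leqNgt; apply/negP; rewrite addn1 ltnS => Bt'.
  by have := cover_free EH BH EB Bt'; rewrite Ecov.
have nBA : B :\: A != set0.
  apply/negP; rewrite setD_eq0 => BA.
  have : B \proper A by apply/properP; split=> //; exists E.
  by move/proper_card; rewrite cB ltnNge At.
have /set0Pn[E' E'D] := nBA.
have [E'B E'A] : E' \in B /\ E' \notin A by move: E'D; rewrite inE => /andP[].
have E'H := subsetP BH E' E'B.
have E'cov : E' \subset cover A by rewrite AB; apply: bigcup_sup.
have cA : #|A| = (t + 1)%N.
  apply/eqP; rewrite eqn_leq At /= leqNgt; apply/negP; rewrite addn1 ltnS => At'.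
  by have := cover_free E'H AH E'A At'; rewrite E'cov.
set C := A :&: B; set W := cover C.
have cAC := cardsID B A; have cBC := cardsID A B.
rewrite (setIC B A) -/C cB in cBC; rewrite -/C cA in cAC.
have CH : C \subset H by apply: subset_trans (subsetIl _ _) AH.
have pE : #|A :\: B| = #|B :\: A|.
  by apply/eqP; rewrite -(eqn_add2l #|C|) cAC cBC.
have p0 : 0 < #|A :\: B| by rewrite card_gt0.
have UH : A :|: B \subset H by rewrite subUset AH.
have cU : #|A :|: B| = t + 1 + #|A :\: B|
  by rewrite cardsU -/C cA cB; move: cAC; move: #|C| #|A :\: B|; clear; lia.
have covU : cover (A :|: B) = cover A.
  by rewrite /cover bigcup_setU -!/(cover _) -AB setUid.
have : 2 <= #|A :|: B| <= 2 * t + 2.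
  by rewrite cU; move: cAC p0 t_gt1; move: #|C| #|A :\: B|; clear; lia.
move=> /(sparseH UH); rewrite cU covU => sparse.
have upper : #|cover A| + \sum_(D in A :\: B) #|D :&: W| <= (t + 1) * r.
  have c1 : #|cover A| <= #|W| + \sum_(D in A :\: B) #|D :\: W|.
    apply: leq_trans (_ : #|W :|: \bigcup_(D in A :\: B) (D :\: W)| <= _).
      apply: subset_leq_card; apply/subsetP => x /bigcupP[D DA xD].
      rewrite inE; case: (boolP (x \in W)) => //= xW.
      apply/bigcupP; exists D; last by rewrite inE xW.
      rewrite inE DA andbT; apply: contraNN xW => DB.
      by apply/bigcupP; exists D; rewrite // inE DA.
    apply: leq_trans (leq_card_setU _ _).1 _; rewrite leq_add2l.
    exact: leq_card_bigcup.
  have c2 : #|W| <= #|C| * r.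
    apply: leq_trans (leq_card_bigcup _ _) _; rewrite -sum_nat_const.
    by rewrite (eq_bigr (fun=> r)) // => D DC; apply: uniH; exact: (subsetP CH).
  have c3 : \sum_(D in A :\: B) #|D :&: W| + \sum_(D in A :\: B) #|D :\: W| =
            #|A :\: B| * r.
    rewrite -big_split /= -sum_nat_const; apply: eq_bigr => D.
    rewrite inE => /andP[_ DA]; rewrite cardsID; apply: uniH; exact: (subsetP AH).
  rewrite -cAC mulnDl; move: c1 c2 c3; clear; lia.
set x := \sum_(D in _) _ in upper.
have EW : #|E :&: W| <= x by rewrite /x (bigD1 E) //= leq_addr.
clearbody x.
have rk : r - k = (t - 1) * k - a by rewrite mulnBl mul1n subnAC.
have rk' : (t - 1) * k - a + k + a = t * k.
  move: a_small t_gt1 k_gt0; clear; nia.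
(* The two bounds combine to [(t + 1 + p) * (r - k) + k + x <= (t + 1) * r], where [x] counts the
   incidences of private edges of [A] with the cover of the common edges. *)
have key : #|A :\: B| * ((t - 1) * k - a) + x <= t * k.
  move: sparse upper rk' t_gt1; rewrite rk; move: #|A :\: B| #|cover A|.
  clear; nia.
(* Here [p >= 3] would give [(2 * t - 3) * k <= 3 * a]. *)
have [p3|] := leqP 3 #|A :\: B|.
  exfalso; move: p3 key a_small3 t_gt1 k_gt0 rk'; move: #|A :\: B|; clear; nia.
rewrite ltnS leq_eqVlt => /orP[/eqP p2|]; last rewrite ltnS => p1.
  (* For [p = 2] no incidence with common edges is left, so [E] would be covered by the two edges of
     [B :\: A], and [2 <= t]. *)
  have x0 : x = 0 by move: key rk' a_small t_gt1; rewrite p2; clear; nia.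
  have EW0 : E :&: W = set0 by apply/eqP; rewrite -cards_eq0 -leqn0 -x0.
  have : E \subset cover (B :\: A).
    apply/subsetP => y yE; have /bigcupP[D DB yD] := subsetP Ecov y yE.
    apply/bigcupP; exists D => //; rewrite inE DB andbT; apply/negP => DA.
    suff : y \in E :&: W by rewrite EW0 inE.
    by rewrite inE yE; apply/bigcupP; exists D; rewrite // inE DA.
  apply: contraTT => _; apply: cover_free => //.
  - by apply: subset_trans BH; apply: subsetDl.
  - by rewrite inE (negbTE EB) andbF.
  - by rewrite -pE p2.
have {p0 p1}p1 : #|A :\: B| = 1 by apply/eqP; rewrite eqn_leq p1.
have AE D : D \in A -> D = E \/ D \in C.
  move=> DA; case: (boolP (D \in B)) => DB; first by right; rewrite inE DA.
  left; have /cards1P[F F1] : #|A :\: B| == 1 by apply/eqP.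
  have : D \in A :\: B by rewrite inE DB.
  by move: ED; rewrite F1 !inE => /eqP-> /eqP->.
have BE D : D \in B -> D = E' \/ D \in C.
  move=> DB; case: (boolP (D \in A)) => DA; first by right; rewrite inE DA.
  left; have /cards1P[F F1] : #|B :\: A| == 1 by rewrite -pE p1.
  have : D \in B :\: A by rewrite inE DA.
  by move: E'D; rewrite F1 !inE => /eqP-> /eqP->.
have EE' : E != E' by apply: contraNneq EB => ->.
(* Now [x <= k + a] and [E] lies in the union of [E'] and [W]; fewer than [k] common points would
   give [r < 2 * k + a], against [a_small]. *)
have kE : #|E :&: E'| = k.
  apply/eqP; rewrite eqn_leq interH //= leqNgt; apply/negP => ltk.
  have : r <= #|E :&: E'| + #|E :&: W|.
    rewrite -(uniH EH); apply: leq_trans (leq_card_setU _ _).1.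
    apply: subset_leq_card; apply/subsetP => y yE.
    have /bigcupP[D /BE[->|DC] yD] := subsetP Ecov y yE; first by rewrite !inE yE yD.
    by rewrite !inE yE; apply/orP; right; apply/bigcupP; exists D.
  move: ltk key EW rk' a_small t_gt1 k_gt0; rewrite p1.
  move: #|E :&: E'| #|E :&: W|; clear; nia.
have /set0Pn[y' y'D] : E' :\: E != set0.
  rewrite -card_gt0 cardsD setIC kE uniH // subn_gt0.
  move: rk' a_small t_gt1 k_gt0; clear; nia.
have [y'E' y'E] : y' \in E' /\ y' \notin E by move: y'D; rewrite inE => /andP[].
have /bigcupP[D0 /AE[D0E|D0C] y'D0] := subsetP E'cov y' y'E'.
  by move: y'E; rewrite -D0E y'D0.
have D0H := subsetP CH D0 D0C.
(* [D0] contains [y'], hence no point of [E :\: E']; without it [E] is still covered, by [t] edges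
   only. *)
have : E \subset cover (E' |: (C :\ D0)).
  apply/subsetP => y yE; apply/bigcupP.
  case: (boolP (y \in E')) => yE'; first by exists E'; rewrite // !inE eqxx.
  have /bigcupP[D /BE[DE|DC] yD] := subsetP Ecov y yE; first by rewrite -DE yD in yE'.
  exists D => //; rewrite !inE; apply/orP; right; rewrite -in_setI DC andbT.
  apply: contraTneq y'D0 => DD0.
  by have cr := crossH EH E'H D0H EE' kE; apply: (cr y y'); rewrite ?inE ?yE' ?yE ?y'E ?y'E' // -DD0.
apply: contraTT => _; apply: cover_free => //.
- by rewrite subUset sub1set E'H (subset_trans (subsetDl _ _) CH).
- by rewrite !inE negb_or EE' (negbTE EB) !andbF.
- rewrite cardsU1; apply: leq_trans (_ : 1 + #|C :\ D0| <= _).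
    by rewrite leq_add2r leq_b1.
  by rewrite -[leqRHS](addnK 1) -cAC p1 addnK (cardsD1 D0 C) D0C.
Qed.

End SparseSystem.

(** * The upper bound *)

(** The first inequality is the critical one. Put [r = t * k - a]; for [a <= t - 1] it fails only if
    [t = 2], [a = 1], where [r = 2 * k - 1]; if [k = 2], [a = t - 1], where [r = t + 1]; and if
    [t = k = 3], [a = 2], where [r = 7]. *)
Lemma exclusion_arith (t k a : nat) : 2 <= t -> 2 <= k -> a <= t - 1 ->
  (forall s, 2 <= s -> (t + 1, t * k - a) <> (3, 2 * s - 1)) ->
  (forall s, 2 <= s -> (t + 1, t * k - a) <> (s + 1, s + 1)) ->
  (t + 1, t * k - a) <> (4, 7) ->
  2 * a <= (t - 2) * k /\ 3 * a < (2 * t - 3) * k.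
Proof.
move=> t2 k2 at1 ex1 ex2 ex3.
have [t3|t3] := leqP t 2.
  have t_eq : t = 2 by apply/eqP; rewrite eqn_leq t3.
  subst t; case: a at1 ex1 ex2 ex3 => [|[|//]] _ ex1 _ _; first by split; lia.
  by case: (ex1 k k2).
have [k3|k3] := leqP k 2.
  have k_eq : k = 2 by apply/eqP; rewrite eqn_leq k3.
  subst k.
  have a1 : a <> t - 1 by move=> ae; apply: (ex2 t t2); rewrite ae; congr (_, _); lia.
  by split; lia.
have [t4|t4] := leqP t 3.
  have t_eq : t = 3 by apply/eqP; rewrite eqn_leq t4.
  subst t; split; last by lia.
  have [k4|k4] := leqP k 3; last by lia.
  have k_eq : k = 3 by apply/eqP; rewrite eqn_leq k4.
  subst k; have a2 : a <> 2 by move=> ae; apply: ex3; rewrite ae.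
  lia.
split; nia.
Qed.

(** * Own subsets of edges *)

Section Own.
Variables (T : finType) (H : {set {set T}}).

Definition own (E S : {set T}) : bool :=
  (S \subset E) && [forall E' in H, (S \subset E') ==> (E' == E)].

Definition own_sets (j : nat) (E : {set T}) : {set {set T}} :=
  [set S : {set T} | (#|S| == j) && own E S].

(** A set is own for at most one edge of [H], so the families counted on the left are disjoint. *)
Lemma sum_own_sets (j : nat) : \sum_(E in H) #|own_sets j E| <= 'C(#|T|, j).
Proof.
rewrite -card_draws -sum1_card.
under eq_bigr => E _ do rewrite -sum1_card big_mkcond /=.
rewrite exchange_big /= [leqRHS]big_mkcond /=; apply: leq_sum => S _.
rewrite inE; case: (boolP (#|S| == j)) => cS; last first.
  by rewrite big1 // => E _; rewrite inE (negbTE cS).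
rewrite -big_mkcondr sum1dep_card; apply/card_le1_eqP => E E'.
rewrite !inE => /andP[EH /and3P[_ SE /forall_inP ownE]].
move=> /andP[E'H /and3P[_ SE' /forall_inP ownE']].
by have := ownE' E EH; rewrite SE => /eqP.
Qed.

Lemma not_ownP (E S : {set T}) : S \subset E -> ~~ own E S ->
  exists E', [/\ E' \in H, E' != E & S \subset E'].
Proof.
move=> SE; rewrite /own SE /= negb_forall => /existsP[E'].
by rewrite !negb_imply => /and3P[]; exists E'.
Qed.

End Own.

(** Cut [X] into at most [b] pieces of at most [j] points, pad each to a [j]-set inside [E], and
    take another edge through each. *)
Lemma cover_by_small (T : finType) (H : {set {set T}}) (E : {set T}) (j : nat) :
  j <= #|E| ->
  (forall S : {set T}, S \subset E -> #|S| = j ->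
     exists E', [/\ E' \in H, E' != E & S \subset E']) ->
  forall (b : nat) (X : {set T}), X \subset E -> #|X| <= b * j ->
  exists B : {set {set T}}, [/\ B \subset H, E \notin B, #|B| <= b & X \subset cover B].
Proof.
move=> jE nown; elim=> [|b IH] X XE Xb.
  exists set0; rewrite sub0set inE cards0 /=; split => //.
  by move: Xb; rewrite leqn0 cards_eq0 => /eqP->; apply: sub0set.
have [S [SE Sj XS]] : exists S : {set T}, [/\ S \subset E, #|S| = j & #|X :\: S| <= b * j].
  case: (leqP j #|X|) => jX.
    have [S SX Sj] := exists_subset_card jX.
    exists S; split => //; first exact: subset_trans XE.
    by rewrite cardsD (setIidPr SX) Sj leq_subLR -mulSn.
  have : j - #|X| <= #|E :\: X| by rewrite cardsD (setIidPr XE) leq_sub2r.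
  move=> /exists_subset_card[S SEX Sj]; exists (X :|: S); split.
  - by rewrite subUset XE (subset_trans SEX) // subsetDl.
  - rewrite cardsU Sj; have -> : X :&: S = set0.
      apply/eqP; rewrite setI_eq0 disjoint_sym disjoints_subset.
      by apply: subset_trans SEX _; rewrite setDE subsetIr.
    by rewrite cards0 subn0 subnKC // ltnW.
  - by rewrite setDUr setDv set0I cards0.
have [B [BH EB Bb XB]] := IH _ (subset_trans (subsetDl _ _) XE) XS.
have [E' [E'H E'E SE']] := nown S SE Sj.
exists (E' |: B); split.
- by rewrite subUset sub1set E'H.
- by rewrite !inE negb_or eq_sym E'E.
- by rewrite cardsU1 -[b.+1]add1n; apply: leq_add; rewrite ?leq_b1.
- apply/subsetP => x xX; case: (boolP (x \in S)) => xS.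
    by apply/bigcupP; exists E'; rewrite ?inE ?eqxx // (subsetP SE').
  have /bigcupP[F FB xF] : x \in cover B by apply: (subsetP XB); rewrite inE xS.
  by apply/bigcupP; exists F; rewrite // inE FB orbT.
Qed.

Lemma imset_preimsetK (aT rT : finType) (f : aT -> rT) (S : {set rT}) :
  S \subset f @: setT -> f @: (f @^-1: S) = S.
Proof.
move=> /subsetP Sf; apply/setP => y; apply/imsetP/idP => [[x xS ->]|yS].
  by rewrite inE in xS.
have /imsetP[x _ yx] := Sf y yS; exists x => //.
by rewrite inE -yx.
Qed.

(** The extremal number is defined on ordinals; the enumeration of [E] carries the family over and
    preserves sizes and disjointness. *)
Lemma leq_max_matching_free (T : finType) (E : {set T}) (k l : nat)
    (F : {set {set T}}) :
  {in F, forall S : {set T}, S \subset E /\ #|S| = k} -> ~~ has_matching l.+1 F ->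
  #|F| <= max_matching_free #|E| k l.
Proof.
move=> Fk Fm.
pose f : 'I_#|E| -> T := enum_val.
have f_inj : injective f by apply: enum_val_inj.
have fE (S : {set T}) : S \subset E -> S \subset f @: setT.
  move=> SE; apply/subsetP => x /(subsetP SE) xE; apply/imsetP.
  by exists (enum_rank_in xE x); rewrite // /f enum_rankK_in.
pose H : {set {set 'I_#|E|}} := [set S : {set 'I_#|E|} | f @: S \in F].
have -> : #|F| = #|H|.
  have -> : F = [set f @: (S : {set 'I_#|E|}) | S in H].
    apply/setP => S; apply/idP/imsetP => [SF|[S' S'H ->]]; last by rewrite inE in S'H.
    have [SE _] := Fk S SF; exists (f @^-1: S); last by rewrite imset_preimsetK // fE.
    by rewrite inE imset_preimsetK // fE.
  by rewrite card_imset //; apply: imset_inj.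
rewrite /max_matching_free (leq_bigmax_cond H) //; apply/andP; split.
  apply/forall_inP => S; rewrite inE => /Fk[_].
  by rewrite card_imset // => ->.
apply: contraNN Fm => /existsP[M /and3P[MH /eqP cM tM]].
apply: (has_matching_leq (M := [set f @: (S : {set 'I_#|E|}) | S in M])).
- by apply/subsetP => _ /imsetP[S SM ->]; have := subsetP MH S SM; rewrite inE.
- by rewrite card_imset ?cM //; apply: imset_inj.
- apply/trivIsetP => _ _ /imsetP[S SM ->] /imsetP[S' S'M ->] neq.
  have dis : [disjoint S & S'].
    by move/trivIsetP: tM; apply => //; apply: contraNneq neq => ->.
  rewrite -setI_eq0 -imsetI; last by move=> ? ? _ _; apply: f_inj.
  by move: dis; rewrite -setI_eq0 => /eqP->; rewrite imset0.
Qed.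

Lemma card_own_sets_ge (T : finType) (H : {set {set T}}) (E : {set T}) (t k a : nat) :
  0 < k -> a < t -> uniform (t * k - a) H -> union_free (t + 1) H -> E \in H ->
  own_sets H k.-1 E = set0 ->
  'C(t * k - a, k) - max_matching_free (t * k - a) k (t - a - 1) <=
  #|own_sets H k E|.
Proof.
move=> k0 at1 /forall_inP unif uf EH own0.
have cE : #|E| = t * k - a by apply/eqP/unif.
pose F := [set S : {set T} | [&& S \subset E, #|S| == k & ~~ own H E S]].
have Fk : {in F, forall S : {set T}, S \subset E /\ #|S| = k}.
  by move=> S; rewrite inE => /and3P[-> /eqP->].
have cF : 'C(t * k - a, k) = #|own_sets H k E| + #|F|.
  rewrite -cE -cards_draws -(cardsID [set S : {set T} | own H E S]).
  congr (_ + _); apply: eq_card => S; rewrite !inE /own;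
    move: [forall E' in H, (S \subset E') ==> (E' == E)] => b;
    by case: (S \subset E); case: (#|S| == k); case: b.
suff Fm : ~~ has_matching (t - a - 1).+1 F.
  by have := leq_max_matching_free Fk Fm; rewrite cE cF leq_subLR addnC leq_add2r.
rewrite subn1 prednK ?subn_gt0 //; apply/negP => /existsP[M /and3P[MF /eqP cM tM]].
have nown (S : {set T}) : S \subset E -> #|S| = k.-1 ->
    exists E', [/\ E' \in H, E' != E & S \subset E'].
  move=> SE Sk; apply: not_ownP => //; apply/negP => oS.
  by have : S \in own_sets H k.-1 E; [rewrite inE Sk eqxx|rewrite own0 inE].
have covM : cover M \subset E.
  by apply/bigcupsP => S /(subsetP MF); rewrite inE => /and3P[].
have cardM : #|cover M| = (t - a) * k.
  rewrite -(eqP tM) -cM -sum_nat_const; apply: eq_bigr => S SM.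
  by have := subsetP MF S SM; rewrite inE => /and3P[_ /eqP].
have k1E : k.-1 <= #|E| by rewrite cE; move: k0 at1; clear; nia.
(* Beside [t - a] disjoint [k]-sets, [E] has [a * (k - 1)] further points, which is just what [a]
   sets of size [k.-1] can cover. *)
have rest : #|E :\: cover M| <= a * k.-1.
  rewrite cardsD (setIidPr covM) cE cardM; move: k0 at1; clear; nia.
have [B [BH EB Ba XB]] := cover_by_small k1E nown (subsetDl E (cover M)) rest.
pose other (S : {set T}) := odflt set0 [pick E' in H | (E' != E) && (S \subset E')].
have otherP S : S \in M -> [/\ other S \in H, other S != E & S \subset other S].
  move=> /(subsetP MF); rewrite inE => /and3P[SE _ nS].
  rewrite /other; case: pickP => [E' /and3P[] //|none].
  have [E' [E'H E'E SE']] := not_ownP SE nS.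
  by have := none E'; rewrite E'H E'E SE'.
pose B' := B :|: [set other S | S in M].
have B'H : B' \subset H.
  by rewrite subUset BH; apply/subsetP => _ /imsetP[S /otherP[? _ _] ->].
have EB' : E \notin B'.
  rewrite inE negb_or EB; apply/imsetP => -[S /otherP[_ + _] Eo].
  by rewrite -Eo eqxx.
have cB' : #|B'| <= t.
  apply: leq_trans (leq_card_setU _ _).1 _.
  apply: leq_trans (leq_add Ba (leq_imset_card _ _)) _.
  by rewrite cM subnKC // ltnW.
have EcB' : E \subset cover B'.
  apply/subsetP => x xE; case: (boolP (x \in cover M)) => [/bigcupP[S SM xS]|xM].
    have [_ _ /subsetP/(_ x xS) xo] := otherP S SM.
    by apply/bigcupP; exists (other S); rewrite // inE imset_f ?orbT.
  have /bigcupP[D DB xD] : x \in cover B by apply: (subsetP XB); rewrite inE xM.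
  by apply/bigcupP; exists D; rewrite // inE DB.
have /union_freeP ufP := uf.
(* Both families have the same union and at most [t + 1] members. *)
have : E |: B' = B'.
  apply: ufP => //.
  - by rewrite subUset sub1set EH.
  - by rewrite cardsU1 addnC leq_add // leq_b1.
  - by rewrite (leq_trans cB') // leq_addr.
  - by rewrite /cover bigcup_setU big_set1; apply/setUidPr.
by move/setP/(_ E); rewrite setU11 (negbTE EB').
Qed.

Lemma union_free_card_le (T : finType) (H : {set {set T}}) (t k a : nat) :
  0 < k -> a < t -> uniform (t * k - a) H -> union_free (t + 1) H ->
  ('C(t * k - a, k) - max_matching_free (t * k - a) k (t - a - 1)) * #|H| <=
  'C(#|T|, k) +
  ('C(t * k - a, k) - max_matching_free (t * k - a) k (t - a - 1)) * 'C(#|T|, k.-1).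
Proof.
move=> k0 at1 unif uf; set g := _ - _.
pose H1 := [set E in H | own_sets H k.-1 E != set0].
have cH1 : #|H1| <= 'C(#|T|, k.-1).
  apply: leq_trans (sum_own_sets H k.-1); rewrite -sum1_card.
  rewrite big_mkcond [leqRHS]big_mkcond; apply: leq_sum => E _; rewrite inE.
  by case: (E \in H) => //=; case: ifP => //; rewrite -card_gt0.
rewrite -(cardsID H1 H) addnC mulnDr leq_add //; last first.
  rewrite leq_mul2l; apply/orP; right; apply: leq_trans cH1.
  by apply: subset_leq_card; apply: subsetIr.
apply: leq_trans (sum_own_sets H k); rewrite mulnC -sum_nat_const.
rewrite big_mkcond [leqRHS]big_mkcond; apply: leq_sum => E _; rewrite !inE.
case: (boolP (E \in H)) => EH; rewrite ?andbF // andbT negbK.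
by case: eqP => // own0; apply: card_own_sets_ge.
Qed.

(** * The extremal families without large matchings *)

Lemma exists_max_matching_free (r k l : nat) :
  exists F : {set {set 'I_r}},
    [/\ uniform k F, ~~ has_matching l.+1 F & #|F| = max_matching_free r k l].
Proof.
have P0 : uniform k (set0 : {set {set 'I_r}}) && ~~ has_matching l.+1 (set0 : {set {set 'I_r}}).
  apply/andP; split; first by apply/forall_inP => E; rewrite inE.
  apply/negP => /existsP[M /and3P[]]; rewrite subset0 => /eqP->.
  by rewrite cards0.
have pos : 0 < #|[pred H : {set {set 'I_r}} | uniform k H && ~~ has_matching l.+1 H]|.
  by apply/card_gt0P; exists set0; rewrite inE.
have [F /andP[uF mF] eF] := eq_bigmax_cond (fun H : {set {set 'I_r}} => #|H|) pos.
by exists F; split=> //; rewrite /max_matching_free -eF; apply: eq_bigl.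
Qed.

(** This makes the denominator of the limit positive. The [l.+1] consecutive intervals of length [k]
    in ['I_r] are disjoint, so a family without [l.+1] disjoint members omits one of them. *)
Lemma max_matching_free_lt (r k l : nat) :
  0 < k -> l.+1 * k <= r -> max_matching_free r k l < 'C(r, k).
Proof.
move=> k0 lr; have [F [/forall_inP uF mF <-]] := exists_max_matching_free r k l.
rewrite -[X in 'C(X, _)]card_ord -card_draws; apply: proper_card.
apply/properP; split; first by apply/subsetP => S SF; rewrite inE uF.
pose block (j : 'I_l.+1) : {set 'I_r} := [set i : 'I_r | i %/ k == j].
have card_block j : #|block j| = k.
  pose emb (i : 'I_k) : 'I_r := insubd (Ordinal (leq_trans (leq_trans k0 (leq_pmull k (ltn0Sn l))) lr)) (j * k + i).
  have embE i : emb i = j * k + i :> nat.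
    rewrite /emb insubdK //; apply: leq_trans _ (lr).
    by have := ltn_ord i; have := ltn_ord j; move: (i : nat) (j : nat); clear; nia.
  have -> : block j = [set emb i | i in 'I_k].
    apply/setP => i; rewrite inE; apply/eqP/imsetP => [ij|[i' _ ->]]; last first.
      by rewrite embE divnMDl // divn_small ?addn0.
    exists (Ordinal (ltn_pmod i k0)) => //; apply/val_inj; rewrite /= embE /=.
    by rewrite -ij -divn_eq.
  rewrite card_imset ?card_ord // => i i' /(congr1 val); rewrite /= !embE => /addnI.
  exact: val_inj.
have dis j j' : j != j' -> [disjoint block j & block j'].
  move=> jj; rewrite -setI_eq0; apply/eqP/setP => i; rewrite !inE.
  by apply/negP => /andP[/eqP e1 /eqP e2]; case/negP: jj; apply/eqP/val_inj; rewrite /= -e1.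
have [j jF|allF] := pickP (fun j => block j \notin F).
  by exists (block j) => //; rewrite inE card_block.
have /negP[] := mF.
apply: (has_matching_leq (M := [set block j | j in 'I_l.+1])).
- by apply/subsetP => _ /imsetP[j _ ->]; have := allF j => /negbFE.
- rewrite card_imset ?card_ord // => j j' e; apply/eqP; apply: contraT => /dis.
  by rewrite e -setI_eq0 setIid -cards_eq0 card_block eqn0Ngt k0.
- apply/trivIsetP => _ _ /imsetP[j _ ->] /imsetP[j' _ ->] neq.
  by apply: dis; apply: contraNneq neq => ->.
Qed.

(** * Averages over finite probability spaces *)

Local Open Scope ring_scope.

Lemma ler_sum_setU (R : numDomainType) (T : finType) (B C : {set T}) (f : T -> R) :
  (forall x, 0 <= f x) ->
  \sum_(x in B :|: C) f x <= \sum_(x in B) f x + \sum_(x in C) f x.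
Proof.
move=> f0; rewrite !(big_mkcond (fun x => x \in _)) /= -big_split /=.
apply: ler_sum => x _; rewrite inE.
by case: (x \in B); case: (x \in C); rewrite /= ?addr0 ?add0r // lerDl.
Qed.

(** Expectation for the uniform distribution; probabilities are averages of indicators. *)
Definition avg (R : numFieldType) (T : finType) (f : T -> R) : R :=
  (\sum_t f t) / #|T|%:R.

Section Average.
Variables (R : numFieldType) (T : finType).
Implicit Types f g : T -> R.

Lemma eq_avg f g : f =1 g -> avg f = avg g.
Proof. by move=> fg; rewrite /avg (eq_bigr g). Qed.

Lemma ler_avg f g : (forall t, f t <= g t) -> avg f <= avg g.
Proof.
move=> fg; rewrite /avg ler_wpM2r ?invr_ge0 ?ler0n //.
by apply: ler_sum => t _; apply: fg.
Qed.

Lemma avgD f g : avg (fun t => f t + g t) = avg f + avg g.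
Proof. by rewrite /avg big_split mulrDl. Qed.

Lemma avgB f g : avg (fun t => f t - g t) = avg f - avg g.
Proof. by rewrite /avg sumrB mulrBl. Qed.

Lemma avgZ a f : avg (fun t => a * f t) = a * avg f.
Proof. by rewrite /avg -mulr_sumr mulrA. Qed.

Lemma avg_sum (J : Type) (r : seq J) (P : pred J) (F : J -> T -> R) :
  avg (fun t => \sum_(j <- r | P j) F j t) = \sum_(j <- r | P j) avg (F j).
Proof. by rewrite /avg exchange_big mulr_suml. Qed.

Hypothesis T_gt0 : (0 < #|T|)%N.

Lemma avg_const (a : R) : avg (fun _ : T => a) = a.
Proof.
by rewrite /avg sumr_const -[_ *+ _]mulr_natr mulfK // pnatr_eq0 -lt0n.
Qed.

End Average.

Lemma exists_le_avg (R : realFieldType) (T : finType) (f : T -> R) :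
  (0 < #|T|)%N -> exists t, f t <= avg f.
Proof.
move=> T_gt0; apply/existsP; apply: contraT; rewrite negb_exists => /forallP lt_f.
suff: avg f < avg f by rewrite ltxx.
have T0 : 0 < #|T|%:R :> R by rewrite ltr0n.
rewrite {2}/avg ltr_pdivlMr // mulr_natr -sumr_const.
have /card_gt0P[t0 _] := T_gt0.
rewrite (bigD1 t0) //= [ltRHS](bigD1 t0) //= ltr_leD //.
  by move: (lt_f t0); rewrite -ltNge.
by apply: ler_sum => t _; move: (lt_f t); rewrite -ltNge => /ltW.
Qed.

(** Independence of the values of a uniformly random function. *)
Lemma avg_ffun_prod (R : numFieldType) (I T : finType) (h : I -> T -> R) :
  avg (fun c : {ffun I -> T} => \prod_i h i (c i)) = \prod_i avg (h i).
Proof.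
rewrite /avg -bigA_distr_bigA /= big_split /=; congr (_ * _).
by rewrite prodr_const card_ffun natrX exprVn.
Qed.

Lemma avg_cylinder (R : numFieldType) (I T : finType) (S : {set I})
    (P : I -> pred T) : (0 < #|T|)%N ->
  avg (fun c : {ffun I -> T} => [forall i in S, P i (c i)]%:R) =
  \prod_(i in S) avg (fun z => (P i z)%:R) :> R.
Proof.
move=> T_gt0; rewrite [RHS]big_mkcond /=.
transitivity (\prod_i avg (fun z => if i \in S then (P i z)%:R else 1 : R)); last first.
  by apply: eq_bigr => i _; case: ifP => // _; rewrite avg_const.
rewrite -avg_ffun_prod; apply: eq_avg => c.
rewrite -big_mkcond /=; case: (boolP [forall i in S, _]) => [/forall_inP PS|].
  by rewrite big1 // => i /PS ->.
rewrite negb_forall => /existsP[i]; rewrite negb_imply => /andP[iS nP].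
by rewrite (bigD1 i) //= (negbTE nP) mul0r.
Qed.

Lemma avg_pred1 (R : numFieldType) (T : finType) (a : T) :
  avg (fun z => (z == a)%:R) = #|T|%:R^-1 :> R.
Proof.
rewrite /avg (bigD1 a) //= eqxx big1 ?addr0 ?div1r // => z.
by move/negbTE=> ->.
Qed.

Lemma avg_predC1 (R : numFieldType) (T : finType) (a : T) :
  avg (fun z => (z != a)%:R) = 1 - #|T|%:R^-1 :> R.
Proof.
have T_gt0 : (0 < #|T|)%N by apply/card_gt0P; exists a.
rewrite -(avg_pred1 R a) -[X in X - _](avg_const T_gt0) -avgB.
by apply: eq_avg => z; case: (z == a); rewrite ?subrr ?subr0.
Qed.

Lemma avg_agree (R : numFieldType) (I T : finType) (S : {set I}) (v : I -> T) :
  (0 < #|T|)%N ->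
  avg (fun c : {ffun I -> T} => [forall i in S, c i == v i]%:R) =
  #|T|%:R^-1 ^+ #|S| :> R.
Proof.
move=> T_gt0; rewrite (avg_cylinder R S (fun i z => z == v i)) //.
by rewrite (eq_bigr (fun=> #|T|%:R^-1)) ?prodr_const // => i _; rewrite avg_pred1.
Qed.

Lemma avg_avoid (R : numFieldType) (I T : finType) (S : {set I}) (a : T) :
  avg (fun c : {ffun I -> T} => [forall i in S, c i != a]%:R) =
  (1 - #|T|%:R^-1) ^+ #|S| :> R.
Proof.
have T_gt0 : (0 < #|T|)%N by apply/card_gt0P; exists a.
rewrite (avg_cylinder R S (fun i z => z != a)) //.
rewrite (eq_bigr (fun=> 1 - #|T|%:R^-1)) ?prodr_const // => i _.
by rewrite avg_predC1.
Qed.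

(** * Nearly perfect matchings in linear hypergraphs *)

Lemma prodr_dist (R : realFieldType) (T : finType) (B : {set T}) (a b : T -> R) :
  (forall x, 0 <= a x <= 1) -> (forall x, 0 <= b x <= 1) ->
  `|\prod_(x in B) a x - \prod_(x in B) b x| <= \sum_(x in B) `|a x - b x|.
Proof.
move=> a01 b01.
suff [] : [/\ 0 <= \prod_(x in B) a x <= 1, 0 <= \prod_(x in B) b x <= 1 &
  `|\prod_(x in B) a x - \prod_(x in B) b x| <= \sum_(x in B) `|a x - b x| ] by [].
elim/big_rec3: _ => [|x s u v _ [v01 u01 uv]].
  by rewrite subrr normr0 !lexx ler01.
have /andP[a0 a1] := a01 x; have /andP[b0 b1] := b01 x.
move: u01 v01 => /andP[u0 u1] /andP[v0 v1]; split.
- by rewrite mulr_ge0 // mulr_ile1.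
- by rewrite mulr_ge0 // mulr_ile1.
have -> : a x * v - b x * u = (a x - b x) * v + b x * (v - u) by ring.
rewrite (le_trans (ler_normD _ _)) // lerD //.
  by rewrite normrM (ger0_norm v0) ler_piMr.
by rewrite normrM (ger0_norm b0) (le_trans _ uv) // ler_piMl.
Qed.

(** Dropping [o] factors [1 - p] raises the power by at most [p * o]. The case [o = s] is
    Bernoulli's inequality. *)
Lemma exprB_le (R : realFieldType) (p : R) (s o : nat) :
  0 <= p <= 1 -> (1 - p) ^+ (s - o) <= (1 - p) ^+ s + p * o%:R.
Proof.
move=> /andP[p0 p1]; have u0 : 0 <= 1 - p by rewrite subr_ge0.
have u1 : 1 - p <= 1 by lra.
elim: o => [|o IH]; first by rewrite subn0 mulr0 addr0.
case: (leqP s o) => [so|os].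
  have -> : (s - o.+1 = s - o)%N by lia.
  by rewrite (le_trans IH) // lerD2l ler_wpM2l // ler_nat.
have E : (s - o = (s - o.+1).+1)%N by lia.
move: IH; rewrite E exprS [in X in _ -> X]mulrSr.
have : p * (1 - p) ^+ (s - o.+1) <= p.
  by rewrite ler_piMr // exprn_ile1.
nra.
Qed.

Lemma expr_dist (R : realFieldType) (p : R) (m d : nat) :
  0 <= p <= 1 -> `|(1 - p) ^+ m - (1 - p) ^+ d| <= p * `|m%:R - d%:R|.
Proof.
move=> p01; wlog md : m d / (m <= d)%N.
  by case: (leqP m d) => [md|/ltnW dm] H; [exact: H|rewrite distrC (distrC m%:R) H].
have := exprB_le d (d - m) p01; rewrite subKn // natrB //.
rewrite (distrC m%:R) [X in _ -> _ <= _ * X]ger0_norm ?subr_ge0 ?ler_nat //.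
rewrite ger0_norm ?subr_ge0; first by lra.
by case/andP: p01 => p0 p1; apply: ler_wiXn2l => //; lra.
Qed.

(** The inequality behind [avg_vertex_second_moment], for a vertex of degree [x]: [q] is about the
    chance that a vertex survives a bite and [w] that of [g - 1] further ones. Up to errors [P1],
    [P2], [P3] are [x ^ 2 * q * w ^ 2], [x * q * w] and [q], so the left side is nearly
    [q * w ^ 2 * (x - D) ^ 2]. *)
Lemma vertex_arith (R : realFieldType) (q w p K D g S x dv P1 P2 P3 : R) :
  0 <= q <= 1 -> 0 <= w <= 1 -> 0 <= p -> p * D <= 1 -> 0 <= D -> 1 <= K ->
  0 <= S -> 0 <= x <= K * D -> dv = `|x - D| ->
  P1 <= x + x ^+ 2 * (q * w ^+ 2 + p * (4 * g ^+ 2)) + 2 * p * x * S ->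
  x * (q * w) - p * S <= P2 -> P3 <= q + p * dv + p ->
  P1 - 2 * (D * w) * P2 + (D * w) ^+ 2 * P3 <=
  K * D * dv + K * D + 4 * g ^+ 2 * K ^+ 2 * D + 4 * p * K * D * S + D * (dv + 1).
Proof.
move=> /andP[q0 q1] /andP[w0 w1] p0 pD D0 K1 S0 /andP[x0 xK] dvE le1 le2 le3.
have K0 : 0 <= K by lra.
have KD0 : 0 <= K * D by rewrite mulr_ge0.
have DK : D <= K * D by rewrite ler_peMl.
have dv0 : 0 <= dv by rewrite dvE.
have dvK : dv <= K * D by rewrite dvE ler_norml; apply/andP; split; lra.
have dv2 : (x - D) ^+ 2 = dv ^+ 2 by rewrite dvE real_normK ?num_real.
have w2 : 0 <= w ^+ 2 <= 1 by rewrite exprn_ge0 ?exprn_ile1.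
have Dw : D * w <= D by rewrite ler_piMr.
have Dw0 : 0 <= D * w by rewrite mulr_ge0.
have h1 : q * w ^+ 2 * (x - D) ^+ 2 <= K * D * dv.
  rewrite dv2 (le_trans (_ : _ <= dv ^+ 2)) //; last by rewrite expr2 ler_wpM2r.
  by case/andP: w2 => *; rewrite ler_piMl ?exprn_ge0 ?mulr_ile1.
have h2 : 4 * p * g ^+ 2 * x ^+ 2 <= 4 * g ^+ 2 * K ^+ 2 * D.
  have le : x ^+ 2 <= (K * D) ^+ 2 by rewrite lerXn2r ?nnegrE.
  have -> : 4 * p * g ^+ 2 * x ^+ 2 = (4 * g ^+ 2) * (p * x ^+ 2) by ring.
  rewrite -[leRHS]mulrA; apply: ler_wpM2l; first by rewrite mulr_ge0 // sqr_ge0.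
  apply: le_trans (ler_wpM2l p0 le) _.
  have -> : p * (K * D) ^+ 2 = (p * D) * (K ^+ 2 * D) by ring.
  by rewrite ler_piMl // mulr_ge0 // sqr_ge0.
have h3 : 2 * p * (x + D * w) * S <= 4 * p * K * D * S.
  apply: ler_wpM2r => //.
  have -> : 4 * p * K * D = 2 * p * (K * D + K * D) by ring.
  by apply: ler_wpM2l; [rewrite mulr_ge0|lra].
have h4 : (D * w) ^+ 2 * (p * (dv + 1)) <= D * (dv + 1).
  have -> : (D * w) ^+ 2 * (p * (dv + 1)) = (p * D) * w ^+ 2 * (D * (dv + 1)) by ring.
  have pD0 : 0 <= p * D by rewrite mulr_ge0.
  case/andP: w2 => w20 w21; apply: ler_piMl.
    by rewrite mulr_ge0 ?addr_ge0.
  exact: mulr_ile1.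
have h5 := ler_wpM2l (sqr_ge0 (D * w)) le3.
have h6 : 2 * (D * w) * (x * (q * w) - p * S) <= 2 * (D * w) * P2.
  by rewrite ler_wpM2l // mulr_ge0.
have -> : K * D * dv + K * D + 4 * g ^+ 2 * K ^+ 2 * D + 4 * p * K * D * S + D * (dv + 1) =
  K * D * dv + (K * D + (4 * g ^+ 2 * K ^+ 2 * D + (4 * p * K * D * S + D * (dv + 1)))) by ring.
apply: le_trans (_ : q * w ^+ 2 * (x - D) ^+ 2 + (x + (4 * p * g ^+ 2 * x ^+ 2 +
   (2 * p * (x + D * w) * S + (D * w) ^+ 2 * (p * (dv + 1))))) <= _); last first.
  by rewrite !lerD.
apply: le_trans (_ : (x + x ^+ 2 * (q * w ^+ 2 + p * (4 * g ^+ 2)) + 2 * p * x * S)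
  - 2 * (D * w) * (x * (q * w) - p * S) + (D * w) ^+ 2 * (q + p * dv + p) <= _).
  by rewrite lerD // lerB.
by rewrite le_eqVlt; apply/orP; left; apply/eqP; ring.
Qed.

Lemma pred_double n : (0 < n)%N -> (2 * n).-1 = (n.-1 * 2).+1.
Proof. lia. Qed.

Lemma pred_double_sqr n : ((2 * n).-1 ^ 2 <= 4 * n ^ 2)%N.
Proof. nia. Qed.

(** * One bite of the nibble *)

Definition edeg (T I : finType) (e : I -> {set T}) (A : {set I}) (x : T) : nat :=
  #|[set i in A | x \in e i]|.

Definition edge_matching (T I : finType) (e : I -> {set T}) (M : {set I}) : Prop :=
  {in M &, forall i j, i != j -> [disjoint e i & e j]}.

Section Bite.
Variables (R : realFieldType) (T I : finType) (e : I -> {set T}).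
Variables (g D : nat) (K delta p : R) (X : {set T}) (A : {set I}) (m : nat).

Hypothesis pE : p = m.+1%:R^-1.
Hypothesis g_gt0 : (0 < g)%N.
Hypothesis card_e : {in A, forall i, #|e i| = g}.
Hypothesis sub_e : {in A, forall i, e i \subset X}.
Hypothesis lin_e : {in A &, forall i j, i != j -> (#|e i :&: e j| <= 1)%N}.

Implicit Types (c : {ffun I -> 'I_m.+1}) (B : {set T}).

(* One colour class of a uniform colouring with [m.+1] colours is a random set of
   edges of density [p]. *)
Definition bite c : {set I} := [set i in A | c i == ord0].
Definition covered c : {set T} := \bigcup_(i in bite c) e i.
Definition leave c : {set T} := X :\: covered c.
Definition survivors c : {set I} := [set i in A | e i \subset leave c].
Definition hits B : {set I} := [set i in A | ~~ [disjoint e i & B]].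
Definition isolated c : {set I} :=
  [set i in bite c | [forall j in bite c, (j != i) ==> [disjoint e i & e j]]].
Definition clashes c : {set I * I} :=
  [set ij in setX (bite c) (bite c) |
     (ij.1 != ij.2) && ~~ [disjoint e ij.1 & e ij.2]].

Local Notation dg x := ((edeg e A x)%:R : R).
Local Notation q := ((1 - p) ^+ D).
Local Notation dev x := `|dg x - D%:R|.

(** Survival of a whole set becomes an event on independent colours: no edge meeting [B] is bitten.
    Its probability is therefore an exact power of [1 - p]. *)
Lemma sub_leave B c :
  B \subset X -> (B \subset leave c) = [forall i in hits B, c i != ord0].
Proof.
move=> BX; rewrite subsetD BX /=.
apply/idP/forall_inP => [dis i | avoid].
  rewrite inE => /andP[iA /pred0Pn[x /andP[xi xB]]]; apply/negP => ci.
  have /negP[] := negbT (disjointFr dis xB).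
  by apply/bigcupP; exists i; rewrite ?inE ?iA.
apply/pred0P => x /=; apply/negP => /andP[xB /bigcupP[i]].
rewrite inE => /andP[iA ci] xi.
have := avoid i; rewrite ci; move=> H; suff: i \in hits B by move=> /H.
by rewrite inE iA; apply/pred0Pn; exists x; rewrite /= xi.
Qed.

Lemma avg_sub_leave B : B \subset X ->
  avg (fun c => (B \subset leave c)%:R) = (1 - p) ^+ #|hits B|.
Proof.
move=> BX; under eq_avg => c do rewrite sub_leave //.
by rewrite avg_avoid card_ord pE.
Qed.

Lemma hits0 : hits set0 = set0.
Proof.
apply/setP => i; rewrite !inE; apply/negbTE; rewrite negb_and negbK.
by rewrite disjoint_sym disjoints_subset sub0set orbT.
Qed.

Lemma hitsU1 x B : hits (x |: B) = [set i in A | x \in e i] :|: hits B.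
Proof.
apply/setP => i; rewrite !inE -!setI_eq0 setIUr setU_eq0 negb_and.
by rewrite !setI_eq0 (disjoint_sym _ [set x]) disjoints1 negbK andb_orr.
Qed.

Lemma card_hits_le B : (#|hits B| <= \sum_(x in B) edeg e A x)%N.
Proof.
elim/set_ind: B => [|x B xB IH] //; first by rewrite hits0 cards0.
rewrite big_setU1 //= hitsU1; apply: leq_trans (leq_add (leqnn _) IH).
by rewrite cardsU leq_subr.
Qed.

(** By linearity a new vertex shares at most one edge with each vertex already in [B]; overcounting
    amounts to at most [#|B| ^ 2]. *)
Lemma card_hits_ge B : (\sum_(x in B) edeg e A x - #|B| ^ 2 <= #|hits B|)%N.
Proof.
elim/set_ind: B => [|x B xB IH] //; first by rewrite big_set0.
rewrite big_setU1 //= cardsU1 xB add1n hitsU1 cardsU.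
have common : (#|[set i in A | x \in e i] :&: hits B| <= #|B|)%N.
  have pair1 y : y \in B -> (#|[set i in A | (x \in e i) && (y \in e i)]| <= 1)%N.
    move=> yB; apply/card_le1_eqP => i j.
    rewrite !inE => /and3P[iA xi yi] /and3P[jA xj yj].
    apply/esym/eqP; apply: contraT => /(lin_e iA jA); rewrite leqNgt => /negP[].
    have xy : x != y by apply: contraNneq xB => ->.
    rewrite (leq_trans _ (subset_leq_card (A := mem [set x; y]) _)) ?cards2 ?xy //.
    by apply/subsetP => z; rewrite !inE => /orP[] /eqP ->; rewrite ?xi ?xj ?yi ?yj.
  apply: leq_trans (_ : \sum_(y in B) 1 <= _)%N; last by rewrite sum1_card.
  apply: leq_trans (_ : \sum_(y in B) #|[set i in A | (x \in e i) && (y \in e i)]| <= _)%N; last first.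
    exact: leq_sum.
  apply: leq_trans (leq_card_bigcup _ _).
  apply: subset_leq_card; apply/subsetP => i.
  rewrite !inE => /andP[/andP[iA xi] /andP[_ /pred0Pn[y /andP[yi yB]]]].
  by apply/bigcupP; exists y; rewrite ?inE ?iA ?xi.
have := leq_add (leqnn (edeg e A x)) IH; rewrite /edeg in common *; nia.
Qed.

Lemma p01 : 0 <= p <= 1.
Proof. by rewrite pE invr_ge0 ler0n invf_le1 ?ltr0n // ler1n. Qed.

Lemma u01 : 0 <= 1 - p <= 1.
Proof. by have /andP[? ?] := p01; apply/andP; split; lra. Qed.

Lemma prod_leave_dist B :
  `|\prod_(x in B) (1 - p) ^+ edeg e A x - q ^+ #|B| | <=
  p * \sum_(x in B) dev x.
Proof.
have pw n : 0 <= (1 - p) ^+ n <= 1.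
  by have /andP[u0 u1] := u01; rewrite exprn_ge0 // exprn_ile1.
rewrite -prodr_const (le_trans (prodr_dist _ _ _)) // mulr_sumr.
by apply: ler_sum => x _; apply: expr_dist; apply: p01.
Qed.

Lemma avg_leave_ge B : B \subset X ->
  q ^+ #|B| - p * \sum_(x in B) dev x <= avg (fun c => (B \subset leave c)%:R).
Proof.
move=> BX; rewrite avg_sub_leave //.
have /andP[u0 u1] := u01.
have := prod_leave_dist B; rewrite prodrXr ler_norml => /andP[le1 _].
have : (1 - p) ^+ (\sum_(x in B) edeg e A x) <= (1 - p) ^+ #|hits B|.
  by apply: ler_wiXn2l => //; apply: card_hits_le.
lra.
Qed.

Lemma avg_leave_le B : B \subset X ->
  avg (fun c => (B \subset leave c)%:R) <=
  q ^+ #|B| + p * \sum_(x in B) dev x + p * (#|B| ^ 2)%:R.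
Proof.
move=> BX; rewrite avg_sub_leave //.
have /andP[u0 u1] := u01.
have := prod_leave_dist B; rewrite prodrXr ler_norml => /andP[_ le1].
have le2 : (1 - p) ^+ #|hits B| <= (1 - p) ^+ (\sum_(x in B) edeg e A x - #|B| ^ 2).
  by apply: ler_wiXn2l => //; apply: card_hits_ge.
have := exprB_le (\sum_(x in B) edeg e A x) (#|B| ^ 2) p01.
lra.
Qed.

Hypothesis K_ge1 : 1 <= K.
Hypothesis deg_le : {in X, forall x, dg x <= K * D%:R}.
Hypothesis deg_dev : \sum_(x in X) dev x <= delta * D%:R * #|X|%:R.
Hypothesis pD_le1 : p * D%:R <= 1.
Hypothesis deltaD : 1 <= delta * D%:R.

Lemma delta_ge0 : 0 <= delta.
Proof.
rewrite leNgt; apply/negP => d0.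
by have := le_trans deltaD (mulr_le0_ge0 (ltW d0) (ler0n R D)); rewrite ler10.
Qed.

Lemma avg_card_leave : avg (fun c => #|leave c|%:R) <= (q + delta) * #|X|%:R.
Proof.
have -> : avg (fun c => #|leave c|%:R) =
    \sum_(x in X) avg (fun c => ([set x] \subset leave c)%:R) :> R.
  rewrite -avg_sum; apply: eq_avg => c; rewrite -sum1_card natr_sum.
  rewrite [LHS]big_mkcond [RHS]big_mkcond; apply: eq_bigr => x _.
  rewrite sub1set; case: (boolP (x \in leave c)) => [xl|]; last by case: ifP.
  by have := xl; rewrite inE => /andP[_ ->].
apply: le_trans (_ : \sum_(x in X) (q + p * dev x) <= _).
  apply: ler_sum => x xX; rewrite avg_sub_leave ?sub1set //.
  have -> : hits [set x] = [set i in A | x \in e i].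
    by apply/setP => i; rewrite !inE disjoint_sym disjoints1 negbK.
  have := expr_dist (edeg e A x) D p01; rewrite ler_norml /edeg; lra.
rewrite big_split /= sumr_const -mulr_sumr (mulrDl q delta) -(mulr_natr q) lerD2l.
have /andP[p0 p1] := p01.
apply: le_trans (ler_wpM2l p0 deg_dev) _.
have -> : p * (delta * D%:R * #|X|%:R) = (p * D%:R) * (delta * #|X|%:R) by ring.
by rewrite ler_piMl // mulr_ge0 // delta_ge0.
Qed.

Lemma sum_edges_at (f : T -> I -> R) :
  \sum_(x in X) \sum_(i in A | x \in e i) f x i =
  \sum_(i in A) \sum_(x in e i) f x i.
Proof.
rewrite (exchange_big_dep (mem A)) /=; last by move=> x i _ /andP[].
apply: eq_bigr => i iA; apply: eq_bigl => x; rewrite iA /=.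
case: (boolP (x \in e i)) => xi; rewrite ?andbF // andbT.
by apply: (subsetP (sub_e iA)).
Qed.

Lemma degE x : dg x = \sum_(i in A | x \in e i) 1.
Proof.
rewrite /edeg -sum1_card natr_sum; apply: eq_bigl => i; by rewrite inE.
Qed.

Local Notation d := (D%:R * q ^+ g.-1).
Local Notation dev_edge i := (\sum_(y in e i) dev y).

Lemma survivors_degE c x :
  (edeg e (survivors c) x)%:R =
  \sum_(i in A | x \in e i) (e i \subset leave c)%:R :> R.
Proof.
rewrite /edeg -sum1_card natr_sum.
rewrite (eq_bigl (fun i => ((i \in A) && (x \in e i)) && (e i \subset leave c))).
  by rewrite big_mkcondr; apply: eq_bigr => i _; case: (_ \subset _).
by move=> i; rewrite !inE andbAC.
Qed.

Lemma survivors_deg_le c x : (edeg e (survivors c) x <= edeg e A x)%N.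
Proof.
by apply: subset_leq_card; apply/subsetP => i; rewrite !inE => /andP[/andP[-> _] ->].
Qed.

(** Expanding the square leaves only indicators of sets contained in the leave, whose averages are
    known. A vertex outside the leave has surviving degree 0, so the sum may run over all of [X]
    once the constant term carries the indicator of survival. *)
Lemma leave_second_moment c :
  \sum_(x in leave c) ((edeg e (survivors c) x)%:R - d) ^+ 2 =
  \sum_(x in X) (\sum_(i in A | x \in e i) \sum_(j in A | x \in e j)
       (e i :|: e j \subset leave c)%:R
     - 2 * d * \sum_(i in A | x \in e i) (e i \subset leave c)%:R
     + d ^+ 2 * ([set x] \subset leave c)%:R).
Proof.
rewrite [LHS]big_mkcond [RHS]big_mkcond; apply: eq_bigr => x _.
rewrite -survivors_degE sub1set.
have -> : \sum_(i in A | x \in e i) \sum_(j in A | x \in e j)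
    (e i :|: e j \subset leave c)%:R = (edeg e (survivors c) x)%:R ^+ 2 :> R.
  rewrite survivors_degE expr2 mulr_suml; apply: eq_bigr => i _.
  by rewrite mulr_sumr; apply: eq_bigr => j _; rewrite -natrM mulnb subUset.
case: (boolP (x \in leave c)) => [xl|xNl].
  by have := xl; rewrite inE => /andP[_ ->] /=; ring.
suff -> : edeg e (survivors c) x = 0%N by case: ifP => // _ /=; ring.
apply: eq_card0 => i; rewrite !inE; apply/negP => /andP[/andP[_ /subsetP il] xi].
by rewrite il in xNl.
Qed.

Lemma sum_at_const x (a : R) : \sum_(i in A | x \in e i) a = dg x * a.
Proof. by rewrite degE mulr_suml; apply: eq_bigr => i _; rewrite mul1r. Qed.

Lemma avg_vertex_second_moment x : x \in X ->
  \sum_(i in A | x \in e i) \sum_(j in A | x \in e j)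
       avg (fun c => (e i :|: e j \subset leave c)%:R)
     - 2 * d * \sum_(i in A | x \in e i) avg (fun c => (e i \subset leave c)%:R)
     + d ^+ 2 * avg (fun c => ([set x] \subset leave c)%:R) <=
  K * D%:R * dev x + K * D%:R + 4 * g%:R ^+ 2 * K ^+ 2 * D%:R
  + 4 * p * K * D%:R * (\sum_(i in A | x \in e i) dev_edge i) + D%:R * (dev x + 1).
Proof.
move=> xX; have /andP[p0 p1] := p01; have /andP[u0 u1] := u01.
set S := \sum_(i in A | x \in e i) dev_edge i.
have S0 : 0 <= S by apply: sumr_ge0 => i _; apply: sumr_ge0.
have q0 : 0 <= q by rewrite exprn_ge0.
have q1 : q <= 1 by rewrite exprn_ile1.
have d0 : 0 <= d by rewrite mulr_ge0 ?exprn_ge0.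
have dD : d <= D%:R by rewrite ler_piMr // exprn_ile1.
have dg0 : 0 <= dg x by [].
have dgK := deg_le xX.
have pair_bound i j : i \in A -> x \in e i -> j \in A -> x \in e j ->
    avg (fun c => (e i :|: e j \subset leave c)%:R) <=
    (i == j)%:R + (q ^+ (2 * g).-1 + p * (4 * g%:R ^+ 2))
      + p * dev_edge i + p * dev_edge j.
  move=> iA xi jA xj.
  have dev0 l : 0 <= p * dev_edge l by rewrite mulr_ge0 // sumr_ge0.
  case: eqP => [<-|/eqP ij] /=.
    have le1 : avg (fun c => (e i :|: e i \subset leave c)%:R) <= 1 :> R.
      have c_gt0 : (0 < #|{ffun I -> 'I_m.+1}|)%N by rewrite card_ffun card_ord expn_gt0.
      rewrite -[leRHS](avg_const c_gt0); apply: ler_avg => c.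
      by rewrite lern1 leq_b1.
    have : 0 <= q ^+ (2 * g).-1 + p * (4 * g%:R ^+ 2).
      by rewrite addr_ge0 ?exprn_ge0 // mulr_ge0 // mulr_ge0 // exprn_ge0.
    by have := dev0 i; lra.
  have cardU : #|e i :|: e j| = (2 * g).-1.
    rewrite cardsU !card_e //.
    have -> : #|e i :&: e j| = 1%N.
      apply/eqP; rewrite eqn_leq lin_e //= card_gt0; apply/set0Pn; exists x.
      by rewrite inE xi.
    by rewrite addnn -mul2n subn1.
  have UX : e i :|: e j \subset X by rewrite subUset !sub_e.
  apply: le_trans (avg_leave_le UX) _; rewrite cardU add0r.
  have : \sum_(y in e i :|: e j) dev y <= dev_edge i + dev_edge j.
    exact: ler_sum_setU.
  have : ((2 * g).-1 ^ 2)%:R <= 4 * g%:R ^+ 2 :> R.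
    by rewrite -natrX -natrM ler_nat pred_double_sqr.
  nra.
have pairs : \sum_(i in A | x \in e i) \sum_(j in A | x \in e j)
       avg (fun c => (e i :|: e j \subset leave c)%:R) <=
    dg x + dg x ^+ 2 * (q ^+ (2 * g).-1 + p * (4 * g%:R ^+ 2)) + 2 * p * dg x * S.
  move: (q ^+ (2 * g).-1 + p * (4 * g%:R ^+ 2)) pair_bound => cst pair_bound.
  apply: le_trans (_ : \sum_(i in A | x \in e i) \sum_(j in A | x \in e j)
      ((i == j)%:R + cst + p * dev_edge i + p * dev_edge j) <= _).
    apply: ler_sum => i /andP[iA xi]; apply: ler_sum => j /andP[jA xj].
    exact: pair_bound.
  have inner_sum i : (i \in A) && (x \in e i) ->
      \sum_(j in A | x \in e j) ((i == j)%:R + cst + p * dev_edge i + p * dev_edge j) =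
      1 + dg x * cst + dg x * (p * dev_edge i) + p * S.
    move=> Ai; rewrite !big_split /= !sum_at_const -mulr_sumr -/S; congr (_ + _ + _ + _).
    rewrite (bigD1 i) //= eqxx big1 ?addr0 // => j /andP[_ /negbTE].
    by rewrite eq_sym => ->.
  rewrite (eq_bigr _ inner_sum) !big_split /= !sum_at_const -!mulr_sumr -/S.
  by rewrite le_eqVlt; apply/orP; left; apply/eqP; ring.
have singles : dg x * q ^+ g - p * S <=
    \sum_(i in A | x \in e i) avg (fun c => (e i \subset leave c)%:R).
  rewrite degE mulr_suml /S mulr_sumr -sumrB; apply: ler_sum => i /andP[iA xi].
  by rewrite mul1r -(card_e iA) avg_leave_ge // sub_e.
have vert : avg (fun c => ([set x] \subset leave c)%:R) <= q + p * dev x + p.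
  have xX' : [set x] \subset X by rewrite sub1set.
  by have := avg_leave_le xX'; rewrite cards1 big_set1 expr1 mulr1.
have E1 : q ^+ g = q * q ^+ g.-1 by rewrite -exprS prednK.
have E2 : q ^+ (2 * g).-1 = q * (q ^+ g.-1) ^+ 2.
  by rewrite pred_double // exprS exprM.
have w01 : 0 <= q ^+ g.-1 <= 1 by rewrite exprn_ge0 ?exprn_ile1.
rewrite E1 in singles; rewrite E2 in pairs.
apply: (vertex_arith (q := q) (x := dg x)) => //.
- by rewrite q0.
- by rewrite dg0.
Qed.

(** The deviation of an edge is counted once at each of its [g] vertices; exchanging sums again, a
    vertex contributes its deviation once per edge through it, at most [K * D] times. *)
Lemma sum_dev_edges :
  \sum_(x in X) \sum_(i in A | x \in e i) dev_edge i <=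
  g%:R * (K * D%:R) * \sum_(x in X) dev x.
Proof.
rewrite (sum_edges_at (fun _ i => dev_edge i)).
rewrite (eq_bigr (fun i => g%:R * dev_edge i)); last first.
  by move=> i iA; rewrite sumr_const card_e // mulr_natl.
rewrite -mulr_sumr -(sum_edges_at (fun y _ => dev y)) -mulrA ler_wpM2l //.
rewrite mulr_sumr; apply: ler_sum => x xX.
rewrite (eq_bigr (fun=> 1 * dev x)) => [|i _]; last by rewrite mul1r.
by rewrite -mulr_suml -degE ler_wpM2r // deg_le.
Qed.

(** Sum of the coefficients of the error terms: [K] and [1] from the deviation at the vertex itself,
    [K + 4 * g ^ 2 * K ^ 2 + 1] from the terms linear in [D], and [4 * g * K ^ 2] from the
    deviations at neighbours. *)
Definition bite_const : R := 2 * K + 4 * g%:R ^+ 2 * K ^+ 2 + 4 * g%:R * K ^+ 2 + 2.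

Lemma avg_leave_second_moment :
  avg (fun c => \sum_(x in leave c) ((edeg e (survivors c) x)%:R - d) ^+ 2) <=
  bite_const * delta * D%:R ^+ 2 * #|X|%:R.
Proof.
under eq_avg => c do rewrite leave_second_moment.
rewrite avg_sum.
apply: le_trans (_ : \sum_(x in X) (K * D%:R * dev x + K * D%:R
    + 4 * g%:R ^+ 2 * K ^+ 2 * D%:R
    + 4 * p * K * D%:R * (\sum_(i in A | x \in e i) dev_edge i)
    + D%:R * (dev x + 1)) <= _).
  apply: ler_sum => x xX; rewrite avgD avgB avgZ avgZ !avg_sum.
  under eq_bigr => i _ do rewrite avg_sum.
  exact: avg_vertex_second_moment.
have cst (a : R) : \sum_(x in X) a = a * #|X|%:R by rewrite sumr_const mulr_natr.
rewrite !big_split /= -!mulr_sumr !cst big_split /= cst.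
have := sum_dev_edges; have := deg_dev.
set Sd := \sum_(x in X) dev x; set SS := \sum_(x in X) \sum_(i in A | _) _.
set n := #|X|%:R : R => le1 le2.
have [p0 p1] := andP p01.
have n0 : 0 <= n by [].
have D0 : 0 <= D%:R :> R by [].
have Sd0 : 0 <= Sd by apply: sumr_ge0.
have dl0 := delta_ge0.
move: (D%:R) pD_le1 deltaD le1 le2 D0 => Dr pD dD le1 le2 D0.
have K0 : 0 <= K := le_trans ler01 K_ge1.
(* The assumption [1 <= delta * D] absorbs the terms linear in [D]. *)
have DD : Dr <= delta * Dr ^+ 2.
  by rewrite expr2 mulrA ler_peMl.
have h1 : K * Dr * Sd <= K * (delta * Dr ^+ 2 * n).
  have -> : K * (delta * Dr ^+ 2 * n) = K * Dr * (delta * Dr * n) by ring.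
  by rewrite ler_wpM2l // mulr_ge0.
have h2 : (K + 4 * g%:R ^+ 2 * K ^+ 2 + 1) * (Dr * n) <=
          (K + 4 * g%:R ^+ 2 * K ^+ 2 + 1) * (delta * Dr ^+ 2 * n).
  apply: ler_wpM2l; last exact: ler_wpM2r.
  by rewrite !addr_ge0 // !mulr_ge0 // exprn_ge0.
have h3 : 4 * p * K * Dr * SS <= 4 * g%:R * K ^+ 2 * (delta * Dr ^+ 2 * n).
  apply: le_trans (ler_wpM2l _ le2) _; first by rewrite !mulr_ge0.
  have -> : 4 * p * K * Dr * (g%:R * (K * Dr) * Sd) =
            4 * g%:R * K ^+ 2 * ((p * Dr) * (Dr * Sd)) by ring.
  apply: ler_wpM2l; first by rewrite !mulr_ge0 // exprn_ge0.
  apply: le_trans (_ : Dr * Sd <= _); first by rewrite ler_piMl // mulr_ge0.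
  have -> : delta * Dr ^+ 2 * n = Dr * (delta * Dr * n) by ring.
  by rewrite ler_wpM2l.
have h4 : Dr * Sd <= delta * Dr ^+ 2 * n.
  have -> : delta * Dr ^+ 2 * n = Dr * (delta * Dr * n) by ring.
  by rewrite ler_wpM2l.
have -> : bite_const * delta * Dr ^+ 2 * n = K * (delta * Dr ^+ 2 * n) +
  ((K + 4 * g%:R ^+ 2 * K ^+ 2 + 1) * (delta * Dr ^+ 2 * n) +
  (4 * g%:R * K ^+ 2 * (delta * Dr ^+ 2 * n) + delta * Dr ^+ 2 * n)).
  by rewrite /bite_const; ring.
apply: le_trans (lerD h1 (lerD h2 (lerD h3 h4))).
by rewrite le_eqVlt; apply/orP; left; apply/eqP; ring.
Qed.

(** Both edges of a pair are bitten with probability [p ^ 2], and the intersecting pairs number at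
    most the sum of the squared degrees, about [D ^ 2 * #|X|]. So the loss by clashes is quadratic
    in [p * D], while the bite covers a share linear in it. *)
Lemma avg_clashes :
  avg (fun c => #|clashes c|%:R) <=
  (p * D%:R) ^+ 2 * (1 + 2 * K * delta) * #|X|%:R.
Proof.
have [p0 p1] := andP p01.
pose Q : {set I * I} := [set ij in setX A A |
  (ij.1 != ij.2) && ~~ [disjoint e ij.1 & e ij.2]].
have -> : avg (fun c => #|clashes c|%:R) =
    \sum_(ij in Q) avg (fun c => ((c ij.1 == ord0) && (c ij.2 == ord0))%:R) :> R.
  rewrite -avg_sum; apply: eq_avg => c.
  rewrite -sum1_card natr_sum [LHS]big_mkcond [RHS]big_mkcond.
  apply: eq_bigr => -[i j] _; rewrite !inE /=.
  by case: (i \in A); case: (j \in A); case: (c i == _); case: (c j == _);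
     case: (i != j); case: [disjoint _ & _].
rewrite (eq_bigr (fun=> p ^+ 2)); last first.
  move=> [i j]; rewrite !inE /= => /andP[_ /andP[ij _]].
  have := avg_agree R [set i; j] (fun=> ord0 : 'I_m.+1).
  rewrite card_ord cards2 ij pE => <- //; apply: eq_avg => c; congr (_%:R); congr nat_of_bool.
  apply/andP/forall_inP => [[ci cj] l|H].
    by rewrite !inE => /orP[] /eqP ->.
  by split; apply: H; rewrite !inE eqxx ?orbT.
have -> : \sum_(ij in Q) p ^+ 2 = p ^+ 2 * #|Q|%:R by rewrite sumr_const mulr_natr.
have -> : (p * D%:R) ^+ 2 * (1 + 2 * K * delta) * #|X|%:R =
  p ^+ 2 * (D%:R ^+ 2 * (1 + 2 * K * delta) * #|X|%:R) by ring.
apply: ler_wpM2l; first by rewrite exprn_ge0.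
have cardQ : (#|Q| <= \sum_(x in X) edeg e A x ^ 2)%N.
  apply: leq_trans (_ : \sum_(x in X) #|setX [set i in A | x \in e i] [set i in A | x \in e i]| <= _)%N.
    apply: leq_trans (leq_card_bigcup _ _); apply: subset_leq_card.
    apply/subsetP => -[i j]; rewrite !inE /= => /andP[/andP[iA jA] /andP[_ /pred0Pn[x /= /andP[xi xj]]]].
    apply/bigcupP; exists x; first exact: (subsetP (sub_e iA)).
    by rewrite !inE iA jA /=; apply/andP.
  by apply: leq_sum => x _; rewrite cardsX.
apply: le_trans (_ : \sum_(x in X) (D%:R * (D%:R + dev x) + K * D%:R * dev x) <= _).
  apply: le_trans (_ : (\sum_(x in X) edeg e A x ^ 2)%:R <= _); first by rewrite ler_nat.
  rewrite natr_sum; apply: ler_sum => x xX; rewrite natrX.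
  have -> : dg x ^+ 2 = D%:R * dg x + (dg x - D%:R) * dg x by ring.
  have le1 : dg x <= D%:R + dev x by have := ler_norm (dg x - D%:R); lra.
  apply: lerD; first by rewrite ler_wpM2l.
  apply: le_trans (_ : dev x * dg x <= _); first by rewrite ler_wpM2r // ler_norm.
  by rewrite mulrC ler_wpM2r // deg_le.
have cst (a : R) : \sum_(x in X) a = a * #|X|%:R by rewrite sumr_const mulr_natr.
rewrite big_split /= -!mulr_sumr big_split /= cst.
have K0 : 0 <= K := le_trans ler01 K_ge1.
have le1 : D%:R * \sum_(x in X) dev x <= D%:R * (delta * D%:R * #|X|%:R).
  by rewrite ler_wpM2l.
have le2 : D%:R * \sum_(x in X) dev x <= K * (D%:R * (delta * D%:R * #|X|%:R)).
  by rewrite (le_trans le1) // ler_peMl // !mulr_ge0 // delta_ge0.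
have le3 : K * (D%:R * \sum_(x in X) dev x) <= K * (D%:R * (delta * D%:R * #|X|%:R)).
  by rewrite ler_wpM2l.
apply: le_trans (_ : D%:R * (D%:R * #|X|%:R) + (K * (D%:R * (delta * D%:R * #|X|%:R)) +
   K * (D%:R * (delta * D%:R * #|X|%:R))) <= _).
  by rewrite mulrDr -addrA lerD2l -mulrA lerD.
by rewrite le_eqVlt; apply/orP; left; apply/eqP; ring.
Qed.

(** A bitten edge that is not isolated is the first member of a clash; its vertices leave the game
    and are written off as uncovered. *)
Lemma card_leave_isolated c :
  (#|X| <= #|leave c| + g * (#|isolated c| + #|clashes c|))%N.
Proof.
rewrite -(cardsID (covered c) X) addnC leq_add2l.
apply: leq_trans (subset_leq_card (subsetIr _ _)) _.
apply: leq_trans (leq_card_bigcup _ _) _.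
rewrite (eq_bigr (fun=> g)); last by move=> i; rewrite inE => /andP[/card_e].
rewrite sum_nat_const mulnC leq_mul2l; apply/orP; right.
rewrite -(cardsID (isolated c) (bite c)); apply: leq_add.
  by apply: subset_leq_card; apply: subsetIr.
apply: leq_trans (leq_imset_card (fun ij => ij.1) (clashes c)).
apply: subset_leq_card; apply/subsetP => i; rewrite !inE => /andP[niso ib].
move: niso; rewrite ib /= negb_forall => /existsP[j].
rewrite !negb_imply => /and3P[jb ji ndis].
by apply/imsetP; exists (i, j) => //; move: jb; rewrite !inE ib /= => ->; rewrite eq_sym ji.
Qed.

Lemma isolated_sub c : isolated c \subset A.
Proof. by apply/subsetP => i; rewrite !inE => /andP[/andP[]]. Qed.

Lemma isolated_matching c : edge_matching e (isolated c).
Proof.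
move=> i j; rewrite !inE => /andP[_ /forall_inP iso] /andP[jb _] ij.
by have := iso j; rewrite inE jb eq_sym ij => /(_ isT).
Qed.

Lemma isolated_survivor_disjoint c i j :
  i \in isolated c -> j \in survivors c -> [disjoint e i & e j].
Proof.
move=> iI; rewrite inE => /andP[_ jl]; rewrite disjoint_sym.
apply: disjointWl jl _; rewrite disjoints_subset; apply/subsetP => x.
rewrite !inE => /andP[nx _]; apply: contraNN nx => xi.
by apply/bigcupP; exists i => //; move: iI; rewrite inE => /andP[].
Qed.

End Bite.

(** * Iterating the bites *)

(** Degrees are close to [D] only on average, which is all that a second moment can give; [K] bounds
    them everywhere. The last condition makes an error of 1 per vertex, such as rounding the degree,
    affordable. *)
Definition quasi_regular (R : realFieldType) (g D : nat) (K delta : R)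
    (T I : finType) (e : I -> {set T}) (X : {set T}) (A : {set I}) : Prop :=
  [/\ {in A, forall i, #|e i| = g /\ e i \subset X},
      {in A &, forall i j, i != j -> (#|e i :&: e j| <= 1)%N},
      {in X, forall x, (edeg e A x)%:R <= K * D%:R},
      \sum_(x in X) `|(edeg e A x)%:R - D%:R| <= delta * D%:R * #|X|%:R &
      1 <= delta * D%:R].

(* [beta] is the fraction of vertices that may remain uncovered. *)
Definition nearly_perfect (R : realFieldType) (g : nat) (beta : R) : Prop :=
  forall eps K : R, 0 < eps -> 1 <= K -> exists2 delta : R, 0 < delta &
  forall (T I : finType) (e : I -> {set T}) (X : {set T}) (A : {set I}) (D : nat),
    quasi_regular g D K delta e X A ->
    exists M : {set I}, [/\ M \subset A, edge_matching e M &
      #|X|%:R - (g * #|M|)%:R <= (beta + eps) * #|X|%:R].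

Lemma nearly_perfect1 (R : realFieldType) (g : nat) : nearly_perfect g (1 : R).
Proof.
move=> eps K eps0 _; exists 1 => // T I e X A D _; exists set0.
split; first exact: sub0set; first by move=> i j; rewrite inE.
rewrite cards0 muln0 subr0 mulrDl mul1r lerDl mulr_ge0 //; exact: ltW.
Qed.

Lemma bernoulli_ge (R : realFieldType) (p : R) (n : nat) :
  0 <= p -> 1 + p * n%:R <= (1 + p) ^+ n.
Proof.
move=> p0; elim: n => [|n IH]; first by rewrite mulr0 addr0.
rewrite exprS; apply: le_trans (ler_wpM2l _ IH); last by lra.
rewrite [in leLHS]mulrSr.
have : 0 <= p * (p * n%:R) by rewrite !mulr_ge0.
lra.
Qed.

(** For the upper bound, [(1 - p) ^+ D * (1 + p) ^+ D <= 1] and Bernoulli's inequality give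
    [1 / (1 + x)], and [(1 - x + x ^ 2) * (1 + x) = 1 + x ^ 3]. *)
Lemma expr_compl_bounds (R : realFieldType) (p x : R) (D : nat) :
  0 <= p <= 1 -> p * D%:R = x -> 1 - x <= (1 - p) ^+ D <= 1 - x + x ^+ 2.
Proof.
move=> p01 px; have /andP[p0 p1] := p01.
have x0 : 0 <= x by rewrite -px mulr_ge0.
have := exprB_le D D p01; rewrite subnn expr0 px => lo.
apply/andP; split; first by lra.
have B := bernoulli_ge D p0; rewrite px in B.
have q0 : 0 <= (1 - p) ^+ D by rewrite exprn_ge0 // subr_ge0.
have le1 : (1 - p) ^+ D * (1 + p) ^+ D <= 1.
  rewrite -exprMn exprn_ile1 //; first by rewrite mulr_ge0; lra.
  by have := sqr_ge0 p; lra.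
have le2 : (1 - p) ^+ D * (1 + x) <= 1.
  by rewrite (le_trans _ le1) // ler_wpM2l.
have x1 : 0 < 1 + x by lra.
rewrite -(ler_pM2r x1) (le_trans le2) //.
have -> : (1 - x + x ^+ 2) * (1 + x) = 1 + x ^+ 3 by ring.
by rewrite lerDl exprn_ge0.
Qed.

(** Pointwise arithmetic-geometric mean inequality [|f| <= c / 2 + f ^ 2 / (2 * c)] with
    [c = kappa * D]; it turns a second moment into a mean deviation without square roots. *)
Lemma sum_abs_le_sqr (R : realFieldType) (T : finType) (X : {set T}) (f : T -> R)
    (kappa D : R) : 0 < kappa -> 0 < D ->
  \sum_(x in X) `|f x| <=
  kappa * D / 2 * #|X|%:R + (\sum_(x in X) f x ^+ 2) / (2 * kappa * D).
Proof.
move=> k0 D0.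
have -> : kappa * D / 2 * #|X|%:R = \sum_(x in X) (kappa * D / 2).
  by rewrite sumr_const mulr_natr.
rewrite mulr_suml -big_split /=; apply: ler_sum => x _.
have kD : 0 < kappa * D by rewrite mulr_gt0.
rewrite -(real_normK (num_real (f x))).
have -> : 2 * kappa * D = 2 * (kappa * D) by ring.
move: (kappa * D) (`|f x|) kD => a b a0.
have : 0 <= (b - a) ^+ 2 / (2 * a).
  by rewrite divr_ge0 ?sqr_ge0 // mulr_ge0 // ltW.
have -> : (b - a) ^+ 2 / (2 * a) = b ^+ 2 / (2 * a) - b + a / 2.
  by field; rewrite gt_eqF.
lra.
Qed.

Lemma double_half_expr (R : realFieldType) (a : R) (n : nat) :
  2 * (a / 2 ^+ n.+1) = a * (1 / 2) ^+ n.
Proof.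
by rewrite exprS expr_div_n expr1n; field; rewrite expf_neq0 ?pnatr_eq0.
Qed.

(** [tau] is the mean deviation aimed at, in units of [D], and [alpha] the weight under which a
    bounded penalty forces it. [delta] is the inverse of the sum [S] of all factors it has to beat,
    so each of them times [delta] is at most 1. *)
Lemma step_constants (R : realFieldType) (g : nat) (beta beta' delta' eps K C : R) :
  0 <= beta -> 0 <= beta' -> 0 < delta' -> 0 < eps -> 1 <= K -> 0 <= C ->
  exists tau alpha delta : R,
    [/\ [/\ 0 < tau, tau = delta' * (eps / 4) / 2 ^+ g, 0 < alpha & 0 < delta],
        (beta' + eps) / alpha = tau ^+ 2 / 2 /\ delta <= tau / 4,
        2 ^+ g * delta <= delta' /\ 2 ^+ g * delta <= 1,
        (beta + eps) * delta <= eps / 8 /\ alpha * (C * delta) <= eps / 8 &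
        2 * K * delta <= 1].
Proof.
move=> b0 beta'0 d'0 eps0 K1 C0.
have eps4 : 0 < eps / 4 by lra.
have G0 : 0 < 2 ^+ g :> R by rewrite exprn_gt0.
pose tau := delta' * (eps / 4) / 2 ^+ g.
have tau0 : 0 < tau by rewrite /tau divr_gt0 // mulr_gt0.
have tauE : tau = delta' * (eps / 4) / 2 ^+ g by [].
clearbody tau.
pose B := beta' + eps.
have B0 : 0 < B by rewrite /B; lra.
pose alpha := 2 * B / tau ^+ 2.
have alpha0 : 0 < alpha by rewrite divr_gt0 ?exprn_gt0 // mulr_gt0.
have alphaE : B / alpha = tau ^+ 2 / 2.
  by rewrite /alpha; field; rewrite !gt_eqF.
clearbody alpha.
pose S := 4 / tau + (2 ^+ g / delta' + (2 ^+ g + (8 * (beta + eps) / eps +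
  (8 * alpha * C / eps + 2 * K)))).
have s1 : 0 <= 4 / tau by rewrite divr_ge0 // ltW.
have s2 : 0 <= 2 ^+ g / delta' by rewrite divr_ge0 // ltW.
have s3 : 0 <= 2 ^+ g :> R by exact: ltW.
have s4 : 0 <= 8 * (beta + eps) / eps by rewrite divr_ge0 ?mulr_ge0 //; lra.
have s5 : 0 <= 8 * alpha * C / eps by rewrite !mulr_ge0 ?invr_ge0 // ltW.
have S0 : 0 < S by rewrite /S; lra.
pose delta := S^-1.
have d0 : 0 < delta by rewrite invr_gt0.
have small s : s <= S -> s * delta <= 1 by move=> sS; rewrite ler_pdivrMr // mul1r.
clearbody delta.
have b1 : delta <= tau / 4.
  have := small (4 / tau); rewrite /S => /(_ ltac:(lra)).
  by rewrite mulrAC ler_pdivrMr // mul1r; lra.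
have b2 : 2 ^+ g * delta <= delta'.
  have := small (2 ^+ g / delta'); rewrite /S => /(_ ltac:(lra)).
  by rewrite mulrAC ler_pdivrMr // mul1r.
have b3 : 2 ^+ g * delta <= 1 by apply: small; rewrite /S; lra.
have b4 : (beta + eps) * delta <= eps / 8.
  have := small (8 * (beta + eps) / eps); rewrite /S => /(_ ltac:(lra)).
  by rewrite mulrAC ler_pdivrMr // mul1r; lra.
have b5 : alpha * (C * delta) <= eps / 8.
  have := small (8 * alpha * C / eps); rewrite /S => /(_ ltac:(lra)).
  by rewrite mulrAC ler_pdivrMr // mul1r; lra.
have b6 : 2 * K * delta <= 1 by apply: small; rewrite /S; lra.
by exists tau, alpha, delta.
Qed.

(* A bite of density [1 / (h * D)] covers about [1 / h] of the vertices, and what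
   survives is again quasi-regular, of degree about [D * q ^+ g.-1]. *)
Lemma nearly_perfect_step (R : realType) (g : nat) (beta : R) (h : nat) :
  (0 < g)%N -> 0 <= beta -> (2 <= h)%N -> nearly_perfect g beta ->
  nearly_perfect g (2 * g%:R / h%:R ^+ 2 + beta * (1 - h%:R^-1 + h%:R^-2)).
Proof.
move=> g_gt0 b0 h2 IH eps K eps0 K1.
set beta' := _ + beta * _.
have h0 : 0 < h%:R :> R by rewrite ltr0n; apply: leq_trans h2.
have hinv : 0 < (h%:R^-1 : R) <= 1 / 2.
  rewrite invr_gt0 h0 /=.
  by rewrite div1r lef_pV2 ?posrE // ler_nat.
have G0 : 0 < 2 ^+ g :> R by rewrite exprn_gt0.
(* The reference degree may fall to [D / 2 ^ g] while the maximal degree need not drop, so their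
   ratio is allowed to grow by [2 ^ g]. *)
have K'1 : 1 <= K * 2 ^+ g.
  by rewrite (le_trans K1) // ler_peMr ?exprn_ege1 ?ler1n // (le_trans ler01 K1).
have eps4 : 0 < eps / 4 by lra.
have [delta' d'0 IHd] := IH (eps / 4) (K * 2 ^+ g) eps4 K'1.
have beta'0 : 0 <= beta'.
  rewrite /beta' addr_ge0 ?divr_ge0 ?mulr_ge0 ?exprn_ge0 //.
  have : 0 <= h%:R^-2 :> R by rewrite invr_ge0 exprn_ge0.
  by case/andP: hinv; lra.
have C0 : 0 <= bite_const g K.
  have K0 : 0 <= K := le_trans ler01 K1.
  by rewrite /bite_const !addr_ge0 // !mulr_ge0 // exprn_ge0.
have [tau [alpha [delta [[tau0 tauE alpha0 d0] [alphaE b1] [b2 b3] [b4 b5] b6]]]] :=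
  step_constants g b0 beta'0 d'0 eps0 K1 C0.
move CE : (bite_const g K) C0 b5 => C C0 b5.
exists delta => // T I e X A D [eA lin degK dev dD].
have cardA : {in A, forall i, #|e i| = g} by move=> i /eA[].
have subA : {in A, forall i, e i \subset X} by move=> i /eA[].
have D0 : (0 < D)%N.
  by case: (posnP D) dD => // ->; rewrite mulr0 ler10.
have Dr0 : 0 < D%:R :> R by rewrite ltr0n.
(* With [h * D] colours, [p * D] is exactly [1 / h]. *)
have [m mE] : exists m, m.+1 = (h * D)%N.
  by exists (h * D).-1; rewrite prednK // muln_gt0 D0 (leq_trans _ h2).
pose p : R := m.+1%:R^-1.
have pD : p * D%:R = h%:R^-1.
  by rewrite /p mE natrM invfM -mulrA mulVf ?mulr1 // gt_eqF.
have p01' : 0 <= p <= 1 by rewrite invr_ge0 ler0n invf_le1 ?ltr0n // ler1n.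
have pD1 : p * D%:R <= 1 by rewrite pD; move: hinv; clear; case/andP; lra.
have := expr_compl_bounds p01' pD; set q := (1 - p) ^+ D => /andP[qlo qhi].
have q01 : 1 / 2 <= q <= 1.
  apply/andP; split; first by move: hinv qlo; clear; case/andP; lra.
  by case/andP: p01' => pa pb; rewrite exprn_ile1 ?subr_ge0 // gerBl.
have pEq : p = m.+1%:R^-1 by [].
have E1 := avg_card_leave pEq dev pD1 dD.
have E2 := avg_leave_second_moment pEq g_gt0 cardA subA lin K1 degK dev pD1 dD.
rewrite CE in E2.
have E3 := avg_clashes pEq subA K1 degK dev dD.
rewrite pD in E3.
pose Y (c : {ffun I -> 'I_m.+1}) : R := \sum_(x in leave e X A c)
   ((edeg e (survivors e X A c) x)%:R - D%:R * q ^+ g.-1) ^+ 2.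
(* Vertices wasted by clashes, the part of the leave that the induction will miss, and a penalty for
   irregularity are added up, so that one averaging argument controls all three. *)
pose Psi (c : {ffun I -> 'I_m.+1}) : R := g%:R * #|clashes e A c|%:R +
  (beta + eps / 4) * #|leave e X A c|%:R + alpha / D%:R ^+ 2 * Y c.
have n0 : 0 <= #|X|%:R :> R by [].
have [c Psic] : exists c, Psi c <= (beta' + eps / 2) * #|X|%:R.
  have c_gt0 : (0 < #|{ffun I -> 'I_m.+1}|)%N by rewrite card_ffun card_ord expn_gt0.
  have [c le1] := exists_le_avg Psi c_gt0; exists c; apply: le_trans le1 _.
  rewrite /Psi !avgD !avgZ.
  have F1 : g%:R * avg (fun c : {ffun I -> 'I_m.+1} => #|clashes e A c|%:R) <=
            2 * g%:R / h%:R ^+ 2 * #|X|%:R :> R.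
    apply: le_trans (ler_wpM2l _ E3) _; first by [].
    have -> : 2 * g%:R / h%:R ^+ 2 * #|X|%:R = g%:R * (h%:R^-1 ^+ 2 * 2 * #|X|%:R) :> R.
      by field; rewrite gt_eqF.
    apply: ler_wpM2l => //; apply: ler_wpM2r => //; apply: ler_wpM2l; last by move: b6; clear; lra.
    by rewrite exprn_ge0 // invr_ge0.
  have F2 : (beta + eps / 4) * avg (fun c : {ffun I -> 'I_m.+1} => #|leave e X A c|%:R) <=
            (beta * (1 - h%:R^-1 + h%:R^-2) + eps / 4 + eps / 8) * #|X|%:R :> R.
    apply: le_trans (ler_wpM2l _ E1) _; first by rewrite addr_ge0 // ltW.
    rewrite mulrA ler_wpM2r // mulrDr lerD //; last first.
      by apply: le_trans b4; rewrite ler_wpM2r ?(ltW d0) // lerD2l; move: eps0; clear; lra.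
    rewrite mulrDl lerD //; last by rewrite ler_piMr ?(ltW eps4) //; case/andP: q01.
    by rewrite ler_wpM2l // -exprVn.
  have F3 : alpha / D%:R ^+ 2 * avg Y <= eps / 8 * #|X|%:R.
    apply: le_trans (ler_wpM2l _ E2) _.
      by rewrite divr_ge0 ?exprn_ge0 // ltW.
    have -> : alpha / D%:R ^+ 2 * (C * delta * D%:R ^+ 2 * #|X|%:R) =
              alpha * (C * delta) * #|X|%:R by field; rewrite gt_eqF.
    by rewrite ler_wpM2r.
  apply: le_trans (lerD (lerD F1 F2) F3) _.
  rewrite -!mulrDl ler_wpM2r // /beta'; clear; lra.
have Y0 : 0 <= Y c by apply: sumr_ge0 => x _; apply: sqr_ge0.
have aY0 : 0 <= alpha / D%:R ^+ 2 * Y c.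
  by rewrite mulr_ge0 // divr_ge0 ?exprn_ge0 // ltW.
have lv0 : 0 <= (beta + eps / 4) * #|leave e X A c|%:R by rewrite mulr_ge0 // addr_ge0 // ltW.
have cl0 : 0 <= g%:R * #|clashes e A c|%:R :> R by rewrite mulr_ge0.
have iso : #|X|%:R <= #|leave e X A c|%:R + g%:R * #|isolated e A c|%:R +
    g%:R * #|clashes e A c|%:R :> R.
  rewrite -addrA -mulrDr -natrD -natrM -natrD ler_nat.
  exact: card_leave_isolated.
(* A tiny leave may stay uncovered. Otherwise [X] is at most [4 / eps] times the leave, which
   converts deviations measured against [X] into deviations measured against the leave. *)
case: (lerP #|leave e X A c|%:R (eps / 4 * #|X|%:R)) => [small_leave|big_leave].
  exists (isolated e A c); split; first exact: isolated_sub.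
    exact: isolated_matching.
  have en0 : 0 <= eps * #|X|%:R by rewrite mulr_ge0 // ltW.
  rewrite natrM; move: Psic small_leave iso lv0 aY0 cl0 en0; rewrite /Psi; clear; lra.
have q0 : 0 <= q by move: q01; clear; case/andP; lra.
have q1 : q <= 1 by case/andP: q01.
pose d : R := D%:R * q ^+ g.-1.
(* Since [q >= 1 / 2], only [g.-1] halvings occur; the spare factor 2 pays for rounding [d] down to
   [D']. *)
have dlo : 2 * (D%:R / 2 ^+ g) <= d.
  rewrite -{1}(prednK g_gt0) double_half_expr /d ler_wpM2l //.
  by apply: lerXn2r; rewrite ?nnegrE ?divr_ge0 //; case/andP: q01.
have D2g : 1 <= D%:R / 2 ^+ g :> R.
  rewrite ler_pdivlMr // mul1r.
  apply: le_trans (_ : 2 ^+ g * (delta * D%:R) <= _).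
    by rewrite ler_peMr ?(ltW G0).
  by rewrite mulrA ler_piMl.
pose D' := Num.truncn d.
have d_ge0 : 0 <= d by rewrite mulr_ge0 // exprn_ge0.
have D'le : D'%:R <= d by rewrite truncn_le.
have D'ge : d < D'%:R + 1 by have := truncnS_gt d; rewrite -natr1.
have D'lo : D%:R / 2 ^+ g <= D'%:R :> R.
  apply: ltW; rewrite -(ltrD2r 1); apply: le_lt_trans D'ge; apply: le_trans dlo.
  by rewrite [leRHS](_ : _ = D%:R / 2 ^+ g + D%:R / 2 ^+ g) ?lerD2l //; ring.
have lvX : #|leave e X A c|%:R <= #|X|%:R :> R.
  by rewrite ler_nat subset_leq_card // subsetDl.
have Yle : Y c <= tau ^+ 2 / 2 * D%:R ^+ 2 * #|X|%:R.
  have le1 : alpha / D%:R ^+ 2 * Y c <= (beta' + eps) * #|X|%:R.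
    have en0 : 0 <= eps * #|X|%:R by rewrite mulr_ge0 // ltW.
    move: Psic lv0 cl0 en0; rewrite /Psi; clear; lra.
  have -> : Y c = alpha / D%:R ^+ 2 * Y c * (D%:R ^+ 2 / alpha).
    by field; rewrite !gt_eqF.
  rewrite -alphaE.
  have -> : (beta' + eps) / alpha * D%:R ^+ 2 * #|X|%:R =
            (beta' + eps) * #|X|%:R * (D%:R ^+ 2 / alpha) by field; rewrite gt_eqF.
  by rewrite ler_wpM2r // divr_ge0 ?exprn_ge0 // ltW.
have dev' : \sum_(x in leave e X A c) `|(edeg e (survivors e X A c) x)%:R - D'%:R| <=
    delta' * D'%:R * #|leave e X A c|%:R.
  have le1 : \sum_(x in leave e X A c) `|(edeg e (survivors e X A c) x)%:R - D'%:R| <=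
      \sum_(x in leave e X A c) `|(edeg e (survivors e X A c) x)%:R - d| + #|X|%:R.
    apply: le_trans (lerD (lexx _) lvX); rewrite -sum1_card natr_sum -big_split /=.
    apply: ler_sum => x _; set z := (edeg _ _ _)%:R.
    have -> : z - D'%:R = (z - d) + (d - D'%:R) by ring.
    apply: le_trans (ler_normD _ _) _; rewrite lerD2l ger0_norm ?subr_ge0 //.
    by rewrite lerBlDl ltW.
  have le2 := sum_abs_le_sqr (leave e X A c)
    (fun x => (edeg e (survivors e X A c) x)%:R - d) tau0 Dr0.
  have le3 : tau * D%:R / 2 * #|leave e X A c|%:R <= tau * D%:R / 2 * #|X|%:R.
    by rewrite ler_wpM2l // divr_ge0 // mulr_ge0 // ltW.
  have le4 : Y c / (2 * tau * D%:R) <= tau * D%:R / 4 * #|X|%:R.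
    have -> : tau * D%:R / 4 * #|X|%:R =
        tau ^+ 2 / 2 * D%:R ^+ 2 * #|X|%:R / (2 * tau * D%:R).
      by field; rewrite !gt_eqF.
    by rewrite ler_wpM2r // invr_ge0 !mulr_ge0 // ltW.
  have le5 : #|X|%:R <= tau * D%:R / 4 * #|X|%:R :> R.
    rewrite ler_peMl // (le_trans dD) // mulrAC ler_wpM2r //.
  have le6 : tau * D%:R * #|X|%:R <= delta' * D'%:R * #|leave e X A c|%:R.
    rewrite tauE.
    have -> : delta' * (eps / 4) / 2 ^+ g * D%:R * #|X|%:R =
      delta' * ((D%:R / 2 ^+ g) * (eps / 4 * #|X|%:R)) by field; rewrite expf_neq0 ?pnatr_eq0.
    rewrite -[leRHS]mulrA; apply: ler_wpM2l; first exact: ltW.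
    apply: ler_pM => //; first by rewrite divr_ge0 // exprn_ge0.
      by rewrite mulr_ge0 // ltW.
    exact: ltW.
  apply: le_trans le1 (le_trans _ le6).
  move: le2 le3 le4 le5; rewrite -/(Y c).
  set s1 := \sum_(x in _) `|_|.
  move: (Y c / _) (#|X|%:R) (#|leave _ _ _ _|%:R) => y n l.
  have -> : tau * D%:R * n = tau * D%:R / 2 * n + (tau * D%:R / 4 * n + tau * D%:R / 4 * n) by field.
  move: (tau * D%:R / 2 * l) (tau * D%:R / 2 * n) (tau * D%:R / 4 * n) => a b f.
  clear; lra.
have qr : quasi_regular g D' (K * 2 ^+ g) delta' e (leave e X A c) (survivors e X A c).
  split=> //.
  - by move=> i; rewrite inE => /andP[iA il]; split=> //; apply: cardA.
  - by move=> i j; rewrite !inE => /andP[iA _] /andP[jA _]; apply: lin.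
  - move=> x; rewrite inE => /andP[_ xX].
    apply: le_trans (_ : (edeg e A x)%:R <= _); first by rewrite ler_nat survivors_deg_le.
    apply: le_trans (degK x xX) _; rewrite -mulrA ler_wpM2l ?(le_trans ler01 K1) //.
    by rewrite mulrC -ler_pdivrMr.
  - apply: le_trans _ (ler_wpM2l (ltW d'0) D'lo); apply: le_trans dD _.
    by rewrite mulrA mulrAC; apply: ler_wpM2r; rewrite // ler_pdivlMr // mulrC.
have [M' [subM' matM' M'le]] := IHd T I e _ _ D' qr.
exists (isolated e A c :|: M'); split.
- rewrite subUset isolated_sub; apply: subset_trans subM' _.
  by apply/subsetP => i; rewrite inE => /andP[].
- move=> i j; rewrite !in_setU => /orP[iI|iM] /orP[jI|jM] ij.
  + exact: isolated_matching iI jI ij.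
  + by apply: isolated_survivor_disjoint iI _; apply: (subsetP subM').
  + rewrite disjoint_sym; apply: isolated_survivor_disjoint jI _.
    exact: (subsetP subM').
  + exact: matM' ij.
have cardU : #|isolated e A c :|: M'| = (#|isolated e A c| + #|M'|)%N.
  apply/eqP; rewrite (leq_card_setU _ _).2 disjoint_subset.
  apply/subsetP => i iI; rewrite inE; apply/negP => /(subsetP subM') iS.
  have := isolated_survivor_disjoint iI iS.
  rewrite -setI_eq0 setIid -cards_eq0 cardA ?eqn0Ngt ?g_gt0 //.
  exact: (subsetP (isolated_sub _ _ _)) iI.
rewrite cardU mulnDr natrD !natrM.
move: M'le Psic; rewrite natrM /Psi (mulrDl beta' eps) (mulrDl beta' (eps / 2)).
have en0 : 0 <= eps * #|X|%:R by rewrite mulr_ge0 // ltW.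
move: iso lv0 aY0 cl0 en0; clear; lra.
Qed.

Lemma geometric_small (R : realType) (rho eps : R) :
  0 <= rho < 1 -> 0 < eps -> exists n, rho ^+ n <= eps.
Proof.
move=> /andP[r0 r1] e0.
have d0 : 0 < 1 - rho by rewrite subr_gt0.
have de0 : 0 < ((1 - rho) * eps)^-1 by rewrite invr_gt0 mulr_gt0.
exists (Num.bound (((1 - rho) * eps)^-1)); set n := Num.bound _.
have ne := archi_boundP (ltW de0); rewrite -/n in ne.
have n0 : 0 < n%:R :> R by apply: lt_trans ne.
have {}ne : 1 <= eps * ((1 - rho) * n%:R).
  move: ne; rewrite -[_^-1]mul1r ltr_pdivrMr ?mulr_gt0 // => /ltW.
  by rewrite mulrC mulrCA mulrA.
have B := bernoulli_ge n (ltW d0).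
have le1 : rho ^+ n * (1 + (1 - rho)) ^+ n <= 1.
  rewrite -exprMn exprn_ile1 //; first by rewrite mulr_ge0 //; lra.
  by have := sqr_ge0 (1 - rho); lra.
have rn0 : 0 <= rho ^+ n by rewrite exprn_ge0.
have le2 : rho ^+ n * ((1 - rho) * n%:R) <= 1.
  by apply: le_trans le1; apply: ler_wpM2l => //; apply: le_trans B; rewrite lerDr.
have le3 : rho ^+ n * ((1 - rho) * n%:R) <= eps * ((1 - rho) * n%:R).
  exact: le_trans le2 ne.
by rewrite -(ler_pM2r (mulr_gt0 d0 n0)).
Qed.

(** [2 * g / (h - 1)] is the fixed point of the map on [beta] given by one step, and the distance to
    it shrinks by the factor [1 - 1 / h + 1 / h ^ 2] each time. *)
Lemma nearly_perfect_iter (R : realType) (g h n : nat) :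
  (0 < g)%N -> (2 <= h)%N ->
  nearly_perfect g (2 * g%:R / (h%:R - 1) + (1 - h%:R^-1 + h%:R^-2) ^+ n : R).
Proof.
move=> g0 h2.
have h1 : 1 < h%:R :> R by rewrite ltr1n.
have h0 : 0 < h%:R :> R by apply: lt_trans h1.
have rho0 : 0 <= 1 - h%:R^-1 + h%:R^-2 :> R.
  have : 0 <= h%:R^-2 :> R by rewrite invr_ge0 exprn_ge0 // ltW.
  have : h%:R^-1 <= 1 :> R by rewrite invf_le1 // ltW.
  by lra.
elim: n => [|n IH].
  move=> eps K e0 K1; have [d d0 H] := nearly_perfect1 g e0 K1; exists d => //.
  move=> T I e X A D qr; have [M [MA mM le1]] := H T I e X A D qr.
  exists M; split => //; apply: le_trans le1 _; rewrite ler_wpM2r // lerD2r.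
  by rewrite expr0 lerDr divr_ge0 ?mulr_ge0 // subr_ge0 ltW.
have := nearly_perfect_step g0 _ h2 IH.
rewrite addr_ge0 ?exprn_ge0 ?divr_ge0 ?mulr_ge0 ?subr_ge0 // 1?ltW // => /(_ isT).
set b := _ + _ * _; set b' := _ + _; suff -> : b = b' by [].
rewrite /b /b' [_ ^+ n.+1]exprS; move: (_ ^+ n) => y; field.
by rewrite !gt_eqF // subr_gt0.
Qed.

(** A large [h] brings the fixed point below [eps / 2], and then sufficiently many steps bring the
    geometric term below [eps / 4]; the last quarter is the slack of [nearly_perfect]. *)
Lemma nearly_perfect0 (R : realType) (g : nat) : (0 < g)%N -> nearly_perfect g (0 : R).
Proof.
move=> g0 eps K e0 K1.
have g1 : 0 < g%:R :> R by rewrite ltr0n.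
pose h := (Num.bound (4 * g%:R / eps)).+2.
have hb : 4 * g%:R / eps < h%:R - 1.
  have ge0 : 0 <= 4 * g%:R / eps by rewrite divr_ge0 ?mulr_ge0 // ltW.
  move: (archi_boundP ge0); rewrite /h; move: (Num.bound _) => b ltb.
  have -> : b.+2%:R = b%:R + 1 + 1 :> R by rewrite !natr1.
  lra.
have h1 : 0 < h%:R - 1 :> R by rewrite subr_gt0 ltr1n.
have h0 : 0 < h%:R :> R by rewrite ltr0n.
have rho : 0 <= (1 - h%:R^-1 + h%:R^-2 : R) < 1.
  have a1 : 0 <= h%:R^-2 :> R by rewrite invr_ge0 exprn_ge0 // ltW.
  have a2 : h%:R^-1 < 1 :> R by rewrite invf_lt1 // -subr_gt0.
  have a3 : h%:R^-2 < h%:R^-1 :> R.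
    by rewrite expr2 invfM gtr_pMl // invr_gt0.
  by apply/andP; split; lra.
have e4 : 0 < eps / 4 by lra.
have [n rn] := geometric_small rho e4.
have [d d0 H] := nearly_perfect_iter n g0 (isT : (2 <= h)%N) e4 K1.
exists d => // T I e X A D qr; have [M [MA mM le1]] := H T I e X A D qr.
exists M; split => //; apply: le_trans le1 _; rewrite ler_wpM2r //.
have : 2 * g%:R / (h%:R - 1) <= eps / 2.
  rewrite ler_pdivrMr //; move: hb; rewrite ltr_pdivrMr // => hb.
  by lra.
lra.
Qed.

(** * Codes for placing an edge around its [k]-subsets *)

(** A coordinate [(i, j, chi)] names the two positions that may be exchanged in it; the [e] copies
    of each pair provide [e] independent binary choices. *)
Definition coord (r e : nat) : finType := ('I_r * 'I_r * 'I_e)%type.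
Definition word (r e l : nat) : finType := {ffun coord r e -> 'I_l.+1}.

Section Words.
Variables (r e l : nat).
Local Notation word := (word r e l).
Local Notation coord := (coord r e).
Implicit Types (w : word) (y z : {ffun 'I_r -> word}) (K : {set 'I_r}).
Implicit Types (gam : {ffun 'I_e -> bool}).

Definition agree w w' : bool := [exists n, w n == w' n].

Definition generic y : bool :=
  [forall i, forall j, (i != j) ==> ~~ agree (y i) (y j)].

Lemma genericP y : reflect (forall i j, i != j -> ~~ agree (y i) (y j)) (generic y).
Proof.
by apply: (iffP forallP) => H i; [move=> j; move/forallP/(_ j)/implyP: (H i)
  | apply/forallP => j; apply/implyP; apply: H].
Qed.

(* [{ffun 'I_e -> bool}] acts by exchanging, in every column [(i, j, chi)] with
   [gam chi] and [i], [j] outside [K], the entries of [i] and [j].  Taking one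
   representative [canon K y] per orbit saves a factor [2 ^ e], and two tuples with
   the same representative either coincide outside [K] or agree crosswise. *)
Definition column_swap K gam (n : coord) : {perm 'I_r} :=
  if [&& gam n.2, n.1.1 \notin K & n.1.2 \notin K] then tperm n.1.1 n.1.2 else 1%g.

Definition flip K gam y : {ffun 'I_r -> word} :=
  [ffun a => [ffun n => y (column_swap K gam n a) n]].

Lemma flipE K gam y a n : flip K gam y a n = y (column_swap K gam n a) n.
Proof. by rewrite !ffunE. Qed.

Lemma column_swapK K gam n : involutive (column_swap K gam n).
Proof. by move=> a; rewrite /column_swap; case: ifP => _; rewrite ?tpermK ?perm1. Qed.

Lemma column_swap_in K gam n a : a \in K -> column_swap K gam n a = a.
Proof.
move=> aK; rewrite /column_swap; case: ifP => [/and3P[_ iK jK]|_]; last by rewrite perm1.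
by rewrite tpermD //; [apply: contraNneq iK => ->|apply: contraNneq jK => ->].
Qed.

Lemma column_swap_notin K gam n a : a \notin K -> column_swap K gam n a \notin K.
Proof.
move=> aK; rewrite /column_swap; case: ifP => [/and3P[_ iK jK]|_]; last by rewrite perm1.
by case: tpermP.
Qed.

Lemma flipK K gam : involutive (flip K gam).
Proof.
by move=> y; apply/ffunP => a; apply/ffunP => n; rewrite !flipE column_swapK.
Qed.

Definition mask K y : {ffun 'I_r -> word} :=
  [ffun a => if a \in K then [ffun=> ord0] else y a].

Definition marked K : 'I_r * 'I_r -> bool :=
  fun ij => [&& ij.1 != ij.2, ij.1 \notin K & ij.2 \notin K].

Definition less_at y (ij : 'I_r * 'I_r) chi : bool :=
  (y ij.1 (ij.1, ij.2, chi) < y ij.2 (ij.1, ij.2, chi))%N.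

(** The sign is read off a single pair that depends on [K] alone. In a generic tuple the two letters
    compared are distinct, so an exchange reverses the comparison. The default [false] occurs only
    if fewer than two positions lie outside [K]. *)
Definition sgn K y : {ffun 'I_e -> bool} :=
  [ffun chi => if [pick ij | marked K ij] is Some ij then less_at y ij chi else false].

Definition canon K y := mask K (flip K (sgn K y) y).

Lemma canonE K y a n : a \notin K ->
  canon K y a n = y (column_swap K (sgn K y) n a) n.
Proof. by move=> aK; rewrite /canon /mask ffunE (negbTE aK) flipE. Qed.

(** If the signs coincide, the same exchanges can be undone on both sides. If they differ at [chi],
    column [(a, b, chi)] was exchanged on one side only, so there the letter of [a] on one side is
    the letter of [b] on the other. *)
Lemma canon_cross K y y' : canon K y = canon K y' ->
  (forall a, a \notin K -> y a = y' a) \/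
  (forall a b, a \notin K -> b \notin K -> agree (y a) (y' b)).
Proof.
move=> eqc.
have eqf a n : a \notin K -> y (column_swap K (sgn K y) n a) n =
                             y' (column_swap K (sgn K y') n a) n.
  by move=> aK; rewrite -!canonE // eqc.
case: (eqVneq (sgn K y) (sgn K y')) => [sE|neq].
  left=> a aK; apply/ffunP => n.
  have := eqf (column_swap K (sgn K y) n a) n (column_swap_notin _ _ aK).
  by rewrite -sE !column_swapK.
right=> a b aK bK.
have [chi nchi] : exists chi, sgn K y chi != sgn K y' chi.
  apply/existsP; rewrite -negb_forall; apply: contraNN neq => /forallP eqs.
  by apply/eqP/ffunP => chi; apply/eqP.
apply/existsP; exists (a, b, chi); apply/eqP.
move: nchi (eqf a (a, b, chi) aK) (eqf b (a, b, chi) bK).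
rewrite /column_swap /= aK bK /=.
by case: (sgn K y chi); case: (sgn K y' chi) => //= _; rewrite !perm1 ?tpermL ?tpermR.
Qed.

(** In a representative all comparisons at the chosen pair are false; flipping by [gam] makes them
    true exactly where [gam] is. *)
Lemma flip_canon_inj K : (2 <= #|~: K|)%N ->
  {in [set canon K y | y : {ffun 'I_r -> word} & generic y], forall z gam,
     sgn K (flip K gam z) = gam}.
Proof.
move=> K2 _ /imsetP[y + ->] gam; rewrite inE => gy.
case E: [pick ij | marked K ij] => [[i j]|]; last first.
  have [i [j [iK jK ij]]] := card_gt1P K2.
  case: pickP E => [? ? //|none _]; have := none (i, j); rewrite /marked /= ij.
  by move: iK jK; rewrite !inE => -> ->.
have sgnE z : sgn K z = [ffun chi => less_at z (i, j) chi].
  by apply/ffunP => chi; rewrite !ffunE E.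
have /and3P[/= ij iK jK] : marked K (i, j) by case: pickP E => [? m [<-]|].
apply/ffunP => chi; rewrite sgnE ffunE /less_at /=.
set n := (i, j, chi).
have swE g : column_swap K g n = if g chi then tperm i j else 1%g.
  by rewrite /column_swap /= iK jK /= andbT.
have neq : y i n != y j n.
  by move/genericP: gy => /(_ i j ij); apply: contraNneq => yij; apply/existsP; exists n; rewrite yij.
have ltji : (canon K y j n < canon K y i n)%N.
  rewrite !canonE // swE; have -> : sgn K y chi = less_at y (i, j) chi by rewrite sgnE ffunE.
  rewrite /less_at /= -/n; case: (boolP (y i n < y j n)%N) => [lt|le].
    by rewrite tpermL tpermR.
  by rewrite !perm1 ltn_neqAle eq_sym neq leqNgt.
rewrite !flipE -/n swE; case: (gam chi); rewrite ?tpermL ?tpermR //.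
by rewrite !perm1 ltnNge ltnW.
Qed.

Lemma flip_canon_mask K gam y a : a \in K -> flip K gam (canon K y) a = [ffun=> ord0].
Proof.
by move=> aK; apply/ffunP => n; rewrite flipE column_swap_in // ffunE aK.
Qed.

(** A representative together with a sign vector yields a tuple that is constant on [K], and both
    can be recovered from it. *)
Lemma card_canon K : (2 <= #|~: K|)%N ->
  (#|[set canon K y | y : {ffun 'I_r -> word} & generic y]| * 2 ^ e <= #|word| ^ #|~: K|)%N.
Proof.
move=> K2; set S := [set canon K y | y : _ & _].
pose h (p : {ffun 'I_r -> word} * {ffun 'I_e -> bool}) := flip K p.2 p.1.
have -> : (#|S| * 2 ^ e = #|setX S [set: {ffun 'I_e -> bool}]|)%N.
  by rewrite cardsX cardsT card_ffun card_bool card_ord.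
have h_inj : {in setX S [set: {ffun 'I_e -> bool}] &, injective h}.
  move=> [z gam] [z' gam']; rewrite !inE /= !andbT => zS z'S; rewrite /h /= => e1.
  have e2 : gam = gam'.
    by rewrite -(flip_canon_inj K2 zS gam) e1 (flip_canon_inj K2 z'S gam').
  by rewrite -e2 in e1 *; rewrite (inv_inj (flipK K gam) e1).
rewrite -(card_in_imset h_inj) -(card_pffun_on [ffun=> ord0] (~: K) predT).
apply: subset_leq_card; apply/subsetP => f /imsetP[[z gam] zS ->]; rewrite /h /=.
have [y _ ->] : exists2 y, y \in [set y | generic y] & z = canon K y.
  by apply/imsetP; move: zS; rewrite inE => /andP[].
apply/pffun_onP; split=> //; apply/supportP => a; rewrite inE negbK => aK.
exact: flip_canon_mask.
Qed.

(** The code is the index of the pair [(K, canon K y)] among all such pairs, hence it determines the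
    position [K] as well as the representative. *)
Lemma exists_code (F : {set {set 'I_r}}) (L : nat) : (2 <= L)%N ->
  {in F, forall K : {set 'I_r}, #|~: K| = L} ->
  exists (code : {set 'I_r} -> {ffun 'I_r -> word} -> nat) (Z : nat),
  [/\ (Z * 2 ^ e <= #|F| * #|word| ^ L)%N,
      forall K y, K \in F -> generic y -> (code K y < Z)%N &
      forall K K' y y', K \in F -> K' \in F -> generic y -> generic y' ->
        code K y = code K' y' -> K = K' /\
        ((forall a, a \notin K -> y a = y' a) \/
         (forall a b, a \notin K -> b \notin K -> agree (y a) (y' b)))].
Proof.
move=> L2 FL.
pose C := [set (K, canon K y) | K in F, y in [set y | generic y]].
have memC K y : K \in F -> generic y -> (K, canon K y) \in C.
  by move=> KF gy; apply/imset2P; exists K y; rewrite ?inE.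
exists (fun K y => index (K, canon K y) (enum C)), #|C|; split.
- have CE : C \subset \bigcup_(K in F) setX [set K] [set canon K y | y : {ffun 'I_r -> word} & generic y].
    apply/subsetP => _ /imset2P[K y KF + ->]; rewrite inE => gy.
    apply/bigcupP; exists K; rewrite // !inE eqxx /=.
    by apply/imsetP; exists y; rewrite ?inE.
  apply: leq_trans (leq_mul (leq_trans (subset_leq_card CE) (leq_card_bigcup _ _)) (leqnn _)) _.
  rewrite big_distrl /= -sum_nat_const; apply: leq_sum => K KF.
  by rewrite cardsX cards1 mul1n -(FL K KF) card_canon // FL.
- by move=> K y KF gy; rewrite cardE index_mem mem_enum memC.
- move=> K K' y y' KF K'F gy gy' eqi.
  have : (K, canon K y) = (K', canon K' y').
    rewrite -[LHS](nth_index (K, canon K y) (s := enum C)) ?mem_enum ?memC //.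
    by rewrite eqi nth_index // mem_enum memC.
  by case=> <- eqc; split=> //; apply: canon_cross.
Qed.

End Words.

(** Union bound over the coordinates. A large alphabet makes agreement rare, so that almost all maps
    are generic. *)
Lemma card_agree_le (R : numFieldType) (r e l : nat) (w : word r e l) :
  #|[set w' | agree w w']|%:R <=
  #|coord r e|%:R / l.+1%:R * #|word r e l|%:R :> R.
Proof.
have card1 (n : coord r e) :
    #|[set w' : word r e l | w n == w' n]|%:R = #|word r e l|%:R / l.+1%:R :> R.
  have := avg_agree R [set n] w; rewrite card_ord cards1 expr1 => /(_ isT) <-.
  rewrite /avg mulrC divfK; last by rewrite pnatr_eq0 -lt0n; apply/card_gt0P; exists w.
  rewrite -sum1_card natr_sum big_mkcond; apply: eq_bigr => w' _; rewrite inE.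
  rewrite (_ : [forall i in [set n], w' i == w i] = (w n == w' n)); first by case: eqP.
  apply/forall_inP/eqP => [H|e1 i]; first by apply/esym/eqP/H; rewrite inE.
  by rewrite inE => /eqP->; rewrite e1.
apply: le_trans (_ : \sum_(n : coord r e) #|[set w' : word r e l | w n == w' n]|%:R <= _).
  rewrite -natr_sum ler_nat; apply: leq_trans (leq_card_bigcup _ _).
  apply: subset_leq_card; apply/subsetP => w'; rewrite inE => /existsP[n wn].
  by apply/bigcupP; exists n; rewrite // inE.
rewrite (eq_bigr (fun=> #|word r e l|%:R / l.+1%:R)) // sumr_const -[_ *+ _]mulr_natl.
by rewrite mulrA mulrAC.
Qed.

(** * The random system of edges *)

Lemma avg_pair (R : numFieldType) (S T : finType) (f : S -> R) (h : T -> R) :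
  avg (fun st : S * T => f st.1 * h st.2) = avg f * avg h.
Proof.
rewrite /avg card_prod natrM invfM mulrACA; congr (_ * _).
rewrite mulr_suml -(pair_bigA _ (fun s t => f s * h t)) /=.
by apply: eq_bigr => s _; rewrite mulr_sumr.
Qed.

Lemma avg_determined_le (R : numFieldType) (I T : finType) (S : {set I})
    (E : pred {ffun I -> T}) :
  (forall c c', E c -> E c' -> {in S, c =1 c'}) ->
  avg (fun c => (E c)%:R) <= #|T|%:R^-1 ^+ #|S| :> R.
Proof.
move=> Edet; case: (pickP E) => [c0 Ec0|E0]; last first.
  rewrite /avg big1 ?mul0r ?exprn_ge0 ?invr_ge0 // => c _.
  by rewrite (E0 c).
have [i0|] := pickP (fun i => i \in S); last first.
  move=> S0; have -> : S = set0 by apply/setP => i; rewrite S0 inE.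
  rewrite cards0 expr0 /avg ler_pdivrMr ?mul1r; last first.
    by rewrite ltr0n; apply/card_gt0P; exists c0.
  rewrite -sum1_card natr_sum; apply: ler_sum => c _.
  by rewrite ler_nat leq_b1.
move=> _; have T0 : (0 < #|T|)%N by apply/card_gt0P; exists (c0 i0).
rewrite -(avg_agree R S c0 T0); apply: ler_avg => c; rewrite ler_nat.
case: (boolP (E c)) => // Ec; rewrite lt0b; apply/forall_inP => i iS.
by rewrite (Edet c c0).
Qed.

Lemma avg_determined_eq (R : numFieldType) (I T : finType) (S : {set I})
    (E : pred {ffun I -> T}) (c0 : {ffun I -> T}) : (0 < #|T|)%N ->
  (forall c, E c = [forall i in S, c i == c0 i]) ->
  avg (fun c => (E c)%:R) = #|T|%:R^-1 ^+ #|S| :> R.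
Proof.
by move=> T0 EE; rewrite -(avg_agree R S c0 T0); apply: eq_avg => c; rewrite EE.
Qed.

Lemma sum_second_moment_le (R : realFieldType) (a1 a2 a3 a4 c1 c2 u v w : R) :
  a1 <= u -> a2 <= c1 -> a3 <= c2 -> w <= a4 -> c2 <= v ->
  a1 + a2 + a3 - a4 + c2 <= u + (v + v - w) + c1.
Proof. lra. Qed.

Lemma heavy_arith (R : realFieldType) (x d : R) :
  0 < d -> 2 * d <= x -> x * d <= 2 * (x - d) ^+ 2.
Proof. by move=> d0 dx; nra. Qed.

Lemma kept_dev_arith (R : realFieldType) (dev del Psi1 c N gB gd : R) :
  dev <= 1 / 4 * N + Psi1 / c -> gd <= gB -> del <= gd ->
  Psi1 / c + gB <= 3 / 4 * N -> dev + del <= N.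
Proof. lra. Qed.

Lemma card_ffun_family (I T : finType) (P : I -> pred T) :
  #|[set c : {ffun I -> T} | [forall i, P i (c i)]]| = (\prod_i #|P i|)%N.
Proof.
transitivity #|family P|.
  by apply: eq_card => c; rewrite inE; apply/forallP/familyP.
by rewrite card_family foldrE big_map big_enum.
Qed.

(* [K] and [T] are enumerated and a bijection between them is recorded as a
   permutation, which gives the factor [k`!]. *)
Lemma card_image_eq_le (V : finType) (r : nat) (K : {set 'I_r}) (T : {set V})
    (Q : 'I_r -> pred V) :
  (#|[set phi : {ffun 'I_r -> V} | [&& injectiveb phi, phi @: K == T &
        [forall i in ~: K, Q i (phi i)]]]| <=
   #|K|`! * \prod_(i in ~: K) #|Q i|)%N.
Proof.
set N := [set _ | _].
have [N0|[phi0]] := set_0Vmem N; first by rewrite N0 cards0.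
rewrite inE => /and3P[/injectiveP inj0 /eqP im0 _].
pose at_ (s : {perm 'I_#|K|}) (i : 'I_r) : V :=
  if [pick j | enum_val j == i] is Some j then phi0 (enum_val (s j)) else phi0 i.
pose P s i : pred V := [pred v | if i \in K then v == at_ s i else Q i v].
pose N' (s : {perm 'I_#|K|}) := [set phi : {ffun 'I_r -> V} |
  [forall i, P s i (phi i)]].
have cN' s : #|N' s| = (\prod_(i in ~: K) #|Q i|)%N.
  rewrite card_ffun_family (bigID (mem K)) /= [X in (X * _)%N]big1 ?mul1n.
    apply: eq_big => i; rewrite ?inE // => /negbTE iK.
    by apply: eq_card => v; rewrite !inE iK.
  move=> i iK; rewrite (eq_card (B := pred1 (at_ s i))) ?card1 // => v.
  by rewrite !inE iK.
apply: leq_trans (_ : #|\bigcup_(s : {perm 'I_#|K|}) N' s| <= _)%N; last first.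
  apply: leq_trans (leq_card_bigcup _ _) _.
  by rewrite (eq_bigr _ (fun s _ => cN' s)) sum_nat_const card_Sn.
apply: subset_leq_card; apply/subsetP => phi.
rewrite inE => /and3P[/injectiveP inj /eqP im /forall_inP Qphi].
have ex (j : 'I_#|K|) : exists j' : 'I_#|K|, phi0 (enum_val j') == phi (enum_val j) :> V.
  have : phi (enum_val j) \in phi0 @: K.
    rewrite im0 -im; apply/imset_f. exact: enum_valP.
  move=> /imsetP[x xK e]; exists (enum_rank_in xK x).
  by rewrite enum_rankK_in // e.
pose s0 j := xchoose (ex j).
have s0E j : phi0 (enum_val (s0 j)) = phi (enum_val j) by apply/eqP/(xchooseP (ex j)).
have s0_inj : injective s0.
  by move=> j j' e; apply/enum_val_inj/inj; rewrite -!s0E e.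
apply/bigcupP; exists (perm s0_inj) => //; rewrite inE; apply/forallP => i.
rewrite /P /=; case: ifPn => iK; last by apply: Qphi; rewrite inE.
rewrite /at_; case: pickP => [j /eqP <-|/(_ (enum_rank_in iK i))].
  by rewrite permE s0E.
by rewrite enum_rankK_in // eqxx.
Qed.

(** Such a tuple is given by a list of [v.+1] vertices containing its union, padded by a default
    vertex, and the index in this list of each of its entries. *)
Lemma card_small_union_le (I J V : finType) (v : nat) : (0 < #|V|)%N ->
  (#|[set u : {ffun I -> {ffun J -> V}} |
       #|\bigcup_i (u i @: setT)| <= v.+1]| <=
   v.+1 ^ (#|I| * #|J|) * #|V| ^ v.+1)%N.
Proof.
case/card_gt0P=> x0 _.
pose h (p : {ffun I * J -> 'I_v.+1} * {ffun 'I_v.+1 -> V}) : {ffun I -> {ffun J -> V}} :=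
  [ffun i => [ffun j => p.2 (p.1 (i, j))]].
apply: leq_trans (_ : #|h @: setT| <= _)%N; last first.
  apply: leq_trans (leq_imset_card _ _) _.
  by rewrite cardsT card_prod !card_ffun card_prod !card_ord.
apply: subset_leq_card; apply/subsetP => u; rewrite inE.
set U := \bigcup_i _ => small.
have uU i j : u i j \in U by apply/bigcupP; exists i => //; rewrite imset_f.
apply/imsetP; exists ([ffun ij => inord (index (u ij.1 ij.2) (enum U))],
                      [ffun a : 'I_v.+1 => nth x0 (enum U) a]) => //.
apply/ffunP => i; apply/ffunP => j; rewrite !ffunE /= inordK.
  by rewrite nth_index // mem_enum.
by apply: leq_trans small; rewrite cardE index_mem mem_enum.
Qed.

(** * Live injections and their probabilities *)

Section RandomSystem.
Variables (R : realFieldType) (V : finType) (r k Z M : nat).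
Local Notation Phi := {ffun 'I_r -> V}.
Variables (F G : {set {set 'I_r}}) (gen : pred Phi).
Variables (col : {set 'I_r} -> Phi -> 'I_Z.+1) (low : pred 'I_Z.+1).
Local Notation Omega :=
  ({ffun {set V} -> 'I_Z.+1} * {ffun Phi -> 'I_M.+1})%type.
Local Notation z := (Z.+1%:R^-1 : R).
Local Notation p := (M.+1%:R^-1 : R).

Hypothesis gen_inj : forall phi, gen phi -> injective phi.

Definition cells (phi : Phi) (c : {ffun {set V} -> 'I_Z.+1}) : bool :=
  [forall K in F, c (phi @: K) == col K phi].

Definition live (w : Omega) (phi : Phi) : bool :=
  [&& gen phi, cells phi w.1 & w.2 phi == ord0].

Definition Fsets (phi : Phi) : {set {set V}} := [set phi @: (K : {set 'I_r}) | K in F].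

Lemma card_Fsets phi : gen phi -> #|Fsets phi| = #|F|.
Proof. by move=> gphi; rewrite card_imset //; apply/imset_inj/gen_inj. Qed.

Lemma cells_det phi c c' : cells phi c -> cells phi c' -> {in Fsets phi, c =1 c'}.
Proof.
move=> /forall_inP cc /forall_inP cc' _ /imsetP[K KF ->].
by rewrite (eqP (cc K KF)) (eqP (cc' K KF)).
Qed.

Lemma card_omega_gt0 : (0 < #|{: Omega}|)%N.
Proof. by rewrite card_prod !card_ffun !card_ord muln_gt0 !expn_gt0. Qed.

Lemma avg_cells phi : gen phi ->
  avg (fun c => (cells phi c)%:R) = z ^+ #|F| :> R.
Proof.
move=> gphi; rewrite -(card_Fsets gphi) -[in RHS](card_ord Z.+1).
apply: (avg_determined_eq R (c0 := [ffun S : {set V} => col (phi @^-1: S) phi])).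
  by rewrite card_ord.
have preK (K : {set 'I_r}) : phi @^-1: (phi @: K) = K.
  by apply/setP => i; rewrite inE mem_imset //; apply: gen_inj.
move=> c; apply/forall_inP/forall_inP => [cc _ /imsetP[K KF ->]|cc K KF].
  by rewrite ffunE preK cc.
by have := cc (phi @: K); rewrite imset_f // ffunE preK => ->.
Qed.

Lemma avg_live phi : gen phi -> avg (fun w => (live w phi)%:R) = z ^+ #|F| * p.
Proof.
move=> gphi; rewrite -(avg_cells gphi).
have -> : p = avg (fun s : {ffun Phi -> 'I_M.+1} => (s phi == ord0)%:R).
  have := avg_agree R [set phi] (fun=> ord0 : 'I_M.+1).
  rewrite card_ord cards1 expr1 => <- //.
  apply: eq_avg => s; congr (_%:R); congr nat_of_bool.
  apply/forall_inP/idP => [H|H i]; first by apply: H; rewrite inE.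
  by rewrite inE => /eqP->.
rewrite -avg_pair; apply: eq_avg => w.
by rewrite /live gphi -natrM mulnb.
Qed.

Lemma avg_live_set (S : {set Phi}) :
  avg (fun w => [forall phi in S, live w phi]%:R) <=
  z ^+ #|\bigcup_(phi in S) Fsets phi| * p ^+ #|S|.
Proof.
pose E c := [forall phi in S, cells phi c].
apply: le_trans (_ : avg (fun w : Omega =>
   (E w.1)%:R * [forall phi in S, w.2 phi == ord0]%:R) <= _).
  apply: ler_avg => w; rewrite -natrM mulnb ler_nat.
  case: (boolP [forall phi in S, live w phi]) => // /forall_inP H.
  rewrite lt0b; apply/andP; split; apply/forall_inP => phi /H; by case/and3P.
rewrite (avg_pair (fun c : {ffun {set V} -> 'I_Z.+1} => (E c)%:R) (fun s : {ffun Phi -> 'I_M.+1} => [forall phi in S, s phi == ord0]%:R)).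
rewrite (avg_agree R S (fun=> ord0 : 'I_M.+1)) ?card_ord //.
rewrite ler_wpM2r ?exprn_ge0 ?invr_ge0 //.
rewrite -[X in X%:R^-1](card_ord Z.+1); apply: avg_determined_le.
move=> c c' /forall_inP Ec /forall_inP Ec' T /bigcupP[phi phiS].
by apply: cells_det; [apply: Ec|apply: Ec'].
Qed.

Lemma avg_live_pair phi phi' : phi != phi' ->
  avg (fun w => (live w phi && live w phi')%:R) <=
  z ^+ #|Fsets phi :|: Fsets phi'| * p ^+ 2.
Proof.
move=> neq; have := avg_live_set [set phi; phi'].
rewrite cards2 neq big_setU1 ?inE //= big_set1 => le1; apply: le_trans le1.
apply: ler_avg => w; rewrite ler_nat.
case: andP => [[l1 l2]|] //; rewrite lt0b; apply/forall_inP => x.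
by rewrite !inE => /orP[] /eqP->.
Qed.

Lemma avg_live_tuple (I : finType) (u : {ffun I -> Phi}) : injective u ->
  avg (fun w => [forall i, live w (u i)]%:R) <= p ^+ #|I|.
Proof.
move=> u_inj; have := avg_live_set (u @: setT).
rewrite card_imset // cardsT => le1.
apply: le_trans (le_trans le1 _).
  apply: ler_avg => w; rewrite ler_nat.
  case: forallP => // H; rewrite lt0b; apply/forall_inP => _ /imsetP[i _ ->].
  exact: H.
rewrite ler_piMl ?exprn_ge0 ?exprn_ile1 ?invr_ge0 //.
by rewrite invf_le1 ?ltr0n // ler1n.
Qed.

(** The colour of [T] is not among those prescribed for [phi], so it is low independently of [phi]
    being live. *)
Lemma avg_live_low phi T : gen phi -> T \notin Fsets phi ->
  avg (fun w => (live w phi && low (w.1 T))%:R) <= z ^+ #|F| * p * (z * #|low|%:R).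
Proof.
move=> gphi TF.
have card_TF : #|T |: Fsets phi| = #|F|.+1 by rewrite cardsU1 TF card_Fsets.
have one a : avg (fun c : {ffun {set V} -> 'I_Z.+1} => (cells phi c && (c T == a))%:R) <= z ^+ #|F|.+1 :> R.
  rewrite -card_TF -[X in X%:R^-1](card_ord Z.+1); apply: avg_determined_le.
  move=> c c' /andP[cc /eqP ca] /andP[cc' /eqP ca'] S /setU1P[->|SF].
    by rewrite ca ca'.
  exact: (cells_det cc cc').
apply: le_trans (_ : avg (fun w : Omega => (cells phi w.1 && low (w.1 T))%:R *
   [forall x in [set phi], w.2 x == ord0]%:R) <= _).
  apply: ler_avg => w; rewrite -natrM mulnb ler_nat /live gphi /=.
  case: (cells phi w.1) => //=; case: (low _); rewrite ?andbF // andbT /=.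
  case: eqP => // e; rewrite lt0b; apply/forall_inP => x.
  by rewrite inE => /eqP->; apply/eqP.
rewrite (avg_pair (fun c : {ffun {set V} -> 'I_Z.+1} => (cells phi c && low (c T))%:R)
  (fun s : {ffun Phi -> 'I_M.+1} => [forall x in [set phi], s x == ord0]%:R)).
rewrite (avg_agree R [set phi] (fun=> ord0 : 'I_M.+1)) ?card_ord // cards1 expr1.
have -> : z ^+ #|F| * p * (z * #|low|%:R) = (z ^+ #|F|.+1 * #|low|%:R) * p.
  by move: #|F| (#|low|%:R : R) z p => n a x y; rewrite exprS; ring.
rewrite ler_wpM2r ?invr_ge0 //.
apply: le_trans (_ : avg (fun c : {ffun {set V} -> 'I_Z.+1} => \sum_(a in low) (cells phi c && (c T == a))%:R) <= _).
  apply: ler_avg => c; case: (boolP (low (c T))) => lc; last first.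
    by rewrite andbF sumr_ge0.
  by rewrite (bigD1 (c T)) //= eqxx !andbT lerDl sumr_ge0.
rewrite avg_sum; apply: le_trans (ler_sum _ (fun a _ => one a)) _.
by rewrite sumr_const mulr_natr.
Qed.

(** * Block degrees and expected numbers of defects *)

Hypothesis k_gt0 : (0 < k)%N.
Hypothesis k_lt_r : (k < r)%N.
Hypothesis cardF : {in F, forall K : {set 'I_r}, #|K| = k}.
Hypothesis cardG : {in G, forall K : {set 'I_r}, #|K| = k}.
Hypothesis disFG : [disjoint F & G].
Variables (D : nat) (kappa : R).
Hypothesis V_gt0 : (0 < #|V|)%N.
Hypothesis G_gt0 : (0 < #|G|)%N.
(* [M] is tuned so that a block has expected degree [D]. *)
Hypothesis normalize :
  (M.+1 * (Z.+1 ^ #|F| * D) = #|G| * k`! * #|V| ^ (r - k))%N.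
Hypothesis gen_many : (1 - kappa) * #|V|%:R ^+ r <= #|[set phi | gen phi]|%:R :> R.

Definition blocks : {set {set V}} := [set T : {set V} | #|T| == k].
Definition block_edge (phi : Phi) : {set {set V}} := [set phi @: (K : {set 'I_r}) | K in G].
Definition lives (w : Omega) : {set Phi} := [set phi | live w phi].
(* Tuples spanning fewer vertices than they would if consecutive ranges met in
   [k] points; these violate the sparseness needed by [sparse_union_free]. *)
Definition bad (I : finType) (u : {ffun I -> Phi}) : bool :=
  (#|\bigcup_i (u i @: setT)| < #|I| * (r - k) + k)%N.
Definition bad2 (phi phi' : Phi) : bool :=
  (#|phi @: setT :|: phi' @: setT| < 2 * (r - k) + k)%N.

Local Notation n0 := (#|V|%:R : R).
Local Notation N0 := (n0 ^+ k / k`!%:R).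
Local Notation P1 := (z ^+ #|F| * p).
Local Notation B := (D%:R * Z.+1%:R ^+ #|F| / (#|G|%:R * k`!%:R) : R).

Lemma fact_gt0R : 0 < k`!%:R :> R. Proof. by rewrite ltr0n fact_gt0. Qed.
Lemma G_gt0R : 0 < #|G|%:R :> R. Proof. by rewrite ltr0n. Qed.

Lemma normalizeR : #|G|%:R * k`!%:R * n0 ^+ (r - k) * P1 = D%:R :> R.
Proof.
have := congr1 (fun n : nat => n%:R : R) normalize.
rewrite !natrM !natrX => <-.
have zn0 : Z.+1%:R ^+ #|F| != 0 :> R by rewrite expf_neq0 ?pnatr_eq0.
have mn0 : M.+1%:R != 0 :> R by rewrite pnatr_eq0.
rewrite exprVn; move: (Z.+1%:R ^+ #|F|) (M.+1%:R) zn0 mn0 => x y x0 y0.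
by field; rewrite x0 y0.
Qed.

(** [B] does not depend on [V]: the selection probability has order [#|V| ^ -(r - k)]. *)
Lemma p_scale : p * n0 ^+ (r - k) = B.
Proof.
have h : z ^+ #|F| * Z.+1%:R ^+ #|F| = 1 :> R.
  by rewrite -exprMn mulVf ?expr1n // pnatr_eq0.
have g0 := G_gt0R; have f0 := fact_gt0R.
rewrite -normalizeR; move: h.
move: (z ^+ #|F|) (Z.+1%:R ^+ #|F|) (n0 ^+ (r - k)) p => a c x y h.
transitivity (a * c * (y * x)); first by rewrite h mul1r.
by field; rewrite !gt_eqF.
Qed.

Lemma card_blocks : #|blocks|%:R <= N0 :> R.
Proof.
rewrite /blocks card_draws ler_pdivlMr ?fact_gt0R // -natrM -natrX ler_nat.
by rewrite bin_ffact ffact_le_expn.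
Qed.

Lemma n0_split : n0 ^+ r = n0 ^+ (r - k) * n0 ^+ k.
Proof. by rewrite -exprD subnK // ltnW. Qed.

Lemma card_block_edge phi : gen phi -> #|block_edge phi| = #|G|.
Proof. by move=> gphi; rewrite card_imset //; apply/imset_inj/gen_inj. Qed.

Lemma block_edge_sub phi : gen phi -> block_edge phi \subset blocks.
Proof.
move=> gphi; apply/subsetP => _ /imsetP[K KG ->].
by rewrite inE card_imset ?cardG //; apply: gen_inj.
Qed.

Lemma gen_degree T :
  (#|[set phi | gen phi && (T \in block_edge phi)]| <=
   #|G| * k`! * #|V| ^ (r - k))%N.
Proof.
apply: leq_trans (_ : \sum_(K in G) (k`! * #|V| ^ (r - k)) <= _)%N; last first.
  by rewrite sum_nat_const mulnA.
apply: leq_trans (_ : #|\bigcup_(K in G) [set phi : Phi | [&& injectiveb phi, phi @: K == T &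
        [forall i in ~: K, predT (phi i)]]]| <= _)%N.
  apply: subset_leq_card; apply/subsetP => phi; rewrite inE => /andP[gphi /imsetP[K KG TK]].
  apply/bigcupP; exists K; rewrite // inE TK eqxx /=; apply/andP; split.
    by apply/injectiveP/gen_inj.
  by apply/forall_inP.
apply: leq_trans (leq_card_bigcup _ _) _; apply: leq_sum => K KG.
apply: leq_trans (card_image_eq_le K T (fun=> predT)) _.
rewrite cardG // leq_mul2l prod_nat_const; apply/orP; right.
have -> : #|~: K| = (r - k)%N by rewrite cardsCs setCK card_ord cardG.
by [].
Qed.

(** A bad tuple of [m] maps spans at most [m * (r - k) + k - 1] vertices. Each map costs a factor
    [p] of order [#|V| ^ -(r - k)], so only the order [#|V| ^ (k - 1)] remains, below the number of
    blocks. *)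
Lemma bad_countE (I : finType) : (0 < #|I|)%N ->
  #|[set u : {ffun I -> Phi} | bad u]|%:R * p ^+ #|I| <=
  ((#|I| * (r - k) + k).-1 ^ (#|I| * r))%:R * B ^+ #|I| * n0 ^+ k.-1 :> R.
Proof.
move=> I0.
have p0 : 0 <= p by rewrite invr_ge0.
case E : ((#|I| * (r - k) + k).-1) => [|v].
  by move: E I0 k_gt0 k_lt_r; move: #|I|; clear; nia.
have le1 : (#|[set u : {ffun I -> Phi} | bad u]| <= v.+1 ^ (#|I| * r) * #|V| ^ v.+1)%N.
  have := card_small_union_le I ('I_r) v V_gt0; rewrite card_ord.
  apply: leq_trans; apply: subset_leq_card; apply/subsetP => u; rewrite !inE /bad => lt.
  by rewrite -ltnS -E prednK // addn_gt0 k_gt0 orbT.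
have le2 : #|[set u : {ffun I -> Phi} | bad u]|%:R * p ^+ #|I| <=
    (v.+1 ^ (#|I| * r) * #|V| ^ v.+1)%:R * p ^+ #|I| :> R.
  by rewrite ler_wpM2r ?exprn_ge0 // ler_nat.
apply: le_trans le2 _; rewrite natrM -p_scale -[leLHS]mulrA -[leRHS]mulrA ler_wpM2l //.
rewrite exprMn natrX -exprM.
have -> : v.+1 = ((r - k) * #|I| + k.-1)%N.
  by rewrite -E mulnC -subn1 -addnBA // subn1.
rewrite exprD le_eqVlt; apply/orP; left; apply/eqP; ring.
Qed.

Lemma bad2_count :
  \sum_(phi | gen phi) \sum_(phi' | gen phi') (bad2 phi phi')%:R * p ^+ 2 <=
  ((2 * (r - k) + k).-1 ^ (2 * r))%:R * B ^+ 2 * n0 ^+ k.-1.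
Proof.
have := @bad_countE bool; rewrite card_bool => /(_ isT) le1.
apply: (le_trans _ le1).
under eq_bigr => phi _ do rewrite -mulr_suml.
rewrite -mulr_suml ler_wpM2r ?exprn_ge0 ?invr_ge0 //.
rewrite pair_big_dep /= -natr_sum ler_nat.
pose h (pp : Phi * Phi) : {ffun bool -> Phi} := [ffun b : bool => if b then pp.1 else pp.2].
have h_inj : injective h.
  move=> [a1 a2] [b1 b2] /ffunP e; have := e true; have := e false.
  by rewrite !ffunE /= => -> ->.
apply: leq_trans (_ : #|h @: [set pp | bad2 pp.1 pp.2]| <= _)%N.
  rewrite card_imset // -sum1_card [leqRHS]big_mkcond /= big_mkcond /=.
  by apply: leq_sum => pp _; rewrite inE; case: ifP => _ //; case: (bad2 _ _).
apply: subset_leq_card; apply/subsetP => _ /imsetP[[a1 a2] + ->].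
rewrite !inE /bad2 /bad card_bool /=; congr (_ < _)%N; congr #|pred_of_set _|.
by rewrite big_bool !ffunE.
Qed.

Lemma edeg_lives w T :
  edeg block_edge (lives w) T = (\sum_(phi | gen phi && (T \in block_edge phi)) live w phi)%N.
Proof.
rewrite /edeg -sum1_card big_mkcond [RHS]big_mkcond; apply: eq_bigr => phi _.
rewrite !inE; case: (T \in block_edge phi); rewrite ?andbF ?andbT //.
by rewrite /live; case: (gen phi) => //=; case: ifP => // ->.
Qed.

Lemma sum_block_edge (a : Phi -> R) :
  \sum_(T in blocks) \sum_(phi | gen phi && (T \in block_edge phi)) a phi =
  #|G|%:R * \sum_(phi | gen phi) a phi.
Proof.
rewrite (exchange_big_dep gen) /=; last by move=> T phi _ /andP[].
rewrite mulr_sumr; apply: eq_bigr => phi gphi.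
rewrite (eq_bigl (mem (block_edge phi))) => [|T]; last first.
  rewrite gphi /=; apply: andb_idl => /(subsetP (block_edge_sub gphi)).
  by rewrite inE.
by rewrite sumr_const card_block_edge // mulr_natl.
Qed.

(** Unless the pair is bad, the two ranges meet exactly in the shared block [T]. A common [F]-set
    would equal [T], which sits at a [G]-position. Consequently the colour conditions of the two
    maps are independent. *)
Lemma Fsets_disjoint phi phi' T : gen phi -> gen phi' ->
  T \in block_edge phi -> T \in block_edge phi' -> ~~ bad2 phi phi' ->
  [disjoint Fsets phi & Fsets phi'].
Proof.
move=> gphi gphi' Tphi Tphi' nbad.
have meet : phi @: setT :&: phi' @: setT = T.
  apply/eqP; rewrite eq_sym eqEcard subsetI.
  have [K KG TK] := imsetP Tphi; have [K' K'G TK'] := imsetP Tphi'.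
  have cT : #|T| = k by rewrite TK card_imset ?cardG //; apply: gen_inj.
  rewrite {1}TK imsetS ?subsetT //= {1}TK' imsetS ?subsetT //= cT.
  have := cardsUI (phi @: setT) (phi' @: setT).
  rewrite !card_imset; [|exact: gen_inj gphi'|exact: gen_inj gphi].
  rewrite cardsT card_ord; move: nbad; rewrite /bad2 -leqNgt.
  by move: #|_ :|: _| #|_ :&: _| k_lt_r; clear; lia.
rewrite -setI_eq0; apply/eqP/setP => S; rewrite inE [RHS]inE.
apply/negP => /andP[/imsetP[K KF SK] /imsetP[K' K'F SK']].
have ST : S = T.
  apply/eqP; rewrite eqEcard -meet subsetI {1}SK imsetS ?subsetT //= {1}SK' imsetS ?subsetT //=.
  rewrite meet; have [K1 K1G ->] := imsetP Tphi.
  by rewrite SK !card_imset ?(cardG K1G) ?(cardF KF) //; apply: gen_inj.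
have [K1 K1G TK1] := imsetP Tphi.
have KK1 : K = K1 by apply: (imset_inj (gen_inj gphi)); rewrite -SK ST.
by have := disjointFr disFG KF; rewrite KK1 K1G.
Qed.

(** The ranges meet exactly in the shared [F]-set, so there is no second common one. *)
Lemma card_Fsets_union phi phi' K : gen phi -> gen phi' -> K \in F ->
  phi' @: K = phi @: K -> ~~ bad2 phi phi' ->
  ((2 * #|F|).-1 <= #|Fsets phi :|: Fsets phi'|)%N.
Proof.
move=> gphi gphi' KF eK nbad.
suff : (#|Fsets phi :&: Fsets phi'| <= 1)%N.
  rewrite cardsU !card_Fsets // mul2n -addnn => le1.
  by rewrite -subn1 leq_sub2l.
have cT : #|phi @: K| = k by rewrite card_imset ?cardF //; apply: gen_inj.
have meet : phi @: setT :&: phi' @: setT = phi @: K.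
  apply/eqP; rewrite eq_sym eqEcard subsetI imsetS ?subsetT //= -{1}eK imsetS ?subsetT //= cT.
  have := cardsUI (phi @: setT) (phi' @: setT).
  rewrite !card_imset; [|exact: gen_inj gphi'|exact: gen_inj gphi].
  rewrite cardsT card_ord; move: nbad; rewrite /bad2 -leqNgt.
  by move: #|_ :|: _| #|_ :&: _| k_lt_r; clear; lia.
rewrite -(cards1 (phi @: K)); apply: subset_leq_card; apply/subsetP => S.
rewrite !inE => /andP[/imsetP[K1 K1F SK] /imsetP[K' K'F SK']].
rewrite eqEcard -meet subsetI {1}SK imsetS ?subsetT //= {1}SK' imsetS ?subsetT //=.
by rewrite meet SK !card_imset ?(cardF KF) ?(cardF K1F) //; apply: gen_inj.
Qed.

Lemma z01 : 0 <= z <= 1.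
Proof. by rewrite invr_ge0 ler0n invf_le1 ?ltr0n // ler1n. Qed.

Lemma avg_pair_block phi phi' T : gen phi -> gen phi' ->
  T \in block_edge phi -> T \in block_edge phi' ->
  avg (fun w => (live w phi && live w phi')%:R) <=
  (phi == phi')%:R * P1 + (bad2 phi phi')%:R * p ^+ 2 + P1 ^+ 2.
Proof.
move=> gphi gphi' Tphi Tphi'.
have [z0 z1] := andP z01; have p0 : 0 <= p by rewrite invr_ge0.
case: eqP => [<-|/eqP neq] /=.
  rewrite (eq_avg (g := fun w => (live w phi)%:R)); last by move=> w; rewrite andbb.
  by rewrite avg_live // mul1r -addrA lerDl addr_ge0 ?mulr_ge0 ?exprn_ge0 ?mulr_ge0 ?exprn_ge0.
rewrite mul0r add0r; apply: le_trans (avg_live_pair neq) _.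
case: (boolP (bad2 phi phi')) => [_|nbad] /=.
  rewrite mul1r; apply: le_trans (_ : p ^+ 2 <= _).
    by rewrite ler_piMl ?exprn_ge0 ?exprn_ile1.
  by rewrite lerDl exprn_ge0 // mulr_ge0 ?exprn_ge0.
rewrite mul0r add0r.
have -> : #|Fsets phi :|: Fsets phi'| = (#|F| * 2)%N.
  have := Fsets_disjoint gphi gphi' Tphi Tphi' nbad.
  by rewrite -(leq_card_setU _ _).2 => /eqP->; rewrite !card_Fsets // muln2 addnn.
by rewrite exprM exprMn.
Qed.

(* [Psi1] measures irregularity; [Psi2], [Psi3] and [Psi4] count the defects that
   are removed by [bad_deleted], [sim_deleted] and [low_deleted]. *)
Definition Psi1 (w : Omega) : R :=
  \sum_(T in blocks) ((edeg block_edge (lives w) T)%:R - D%:R) ^+ 2.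

Definition pair_const : R := ((2 * (r - k) + k).-1 ^ (2 * r))%:R * B ^+ 2.

(** The mean degree is at most [D] at every block by [gen_degree], and at least [(1 - kappa) * D] in
    total by [gen_many]; expanding the square leaves [2 * kappa * D ^ 2] per block. The further [D]
    comes from the diagonal, the last term from bad pairs. *)
Lemma avg_Psi1 : avg Psi1 <=
  N0 * (2 * kappa * D%:R ^+ 2 + D%:R) + #|G|%:R * pair_const * n0 ^+ k.-1.
Proof.
have [z0 z1] := andP z01; have p0 : 0 <= p by rewrite invr_ge0.
have P10 : 0 <= P1 by rewrite mulr_ge0 ?exprn_ge0.
have PsiE w : Psi1 w = \sum_(T in blocks) (
    \sum_(phi | gen phi && (T \in block_edge phi))
      \sum_(phi' | gen phi' && (T \in block_edge phi')) (live w phi && live w phi')%:R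
    - 2 * D%:R * \sum_(phi | gen phi && (T \in block_edge phi)) (live w phi)%:R
    + D%:R ^+ 2).
  apply: eq_bigr => T _; rewrite edeg_lives natr_sum sqrrB; congr (_ - _ + _).
    rewrite expr2 mulr_suml; apply: eq_bigr => phi _; rewrite mulr_sumr.
    by apply: eq_bigr => phi' _; rewrite -natrM mulnb.
  by rewrite -mulr_natl mulrA mulrAC.
rewrite (eq_avg PsiE) avg_sum.
apply: le_trans (_ : \sum_(T in blocks) (
    \sum_(phi | gen phi && (T \in block_edge phi))
      \sum_(phi' | gen phi' && (T \in block_edge phi'))
         ((phi == phi')%:R * P1 + (bad2 phi phi')%:R * p ^+ 2 + P1 ^+ 2)
    - 2 * D%:R * \sum_(phi | gen phi && (T \in block_edge phi)) P1
    + D%:R ^+ 2) <= _).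
  apply: ler_sum => T _; rewrite avgD avgB avgZ !avg_sum avg_const ?card_omega_gt0 //.
  rewrite lerD2r lerB //.
    apply: ler_sum => phi /andP[gphi Tphi]; rewrite avg_sum.
    apply: ler_sum => phi' /andP[gphi' Tphi']; exact: (avg_pair_block (T := T)).
  rewrite [X in _ <= _ * X](eq_bigr (fun=> P1)) // => phi /andP[gphi _].
  by rewrite avg_live.
rewrite big_split sumrB -mulr_sumr sum_block_edge /=.
have cgen : \sum_(phi | gen phi) P1 = #|[set phi | gen phi]|%:R * P1.
  by rewrite sumr_const cardsE mulr_natl.
have gen_le : #|[set phi | gen phi]|%:R <= n0 ^+ r.
  rewrite -natrX ler_nat; apply: leq_trans (max_card _) _.
  by rewrite card_ffun card_ord.
have DE : D%:R * N0 = #|G|%:R * (n0 ^+ r * P1).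
  rewrite n0_split -normalizeR; have f0 := fact_gt0R.
  move: (n0 ^+ (r - k)) (n0 ^+ k) P1 => x y w; field.
  by rewrite gt_eqF.
have G0 := ltW G_gt0R.
have A1 : \sum_(T in blocks) \sum_(phi | gen phi && (T \in block_edge phi))
    \sum_(phi' | gen phi' && (T \in block_edge phi')) (phi == phi')%:R * P1 <= D%:R * N0.
  rewrite DE; apply: le_trans (_ : #|G|%:R * \sum_(phi | gen phi) P1 <= _); last first.
    by rewrite cgen; apply: ler_wpM2l => //; apply: ler_wpM2r.
  rewrite -sum_block_edge; apply: ler_sum => T _; apply: ler_sum => phi Hphi.
  rewrite (bigD1 phi) //= eqxx mul1r big1 ?addr0 // => phi' /andP[_ /negbTE].
  by rewrite eq_sym => ->; rewrite mul0r.
have A2 : \sum_(T in blocks) \sum_(phi | gen phi && (T \in block_edge phi))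
    \sum_(phi' | gen phi' && (T \in block_edge phi')) (bad2 phi phi')%:R * p ^+ 2 <=
    #|G|%:R * pair_const * n0 ^+ k.-1.
  apply: le_trans (_ : #|G|%:R * \sum_(phi | gen phi) \sum_(phi' | gen phi') (bad2 phi phi')%:R * p ^+ 2 <= _).
    rewrite -sum_block_edge; apply: ler_sum => T _; apply: ler_sum => phi _.
    rewrite [leLHS]big_mkcond [leRHS]big_mkcond; apply: ler_sum => phi' _.
    by case: (gen phi') => //=; case: ifP => // _; rewrite mulr_ge0 ?exprn_ge0.
  rewrite -mulrA; apply: ler_wpM2l => //; exact: bad2_count.
have A3 : \sum_(T in blocks) \sum_(phi | gen phi && (T \in block_edge phi))
    \sum_(phi' | gen phi' && (T \in block_edge phi')) P1 ^+ 2 <= D%:R ^+ 2 * #|blocks|%:R.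
  rewrite mulr_natr -sumr_const; apply: ler_sum => T _.
  have deg1 : #|[set phi | gen phi && (T \in block_edge phi)]|%:R * P1 <= D%:R.
    rewrite -normalizeR; apply: ler_wpM2r => //.
    by rewrite -natrX -!natrM ler_nat; apply: gen_degree.
  have cst (a : R) : \sum_(phi | gen phi && (T \in block_edge phi)) a =
      #|[set phi | gen phi && (T \in block_edge phi)]|%:R * a.
    by rewrite sumr_const cardsE mulr_natl.
  rewrite !cst [leRHS]expr2 mulrA -expr2 -exprMn [leRHS](_ : _ = D%:R ^+ 2) //.
  by rewrite lerXn2r ?nnegrE // mulr_ge0.
have A4 : 2 * D%:R * (#|G|%:R * \sum_(phi | gen phi) P1) >= 2 * (1 - kappa) * D%:R ^+ 2 * N0.
  have -> : 2 * (1 - kappa) * D%:R ^+ 2 * N0 = 2 * D%:R * ((1 - kappa) * (D%:R * N0)) by ring.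
  rewrite DE cgen; apply: ler_wpM2l; first by rewrite mulr_ge0.
  rewrite mulrCA; apply: ler_wpM2l => //; rewrite (mulrA _ (n0 ^+ r)); exact: ler_wpM2r.
have A5 : \sum_(T in blocks) D%:R ^+ 2 = D%:R ^+ 2 * #|blocks|%:R :> R.
  by rewrite sumr_const mulr_natr.
have A6 : D%:R ^+ 2 * #|blocks|%:R <= D%:R ^+ 2 * N0.
  by rewrite ler_wpM2l ?exprn_ge0 // card_blocks.
rewrite A5.
under eq_bigr => T _ do under eq_bigr => phi _ do rewrite !big_split /=.
under eq_bigr => T _ do rewrite !big_split /=.
rewrite !big_split /=.
have -> : N0 * (2 * kappa * D%:R ^+ 2 + D%:R) =
  D%:R * N0 + (D%:R ^+ 2 * N0 + D%:R ^+ 2 * N0 - 2 * (1 - kappa) * D%:R ^+ 2 * N0) by ring.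
exact: sum_second_moment_le A1 A2 A3 A4 A6.
Qed.

Variable q : nat.

Definition Psi2 (w : Omega) : R :=
  \sum_(m < q.+1 | (2 <= m)%N) \sum_(u : {ffun 'I_m -> Phi} | injectiveb u && bad u)
     [forall i, live w (u i)]%:R.

Definition tuple_const : R :=
  \sum_(m < q.+1 | (2 <= m)%N) ((m * (r - k) + k).-1 ^ (m * r))%:R * B ^+ m.

Lemma avg_Psi2 : avg Psi2 <= tuple_const * n0 ^+ k.-1.
Proof.
rewrite /Psi2 avg_sum /tuple_const mulr_suml; apply: ler_sum => m m2.
rewrite avg_sum; have := @bad_countE 'I_m; rewrite card_ord.
move=> /(_ (ltnW m2)) le1; apply: le_trans _ le1.
apply: le_trans (_ : \sum_(u : {ffun 'I_m -> Phi} | injectiveb u && bad u) p ^+ m <= _).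
  apply: ler_sum => u /andP[/injectiveP u_inj _].
  by have := avg_live_tuple u_inj; rewrite card_ord.
rewrite sumr_const -[leLHS]mulr_natl ler_wpM2r ?exprn_ge0 ?invr_ge0 // ler_nat.
by apply: subset_leq_card; apply/subsetP => u; rewrite !inE => /andP[].
Qed.

Variable sim : {set 'I_r} -> rel Phi.
Variable simN : nat.
Hypothesis sim_count : forall K phi, K \in F -> gen phi ->
  (#|[set phi' | [&& gen phi', phi' @: K == phi @: K & sim K phi phi']]| <= simN)%N.

Definition simpair (K : {set 'I_r}) (phi phi' : Phi) : bool :=
  [&& gen phi', phi' != phi, phi' @: K == phi @: K & sim K phi phi'].

Definition Psi3 (w : Omega) : R :=
  \sum_(K in F) \sum_(phi | gen phi) \sum_(phi' | simpair K phi phi')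
    (live w phi && live w phi')%:R.

(** Two maps sharing one [F]-set prescribe [2 * #|F| - 1] independent colours unless they form a bad
    pair; bad pairs are counted apart and are of lower order. *)
Lemma avg_Psi3 : avg Psi3 <=
  #|F|%:R * (pair_const * n0 ^+ k.-1 + n0 ^+ r * simN%:R * (z ^+ (2 * #|F|).-1 * p ^+ 2)).
Proof.
have [z0 z1] := andP z01; have p0 : 0 <= p by rewrite invr_ge0.
rewrite /Psi3 avg_sum mulr_natl -sumr_const; apply: ler_sum => K KF.
rewrite avg_sum.
apply: le_trans (_ : \sum_(phi | gen phi) \sum_(phi' | simpair K phi phi')
   ((bad2 phi phi')%:R * p ^+ 2 + z ^+ (2 * #|F|).-1 * p ^+ 2) <= _).
  apply: ler_sum => phi gphi; rewrite avg_sum; apply: ler_sum => phi'.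
  case/and4P=> gphi' neq /eqP eK _.
  apply: le_trans (avg_live_pair _) _; first by rewrite eq_sym.
  case: (boolP (bad2 phi phi')) => [_|nbad] /=.
    rewrite mul1r; apply: le_trans (_ : p ^+ 2 <= _).
      by rewrite ler_piMl ?exprn_ge0 ?exprn_ile1.
    by rewrite lerDl mulr_ge0 ?exprn_ge0.
  rewrite mul0r add0r; apply: ler_wpM2r; first by rewrite exprn_ge0.
  by apply: ler_wiXn2l => //; apply: (card_Fsets_union gphi gphi' KF).
under eq_bigr => phi _ do rewrite big_split /=.
rewrite big_split /=; apply: lerD.
  apply: le_trans bad2_count; apply: ler_sum => phi _.
  rewrite [leLHS]big_mkcond [leRHS]big_mkcond; apply: ler_sum => phi' _.
  rewrite /simpair; case: (gen phi') => //=; case: ifP => // _.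
  by rewrite mulr_ge0 ?exprn_ge0.
apply: le_trans (_ : \sum_(phi : Phi | gen phi) (simN%:R * (z ^+ (2 * #|F|).-1 * p ^+ 2)) <= _).
  apply: ler_sum => phi gphi; rewrite sumr_const -[leLHS]mulr_natl.
  apply: ler_wpM2r; first by rewrite mulr_ge0 ?exprn_ge0.
  rewrite ler_nat; apply: leq_trans (sim_count KF gphi).
  apply: subset_leq_card; apply/subsetP => phi'; rewrite inE.
  by case/and4P=> -> _ -> ->.
rewrite sumr_const -[leLHS]mulr_natl -mulrA.
apply: ler_wpM2r; first by rewrite !mulr_ge0 ?exprn_ge0.
rewrite -natrX ler_nat; apply: leq_trans (max_card _) _.
by rewrite card_ffun card_ord.
Qed.

Definition Psi4 (w : Omega) : R :=
  \sum_(K in G) \sum_(phi | gen phi) (live w phi && low (w.1 (phi @: K)))%:R.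

Lemma avg_Psi4 : avg Psi4 <= D%:R * N0 * (z * #|low|%:R).
Proof.
have [z0 z1] := andP z01; have p0 : 0 <= p by rewrite invr_ge0.
have DE : D%:R * N0 = #|G|%:R * (n0 ^+ r * P1).
  rewrite n0_split -normalizeR; have f0 := fact_gt0R.
  move: (n0 ^+ (r - k)) (n0 ^+ k) P1 => x y w; field.
  by rewrite gt_eqF.
rewrite DE /Psi4 avg_sum -mulrA mulr_natl -sumr_const; apply: ler_sum => K KG.
rewrite avg_sum.
apply: le_trans (_ : \sum_(phi : Phi | gen phi) (P1 * (z * #|low|%:R)) <= _).
  apply: ler_sum => phi gphi; apply: avg_live_low => //.
  apply/imsetP => -[K' K'F /(imset_inj (gen_inj gphi)) KK'].
  by have := disjointFr disFG K'F; rewrite -KK' KG.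
rewrite sumr_const -[leLHS]mulr_natl -[leRHS]mulrA.
apply: ler_wpM2r; first by rewrite !mulr_ge0 ?exprn_ge0.
rewrite -natrX ler_nat; apply: leq_trans (max_card _) _.
by rewrite card_ffun card_ord.
Qed.

(** * Deleting the defects *)

Definition bad_deleted (w : Omega) : {set Phi} :=
  \bigcup_(m < q.+1 | (2 <= m)%N)
    \bigcup_(u : {ffun 'I_m -> Phi} |
       (injectiveb u && bad u) && [forall i, live w (u i)]) (u @: setT).

Definition sim_deleted (w : Omega) : {set Phi} :=
  \bigcup_(K in F) [set phi | live w phi &&
     [exists phi', simpair K phi phi' && live w phi']].

Definition low_deleted (w : Omega) : {set Phi} :=
  \bigcup_(K in G) [set phi | live w phi && low (w.1 (phi @: K))].

(** Blocks of degree above [2 * D] lose all their maps; this yields the maximal degree condition of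
    [quasi_regular] with factor 2. *)
Definition heavy (w : Omega) : {set {set V}} :=
  [set T in blocks | (2 * D < edeg block_edge (lives w) T)%N].

Definition heavy_deleted (w : Omega) : {set Phi} :=
  \bigcup_(T in heavy w) [set phi in lives w | T \in block_edge phi].

Definition deleted w : {set Phi} :=
  bad_deleted w :|: sim_deleted w :|: low_deleted w :|: heavy_deleted w.

Definition kept w : {set Phi} := lives w :\: deleted w.

Lemma card_bad_deleted w : #|bad_deleted w|%:R <= q%:R * Psi2 w.
Proof.
rewrite /Psi2 mulr_sumr.
apply: le_trans (_ : (\sum_(m < q.+1 | (2 <= m)%N) \sum_(u : {ffun 'I_m -> Phi} |
  (injectiveb u && bad u) && [forall i, live w (u i)]) m)%:R <= _).
  rewrite ler_nat; apply: leq_trans (leq_card_bigcup _ _) _.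
  apply: leq_sum => m _; apply: leq_trans (leq_card_bigcup _ _) _.
  apply: leq_sum => u _; apply: leq_trans (leq_imset_card _ _) _.
  by rewrite cardsT card_ord.
rewrite natr_sum; apply: ler_sum => m _; rewrite natr_sum big_mkcondr /= mulr_sumr.
apply: ler_sum => u _; case: ifP => _; last by rewrite mulr0.
by rewrite mulr1 ler_nat -ltnS.
Qed.

Lemma card_sim_deleted w : #|sim_deleted w|%:R <= Psi3 w.
Proof.
apply: le_trans (_ : (\sum_(K in F) #|[set phi | live w phi &&
     [exists phi', simpair K phi phi' && live w phi']]|)%:R <= _).
  by rewrite ler_nat; apply: leq_card_bigcup.
rewrite natr_sum; apply: ler_sum => K _; rewrite -sum1_card natr_sum.
rewrite big_mkcond [leRHS]big_mkcond; apply: ler_sum => phi _; rewrite inE.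
case: (boolP (live w phi)) => /= [lphi|_]; last by case: (gen phi) => //; apply: sumr_ge0.
have -> : gen phi by case/and3P: lphi.
case: ifP => [/existsP[phi' /andP[sp lphi']]|_]; last exact: sumr_ge0.
by rewrite (bigD1 phi') //= lphi' lerDl sumr_ge0.
Qed.

Lemma card_low_deleted w : #|low_deleted w|%:R <= Psi4 w.
Proof.
apply: le_trans (_ : (\sum_(K in G) #|[set phi | live w phi && low (w.1 (phi @: K))]|)%:R <= _).
  by rewrite ler_nat; apply: leq_card_bigcup.
rewrite natr_sum; apply: ler_sum => K _; rewrite -sum1_card natr_sum.
rewrite big_mkcond [leRHS]big_mkcond; apply: ler_sum => phi _; rewrite inE.
case: (boolP (live w phi)) => /= [lphi|_]; last by case: (gen phi).
have -> : gen phi by case/and3P: lphi.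
by case: ifP.
Qed.

Hypothesis D_gt0 : (0 < D)%N.

(** A degree [x >= 2 * D] is at most [2 / D * (x - D) ^ 2], so irregularity already pays for this
    deletion. *)
Lemma card_heavy_deleted w : #|heavy_deleted w|%:R <= 2 / D%:R * Psi1 w.
Proof.
have D0 : 0 < D%:R :> R by rewrite ltr0n.
apply: le_trans (_ : (\sum_(T in heavy w) edeg block_edge (lives w) T)%:R <= _).
  by rewrite ler_nat; apply: leq_card_bigcup.
rewrite natr_sum /Psi1 mulr_sumr big_mkcond [leRHS]big_mkcond; apply: ler_sum => T _.
rewrite inE; case: (T \in blocks) => //=.
set x := edeg _ _ _; case: ifP => [lt|_]; last first.
  by rewrite mulr_ge0 ?sqr_ge0 // divr_ge0.
have lt' : 2 * D%:R <= x%:R :> R by rewrite -natrM ler_nat ltnW.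
rewrite mulrAC ler_pdivlMr //; exact: heavy_arith.
Qed.

Lemma kept_gen w phi : phi \in kept w -> gen phi.
Proof. by rewrite !inE => /andP[_ /and3P[]]. Qed.

Lemma kept_live w phi : phi \in kept w -> live w phi.
Proof. by rewrite inE => /andP[_]; rewrite inE. Qed.

Lemma kept_not_bad w (m : nat) (u : {ffun 'I_m -> Phi}) :
  (2 <= m)%N -> (m <= q)%N -> injective u -> (forall i, u i \in kept w) -> ~~ bad u.
Proof.
move=> m2 mq u_inj uk; apply/negP => bu.
pose i0 := Ordinal (ltnW m2).
have := uk i0; rewrite inE => /andP[+ _]; rewrite !inE !negb_or => /andP[/andP[/andP[+ _] _] _].
move/negP; apply; apply/bigcupP; exists (Ordinal (mq : (m < q.+1)%N)) => //.
apply/bigcupP; exists u; last exact: imset_f.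
by rewrite bu andbT; apply/andP; split; [apply/injectiveP|apply/forallP => i; apply/kept_live/uk].
Qed.

Hypothesis q_gt1 : (2 <= q)%N.

Lemma kept_not_bad2 w phi phi' : phi \in kept w -> phi' \in kept w -> phi != phi' ->
  ~~ bad2 phi phi'.
Proof.
move=> pk pk' neq.
pose u : {ffun 'I_2 -> Phi} := [ffun i : 'I_2 => if i == ord0 then phi else phi'].
have u_inj : injective u.
  move=> i j; rewrite !ffunE.
  case: eqP => [->|/eqP i0]; case: eqP => [->|/eqP j0] //.
  - by move=> e; rewrite e eqxx in neq.
  - by move=> e; rewrite e eqxx in neq.
  - by move=> _; apply/val_inj; case: i j i0 j0 => [[|[|i]] //= ?] [[|[|j]]].
have := kept_not_bad (isT : (2 <= 2)%N) q_gt1 u_inj.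
move=> /(_ w) H; have {H} : ~~ bad u by apply: H => i; rewrite ffunE; case: ifP.
by rewrite /bad /bad2 card_ord !big_ord_recl big_ord0 !ffunE setU0.
Qed.

Lemma kept_meet w phi phi' : phi \in kept w -> phi' \in kept w -> phi != phi' ->
  (#|phi @: setT :&: phi' @: setT| <= k)%N.
Proof.
move=> pk pk' neq; have := kept_not_bad2 pk pk' neq; rewrite /bad2 -leqNgt.
have := cardsUI (phi @: setT) (phi' @: setT).
rewrite !card_imset; [|exact: gen_inj (kept_gen pk')|exact: gen_inj (kept_gen pk)].
rewrite cardsT card_ord; move: #|_ :|: _| #|_ :&: _| k_lt_r => a b; lia.
Qed.

(** Kept maps have ranges meeting in at most [k] points, which leaves room for one common
    [k]-set. *)
Lemma kept_linear w phi phi' : phi \in kept w -> phi' \in kept w -> phi != phi' ->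
  (#|block_edge phi :&: block_edge phi'| <= 1)%N.
Proof.
move=> pk pk' neq; apply/card_le1_eqP.
have sub T : T \in block_edge phi :&: block_edge phi' ->
    T \subset phi @: setT :&: phi' @: setT /\ #|T| = k.
  rewrite inE => /andP[Tp Tp']; split; last first.
    by have := subsetP (block_edge_sub (kept_gen pk)) T Tp; rewrite inE => /eqP.
  have [K _ TK] := imsetP Tp; have [K' _ TK'] := imsetP Tp'.
  by rewrite subsetI {1}TK {1}TK' !imsetS ?subsetT.
have full T : T \in block_edge phi :&: block_edge phi' -> T = phi @: setT :&: phi' @: setT.
  by move=> /sub[TS cT]; apply/eqP; rewrite eqEcard TS cT (kept_meet pk pk' neq).
by move=> T T' /full-> /full->.
Qed.

Variable delta : R.
Hypothesis delta_gt0 : 0 < delta.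
Hypothesis deltaD : 1 <= delta * D%:R.

(** The first term bounds the deviation before deletion, by [sum_abs_le_sqr]; the second bounds the
    change of all degrees, as a deleted map lies in [#|G|] blocks. *)
Definition Psi w : R := Psi1 w / (delta * D%:R) +
  #|G|%:R * (q%:R * Psi2 w + Psi3 w + Psi4 w + 2 / D%:R * Psi1 w).

Lemma card_deleted w : #|deleted w|%:R <=
  q%:R * Psi2 w + Psi3 w + Psi4 w + 2 / D%:R * Psi1 w.
Proof.
have := card_bad_deleted w; have := card_sim_deleted w.
have := card_low_deleted w; have := card_heavy_deleted w => h4 h3 h2 h1.
apply: le_trans (lerD (lerD (lerD h1 h2) h3) h4).
rewrite -!natrD ler_nat /deleted.
do 3 (apply: leq_trans (leq_card_setU _ _).1 _; rewrite leq_add2r).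
by [].
Qed.

(** One quarter of the admissible deviation is spent on the constant term of [sum_abs_le_sqr] with
    parameter [delta / 2]; the remaining three quarters are those granted to [Psi]. *)
Lemma kept_regular w : Psi w <= 3 / 4 * (delta * D%:R * #|blocks|%:R) ->
  quasi_regular #|G| D 2 delta block_edge blocks (kept w).
Proof.
move=> Psiw; split => //.
- move=> phi pk; rewrite card_block_edge ?block_edge_sub //; exact: kept_gen pk.
- by move=> phi phi' pk pk'; apply: (kept_linear pk pk').
- move=> T Tb; rewrite -natrM ler_nat.
  case: (boolP (T \in heavy w)) => [Th|]; last first.
    rewrite inE Tb /= -leqNgt; apply: leq_trans; apply: subset_leq_card.
    by apply/subsetP => phi; rewrite !inE => /andP[/andP[_ ->] ->].
  rewrite /edeg eq_card0 // => phi; rewrite inE [RHS]inE.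
  apply/negP => /andP[pk Tp]; move: pk; rewrite in_setD => /andP[/negP nd pl].
  case: nd; rewrite /deleted in_setU; apply/orP; right.
  by apply/bigcupP; exists T; rewrite // in_set pl.
have D0 : 0 < D%:R :> R by rewrite ltr0n.
have del T : `|(edeg block_edge (kept w) T)%:R - D%:R| <=
   `|(edeg block_edge (lives w) T)%:R - D%:R| + (edeg block_edge (deleted w) T)%:R :> R.
  rewrite /kept; move: (deleted w) => Dl.
  have h1 : (edeg block_edge (lives w) T <=
             edeg block_edge (lives w :\: Dl) T + edeg block_edge Dl T)%N.
    apply: leq_trans (leq_card_setU _ _).1; apply: subset_leq_card; apply/subsetP => phi.
    by rewrite !inE => /andP[-> ->]; rewrite !andbT; case: (phi \in Dl).
  have h2 : (edeg block_edge (lives w :\: Dl) T <= edeg block_edge (lives w) T)%N.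
    by apply: subset_leq_card; apply/subsetP => phi; rewrite !inE => /andP[/andP[_ ->] ->].
  set a := edeg _ (_ :\: _) T in h1 h2 *; set b := edeg _ (lives w) T in h1 h2 *.
  set c := edeg _ Dl T in h1 h2 *.
  have -> : a%:R - D%:R = (b%:R - D%:R) + (a%:R - b%:R) :> R by ring.
  apply: le_trans (ler_normD _ _) _; rewrite lerD2l distrC ger0_norm.
    by rewrite lerBlDl -natrD ler_nat.
  by rewrite subr_ge0 ler_nat.
have sumdel : \sum_(T in blocks) (edeg block_edge (deleted w) T)%:R <=
    #|G|%:R * #|deleted w|%:R :> R.
  rewrite -natr_sum -natrM ler_nat mulnC -sum_nat_const.
  apply: leq_trans (_ : \sum_(T in blocks) \sum_(phi in deleted w) (T \in block_edge phi) <= _)%N.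
    apply: leq_sum => T _; rewrite /edeg -sum1_card big_mkcond [leqRHS]big_mkcond.
    by apply: leq_sum => phi _; rewrite inE; case: (_ \in deleted w).
  rewrite exchange_big; apply: leq_sum => phi _ /=.
  apply: leq_trans (leq_imset_card (fun K : {set 'I_r} => phi @: K) G).
  rewrite -sum1_card [leqRHS]big_mkcond [leqLHS]big_mkcond; apply: leq_sum => T _.
  by rewrite /block_edge; case: ifP => _; case: (_ \in _).
apply: le_trans (ler_sum _ (fun T _ => del T)) _; rewrite big_split /=.
have half : 0 < delta / 2 by rewrite divr_gt0.
have am := sum_abs_le_sqr blocks (fun T => (edeg block_edge (lives w) T)%:R - D%:R) half D0.
rewrite -/(Psi1 w) in am.
have gd := ler_wpM2l (ltW G_gt0R) (card_deleted w).
move: am gd sumdel Psiw; rewrite /Psi.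
have -> : 2 * (delta / 2) * D%:R = delta * D%:R by field.
have -> : delta / 2 * D%:R / 2 * #|blocks|%:R = 1 / 4 * (delta * D%:R * #|blocks|%:R) by field.
exact: kept_dev_arith.
Qed.

(** * From a matching of blocks to a union-free system *)

Variables (adj : rel V) (t a : nat).
Hypothesis FG_all : forall K : {set 'I_r}, #|K| = k -> (K \in F) || (K \in G).
Hypothesis col_low : forall K phi, K \in F -> gen phi -> low (col K phi).
Hypothesis gen_adj : forall phi i j, gen phi -> i != j -> ~~ adj (phi i) (phi j).
Hypothesis col_eq : forall K K' phi phi', K \in F -> K' \in F ->
  gen phi -> gen phi' -> col K phi = col K' phi' ->
  K = K' /\ (sim K phi phi' \/
             (forall i j, i \notin K -> j \notin K -> adj (phi i) (phi' j))).
Hypothesis r_eq : r = (t * k - a)%N.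
Hypothesis q_eq : q = (2 * t + 2)%N.
Hypothesis F_matching : ~~ has_matching (t - a) F.
Hypothesis t_gt1 : (1 < t)%N.
Hypothesis a_small : (2 * a <= (t - 2) * k)%N.
Hypothesis a_small3 : (3 * a < (2 * t - 3) * k)%N.

Section Matching.
Variables (w : Omega) (M' : {set Phi}).
Hypothesis subM : M' \subset kept w.
Hypothesis matM : edge_matching block_edge M'.

Lemma matching_kept phi : phi \in M' -> phi \in kept w.
Proof. exact: (subsetP subM). Qed.

Lemma matching_gen phi : phi \in M' -> gen phi.
Proof. by move/matching_kept/kept_gen. Qed.

Lemma card_range phi : phi \in M' -> #|phi @: setT| = r.
Proof.
by move=> pM; rewrite card_imset ?cardsT ?card_ord //; apply/gen_inj/matching_gen.
Qed.

Lemma range_inj : {in M' &, injective (fun phi : Phi => phi @: setT)}.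
Proof.
move=> phi phi' pM pM' /= e; apply/eqP; apply: contraT => neq.
have := kept_meet (matching_kept pM) (matching_kept pM') neq.
by rewrite -e setIid card_range // leqNgt k_lt_r.
Qed.

Lemma preim_of_subset phi (T : {set V}) : gen phi -> T \subset phi @: setT ->
  exists2 K : {set 'I_r}, T = phi @: K & #|K| = #|T|.
Proof.
move=> gphi TS; exists (phi @^-1: T).
  apply/setP => y; apply/idP/imsetP => [yT|[x]]; last by rewrite inE => xT ->.
  by have /imsetP[x _ yx] := subsetP TS y yT; exists x; rewrite ?inE -?yx.
rewrite -(card_imset _ (gen_inj gphi)); congr #|pred_of_set _|.
apply/setP => y; apply/imsetP/idP => [[x]|yT]; first by rewrite inE => xT ->.
by have /imsetP[x _ yx] := subsetP TS y yT; exists x; rewrite ?inE -?yx.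
Qed.

(* The low colours separate [F]-sets from [G]-sets, and a block covered twice is
   excluded by the matching; equal colours then force equal positions. *)
Lemma meet_in_F phi phi' : phi \in M' -> phi' \in M' -> phi != phi' ->
  #|phi @: setT :&: phi' @: setT| = k ->
  exists K, [/\ K \in F, phi @: setT :&: phi' @: setT = phi @: K,
    phi @: setT :&: phi' @: setT = phi' @: K &
    forall i j, i \notin K -> j \notin K -> adj (phi i) (phi' j)].
Proof.
move=> pM pM' neq; set T := _ :&: _ => cT.
have gphi := matching_gen pM; have gphi' := matching_gen pM'.
have [K TK cK] := preim_of_subset gphi (subsetIl _ _ : T \subset _).
have [K' TK' cK'] := preim_of_subset gphi' (subsetIr _ _ : T \subset _).
rewrite cT in cK cK'.
have low_free psi L L' psi' : psi \in M' -> psi' \in M' -> L \in G -> L' \in F ->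
    psi @: L = psi' @: L' -> False.
  move=> pG pF LG LF e.
  have /and3P[gF /forall_inP cF _] := kept_live (matching_kept pF).
  have := matching_kept pG; rewrite in_setD => /andP[/negP nd _]; apply: nd.
  rewrite /deleted 2!in_setU; apply/orP; left; apply/orP; right.
  apply/bigcupP; exists L; rewrite // inE (kept_live (matching_kept pG)) /= e.
  by rewrite (eqP (cF L' LF)) col_low.
case/orP: (FG_all cK) => [KF|KG]; case/orP: (FG_all cK') => [K'F|K'G].
- have /and3P[_ /forall_inP c1 _] := kept_live (matching_kept pM).
  have /and3P[_ /forall_inP c2 _] := kept_live (matching_kept pM').
  have cc : col K phi = col K' phi'.
    by rewrite -(eqP (c1 K KF)) -(eqP (c2 K' K'F)) -TK -TK'.
  have [KK' [sm|cross]] := col_eq KF K'F gphi gphi' cc; last first.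
    by exists K; split; rewrite // KK'.
  have := matching_kept pM; rewrite in_setD => /andP[/negP nd _]; case: nd.
  rewrite /deleted 3!in_setU; do 2 (apply/orP; left); apply/orP; right.
  apply/bigcupP; exists K; rewrite // inE (kept_live (matching_kept pM)) /=.
  apply/existsP; exists phi'.
  rewrite (kept_live (matching_kept pM')) andbT /simpair gphi' eq_sym neq sm andbT /=.
  by rewrite -TK KK' -TK'.
- by case: (low_free phi' K' K phi) => //; rewrite -TK -TK'.
- by case: (low_free phi K K' phi') => //; rewrite -TK -TK'.
- have dis := matM pM pM' neq; exfalso.
  have Tp : T \in block_edge phi by rewrite TK imset_f.
  by have := disjointFr dis Tp; rewrite TK' imset_f.
Qed.

Lemma has_matching_Fsets phi l : gen phi -> has_matching l (Fsets phi) -> has_matching l F.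
Proof.
move=> gphi /existsP[N /and3P[NF /eqP cN tN]].
pose N' : {set {set 'I_r}} := [set K in F | phi @: K \in N].
have NE : N = [set phi @: (K : {set 'I_r}) | K in N'].
  apply/setP => T; apply/idP/imsetP => [TN|[K]]; last by rewrite inE => /andP[_ KN] ->.
  by have /imsetP[K KF TK] := subsetP NF T TN; exists K; rewrite // inE KF -TK.
have inj := imset_inj (gen_inj gphi).
apply/existsP; exists N'; apply/and3P; split.
- by apply/subsetP => K; rewrite inE => /andP[].
- by rewrite -(card_imset _ inj) -NE cN.
- apply/trivIsetP => K K'; rewrite !inE => /andP[_ KN] /andP[_ K'N] neq.
  move/trivIsetP: tN => /(_ _ _ KN K'N); rewrite (inj_eq inj) => /(_ neq).
  by rewrite -!setI_eq0 -imsetI ?imset_eq0 //; move=> ? ? _ _; apply: gen_inj.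
Qed.

Lemma matching_union_free : exists H : {set {set V}},
  [/\ uniform r H, union_free (t + 1) H & #|H| = #|M'|].
Proof.
pose H : {set {set V}} := [set (phi : Phi) @: setT | phi in M'].
exists H; split; last by rewrite card_in_imset //; apply: range_inj.
  by apply/forall_inP => _ /imsetP[phi pM ->]; rewrite card_range.
(* Ranges determine the maps of [M'], so for an edge [E] this union has a single term. *)
pose Fam (E : {set V}) : {set {set V}} :=
  \bigcup_(phi in M' | phi @: setT == E) Fsets phi.
have FamE phi : phi \in M' -> Fam (phi @: setT) = Fsets phi.
  move=> pM; rewrite /Fam (bigD1 phi) ?pM ?eqxx //= big1 ?setU0 // => phi'.
  by case/andP=> /andP[pM' /eqP e] /eqP; case; apply: (range_inj pM' pM).
apply: (@sparse_union_free V t k a H Fam) => //.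
- by move=> _ /imsetP[phi pM ->]; rewrite card_range.
- move=> _ _ /imsetP[phi pM ->] /imsetP[phi' pM' ->] neq.
  apply: kept_meet (matching_kept pM) (matching_kept pM') _.
  by apply: contraNneq neq => ->.
- move=> _ _ /imsetP[phi pM ->] /imsetP[phi' pM' ->] neq cT.
  have neq' : phi != phi' by apply: contraNneq neq => ->.
  have [K [KF -> _ _]] := meet_in_F pM pM' neq' cT.
  by rewrite FamE // imset_f.
- move=> _ /imsetP[phi pM ->]; rewrite FamE //; apply: contraNN F_matching.
  exact: has_matching_Fsets (matching_gen pM).
- move=> _ _ _ /imsetP[phi pM ->] /imsetP[phi' pM' ->] /imsetP[psi psM ->] neq cT y y'.
  have neq' : phi != phi' by apply: contraNneq neq => ->.
  have [K [KF TK TK' cross]] := meet_in_F pM pM' neq' cT.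
  rewrite !inE => /andP[ny /imsetP[i _ yi]] /andP[ny' /imsetP[j _ y'j]] /imsetP[i1 _ yi1].
  apply/imsetP => -[j1 _ y'j1].
  have iK : i \notin K.
    apply: contraNN ny => iK; have : y \in phi @: K by rewrite yi imset_f.
    by rewrite -TK inE => /andP[].
  have jK : j \notin K.
    apply: contraNN ny' => jK; have : y' \in phi' @: K by rewrite y'j imset_f.
    by rewrite -TK' inE => /andP[].
  (* The cross condition makes [y] and [y'] adjacent, but as values of [psi] at distinct positions
     they are not. *)
  have := cross i j iK jK; rewrite -yi -y'j yi1 y'j1; apply/negP.
  apply: gen_adj (matching_gen psM) _; apply: contraNneq ny => e.
  by rewrite yi1 e -y'j1 y'j imset_f.
- move=> S SH /andP[S2 Sq]; rewrite -r_eq.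
  pose P := [set phi in M' | phi @: setT \in S].
  have SP : S = [set (phi : Phi) @: setT | phi in P].
    apply/setP => E; apply/idP/imsetP => [ES|[phi]]; last by rewrite inE => /andP[_ pS] ->.
    by have /imsetP[phi pM Ep] := subsetP SH E ES; exists phi; rewrite // inE pM -Ep.
  have cP : #|P| = #|S|.
    rewrite SP card_in_imset // => x y; rewrite !inE => /andP[xM _] /andP[yM _].
    exact: range_inj.
  pose u : {ffun 'I_#|P| -> Phi} := [ffun i => enum_val i].
  have uP i : u i \in P by rewrite ffunE; apply: enum_valP.
  have nb : ~~ bad u.
    apply: (@kept_not_bad w).
    - by rewrite cP.
    - by rewrite cP q_eq.
    - by move=> i j; rewrite !ffunE; apply: enum_val_inj.
    - by move=> i; have := uP i; rewrite inE => /andP[/matching_kept].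
  move: nb; rewrite /bad card_ord -leqNgt -cP => le; apply: leq_trans le _.
  apply: subset_leq_card; apply/bigcupsP => i _; apply: bigcup_sup.
  by have := uP i; rewrite inE => /andP[].
Qed.

End Matching.

Definition lower_order_const : R :=
  ((delta * D%:R)^-1 + #|G|%:R * (2 / D%:R)) * (#|G|%:R * pair_const) +
  #|G|%:R * (q%:R * tuple_const + #|F|%:R * pair_const).

(** The part of order [#|V| ^ k], to be made small by the parameters. The coefficient
    [lower_order_const] does not depend on [V], so the other part is negligible for large [#|V|]. *)
Definition main_term : R :=
  ((delta * D%:R)^-1 + #|G|%:R * (2 / D%:R)) * (N0 * (2 * kappa * D%:R ^+ 2 + D%:R)) +
  #|G|%:R * (#|F|%:R * (n0 ^+ r * simN%:R * (z ^+ (2 * #|F|).-1 * p ^+ 2)) +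
             D%:R * N0 * (z * #|low|%:R)).

Lemma avg_Psi : avg Psi <= main_term + lower_order_const * n0 ^+ k.-1.
Proof.
have PsiE w : Psi w = ((delta * D%:R)^-1 + #|G|%:R * (2 / D%:R)) * Psi1 w +
    #|G|%:R * (q%:R * Psi2 w + (Psi3 w + Psi4 w)).
  by rewrite /Psi; move: (delta * D%:R)^-1 (2 / D%:R) => x y; ring.
rewrite (eq_avg PsiE) avgD !avgZ !avgD avgZ.
have c0 : 0 <= (delta * D%:R)^-1 + #|G|%:R * (2 / D%:R) :> R.
  by rewrite addr_ge0 ?mulr_ge0 ?invr_ge0 ?mulr_ge0 // ltW.
have g0 := ltW G_gt0R.
have h1 := ler_wpM2l c0 avg_Psi1.
have h2 := ler_wpM2l (ler0n R q) avg_Psi2.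
have h3 := ler_wpM2l g0 (lerD h2 (lerD avg_Psi3 avg_Psi4)).
apply: le_trans (lerD h1 h3) _.
rewrite /main_term /lower_order_const.
move: ((delta * D%:R)^-1 + _) N0 (n0 ^+ k.-1) (n0 ^+ r) (z ^+ _ * _) (z * _) => c n n1 n2 x y.
by rewrite le_eqVlt; apply/orP; left; apply/eqP; ring.
Qed.

Lemma exists_union_free (eps : R) :
  (forall A : {set Phi}, quasi_regular #|G| D 2 delta block_edge blocks A ->
     exists M' : {set Phi}, [/\ M' \subset A, edge_matching block_edge M' &
       #|blocks|%:R - (#|G| * #|M'|)%:R <= eps * #|blocks|%:R]) ->
  main_term + lower_order_const * n0 ^+ k.-1 <= 3 / 4 * (delta * D%:R * #|blocks|%:R) ->
  exists H : {set {set V}}, [/\ uniform r H, union_free (t + 1) H &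
    (1 - eps) * #|blocks|%:R <= (#|G| * #|H|)%:R].
Proof.
move=> nibble small.
have [w Psiw] := exists_le_avg Psi card_omega_gt0.
have qr := kept_regular (le_trans Psiw (le_trans avg_Psi small)).
have [M' [MK matM' cM]] := nibble _ qr.
have [H [uH ufH cH]] := matching_union_free MK matM'.
exists H; split => //; rewrite cH mulrBl mul1r; move: cM; lra.
Qed.

End RandomSystem.

(** * Choice of the parameters *)

Lemma ffact_ge (R : realFieldType) (n k : nat) : (0 < n)%N ->
  n%:R ^+ k * (1 - k%:R ^+ 2 / n%:R) <= (n ^_ k)%:R :> R.
Proof.
move=> n0; have nr : 0 < n%:R :> R by rewrite ltr0n.
have [nk|kn] := ltnP n k.
  apply: le_trans (_ : 0 <= _) => //.
  rewrite mulr_ge0_le0 ?exprn_ge0 // subr_le0 ler_pdivlMr // mul1r -natrX ler_nat.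
  by apply: leq_trans (ltnW nk) _; rewrite -{1}[k]expn1 leq_pexp2l // (leq_ltn_trans _ nk).
apply: le_trans (_ : ((n - k) ^ k)%:R <= _); last first.
  rewrite ler_nat ffact_prod -[X in (_ ^ X)%N]card_ord -prod_nat_const.
  by apply: leq_prod => i _; rewrite leq_sub2l // ltnW.
have p01 : 0 <= (k%:R / n%:R : R) <= 1.
  by rewrite divr_ge0 //= ler_pdivrMr // mul1r ler_nat.
have := exprB_le k k p01; rewrite subnn expr0 => B.
rewrite natrX natrB //.
have -> : n%:R - k%:R = n%:R * (1 - k%:R / n%:R) :> R by field; rewrite gt_eqF.
rewrite exprMn; apply: ler_wpM2l; first by rewrite exprn_ge0.
by move: B; rewrite expr2 mulrAC; lra.
Qed.

Lemma main_term_arith (R : realFieldType) (d D g kappa N X zl : R) :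
  0 < d -> 0 < D -> 0 < g -> 0 <= N -> 0 <= kappa -> 16 <= d * d * D ->
  32 * g <= d * D -> 32 * kappa * (d^-1 + 2 * g) <= d -> g * X <= d * D / 16 * N ->
  16 * (g * zl) <= d ->
  ((d * D)^-1 + g * (2 / D)) * (N * (2 * kappa * D ^+ 2 + D)) + g * (X + D * N * zl) <=
  5 / 16 * (d * D * N).
Proof.
move=> d0 D0 g0 N0 kap0 h1 h2 h3 h4 h5.
have -> : ((d * D)^-1 + g * (2 / D)) * (N * (2 * kappa * D ^+ 2 + D)) + g * (X + D * N * zl) =
  (2 * kappa * (d^-1 + 2 * g)) * (D * N) + (d^-1 * N + (2 * g * N + (g * X + (g * zl) * (D * N)))).
  by field; rewrite !gt_eqF.
have DN : 0 <= D * N by rewrite mulr_ge0 // ltW.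
have e1 : (2 * kappa * (d^-1 + 2 * g)) * (D * N) <= d / 16 * (D * N).
  by apply: ler_wpM2r => //; lra.
have e2 : d^-1 * N <= d * D / 16 * N.
  apply: ler_wpM2r => //; rewrite -[d^-1]mul1r ler_pdivrMr //; lra.
have e3 : 2 * g * N <= d * D / 16 * N by apply: ler_wpM2r => //; lra.
have e4 : (g * zl) * (D * N) <= d / 16 * (D * N) by apply: ler_wpM2r => //; lra.
have -> : 5 / 16 * (d * D * N) = d / 16 * (D * N) + (d * D / 16 * N + (d * D / 16 * N +
   (d * D / 16 * N + d / 16 * (D * N)))) by field.
by rewrite !lerD.
Qed.

(** * Vertices typed by words *)

Section Instance.
Variables (R : realType) (r e l b : nat).
Local Notation W := (word r e.+1 l).
Local Notation V := (W * 'I_b)%type.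
Local Notation Phi := {ffun 'I_r -> V}.

(** A vertex is a word with a copy number in ['I_b]. Genericity and codes see only the word, so the
    words stay fixed while the number of copies grows. *)
Definition types (phi : Phi) : {ffun 'I_r -> W} := [ffun i => (phi i).1].
Definition spread (phi : Phi) : bool := generic (types phi).

Lemma agree_refl (w : W) (i : 'I_r) : agree w w.
Proof. by apply/existsP; exists (i, i, ord0). Qed.

Lemma spread_not_agree phi i j : spread phi -> i != j -> ~~ agree (phi i).1 (phi j).1.
Proof. by move=> /genericP H /H; rewrite !ffunE. Qed.

Lemma spread_inj phi : spread phi -> injective phi.
Proof.
move=> sp i j e1; apply/eqP; apply: contraT => /(spread_not_agree sp).
by rewrite e1 agree_refl.
Qed.

Lemma card_agree_vertex (v : V) :
  #|[set v' : V | agree v.1 v'.1]|%:R <=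
  #|coord r e.+1|%:R / l.+1%:R * #|{: V}|%:R :> R.
Proof.
have -> : [set v' : V | agree v.1 v'.1] = setX [set w' | agree v.1 w'] setT.
  by apply/setP => -[w' i]; rewrite !inE /= andbT.
have -> : #|{: V}| = (#|W| * #|'I_b|)%N by rewrite card_prod.
rewrite cardsX cardsT 2!natrM mulrA; apply: ler_wpM2r => //.
exact: card_agree_le.
Qed.

(** Condition on the value [v] at [i]: the value at [j] is independent of it and agrees with [v] for
    a small share of the vertices. *)
Lemma card_agree_pair (i j : 'I_r) : i != j ->
  #|[set phi : Phi | agree (phi i).1 (phi j).1]|%:R <=
  #|coord r e.+1|%:R / l.+1%:R * #|{: V}|%:R ^+ r :> R.
Proof.
move=> ij; have [V0|V_gt0] := posnP #|{: V}|.
  have -> : [set phi : Phi | agree (phi i).1 (phi j).1] = set0.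
    apply/setP => phi; have := card0_eq V0 (phi i); by rewrite inE.
  by rewrite cards0 mulr_ge0 ?exprn_ge0 // divr_ge0.
have Vr : 0 < #|{: V}|%:R :> R by rewrite ltr0n.
have cPhi : #|{: Phi}|%:R = #|{: V}|%:R ^+ r :> R by rewrite card_ffun card_ord natrX.
have -> : #|[set phi : Phi | agree (phi i).1 (phi j).1]|%:R =
    avg (fun phi : Phi => (agree (phi i).1 (phi j).1)%:R) * #|{: V}|%:R ^+ r :> R.
  rewrite /avg cPhi divfK ?expf_neq0 ?gt_eqF // -sum1_card natr_sum big_mkcond.
  by apply: eq_bigr => phi _; rewrite inE; case: (agree _ _).
apply: ler_wpM2r; first by rewrite exprn_ge0.
pose P (v : V) (x : 'I_r) : pred V := fun v' => if x == i then v' == v else agree v.1 v'.1.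
rewrite (eq_avg (g := fun phi : Phi => \sum_v [forall x in [set i; j], P v x (phi x)]%:R)); last first.
  move=> phi; rewrite (bigD1 (phi i)) //= big1 ?addr0 => [|v nv].
    congr (_%:R); congr nat_of_bool; apply/idP/forall_inP => [ag x|].
      by rewrite !inE /P; case: (eqVneq x i) => [-> _|_ /= /eqP ->].
    by move=> /(_ j); rewrite !inE eqxx orbT /P eq_sym (negbTE ij) => /(_ isT).
  case: forall_inP => // /(_ i); rewrite !inE eqxx /P eqxx => /(_ isT) /= /eqP piv.
  by rewrite piv eqxx in nv.
rewrite avg_sum.
apply: le_trans (_ : \sum_(v : V) (#|{: V}|%:R^-1 * (#|coord r e.+1|%:R / l.+1%:R)) <= _); last first.
  by rewrite sumr_const -[leLHS]mulr_natl mulrA mulfV ?mul1r // gt_eqF.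
apply: ler_sum => v _; rewrite (avg_cylinder R [set i; j] (P v)) //.
rewrite big_setU1 ?inE //= big_set1 /P eqxx eq_sym (negbTE ij) avg_pred1.
 apply: ler_wpM2l; first by rewrite invr_ge0.
rewrite /avg ler_pdivrMr //; apply: le_trans (card_agree_vertex v).
rewrite -sum1_card natr_sum [leRHS]big_mkcond /=; apply: ler_sum => v' _.
by rewrite inE; case: (agree _ _).
Qed.

Lemma card_spread :
  (1 - r%:R ^+ 2 * (#|coord r e.+1|%:R / l.+1%:R)) * #|{: V}|%:R ^+ r <=
  #|[set phi | spread phi]|%:R :> R.
Proof.
set kap := _ / _.
have cPhi : #|{: Phi}|%:R = #|{: V}|%:R ^+ r :> R by rewrite card_ffun card_ord natrX.
have := cardsC [set phi | spread phi] => /(congr1 (fun n => n%:R : R)).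
rewrite natrD cPhi => tot.
suff : #|~: [set phi | spread phi]|%:R <= r%:R ^+ 2 * kap * #|{: V}|%:R ^+ r :> R.
  by rewrite mulrBl mul1r -tot; lra.
apply: le_trans (_ : \sum_(ij : 'I_r * 'I_r | ij.1 != ij.2)
    #|[set phi : Phi | agree (phi ij.1).1 (phi ij.2).1]|%:R <= _).
  rewrite -natr_sum ler_nat; apply: leq_trans (leq_card_bigcup _ _).
  apply: subset_leq_card; apply/subsetP => phi; rewrite !inE => /forallPn[i /forallPn[j]].
  rewrite negb_imply negbK !ffunE => /andP[ij ag].
  by apply/bigcupP; exists (i, j); rewrite ?inE.
apply: le_trans (_ : \sum_(ij : 'I_r * 'I_r | ij.1 != ij.2) (kap * #|{: V}|%:R ^+ r) <= _).
  by apply: ler_sum => -[i j] /= ij; apply: card_agree_pair.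
rewrite sumr_const -[leLHS]mulr_natl -mulrA; apply: ler_wpM2r.
  by rewrite mulr_ge0 ?exprn_ge0 // divr_ge0.
rewrite -natrX ler_nat; apply: leq_trans (max_card _) _.
by rewrite card_prod card_ord expnS expn1.
Qed.

Definition same_types (K : {set 'I_r}) (phi phi' : Phi) : bool :=
  [forall i in ~: K, (phi' i).1 == (phi i).1].

(** Outside [K] only the copy number is free. Against arbitrary vertices this saves a factor [#|W|]
    per position, to be weighed against the number of colours. *)
Lemma card_same_types (K : {set 'I_r}) (phi : Phi) :
  (#|[set phi' | [&& spread phi', phi' @: K == phi @: K & same_types K phi phi']]| <=
   #|K|`! * b ^ #|~: K|)%N.
Proof.
pose Q i : pred V := fun v => v.1 == (phi i).1.
have cQ i : #|Q i| = b.
  rewrite -[RHS]mul1n -(cards1 (phi i).1) -[X in (_ * X)%N]card_ord -cardsT -cardsX.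
  by apply: eq_card => -[w x]; rewrite !inE /= andbT.
have := card_image_eq_le K (phi @: K) Q.
rewrite (eq_bigr (fun=> b)) ?prod_nat_const => [le1|i _]; last exact: cQ.
apply: leq_trans le1; apply: subset_leq_card; apply/subsetP => phi'.
rewrite !inE => /and3P[sp -> st]; apply/and3P; split => //.
exact/injectiveP/spread_inj.
Qed.

End Instance.

Lemma exists_nat_ge (R : realType) (x : R) : exists n : nat, x <= n%:R.
Proof.
exists (Num.bound (Num.max x 0)).
apply: le_trans (_ : Num.max x 0 <= _); first by rewrite le_max lexx.
by apply/ltW/archi_boundP; rewrite le_max lexx orbT.
Qed.

Lemma bin_ge_half (R : realFieldType) (n k : nat) :
  (0 < n)%N -> (2 * k ^ 2 <= n)%N ->
  n%:R ^+ k / k`!%:R <= 2 * 'C(n, k)%:R :> R.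
Proof.
move=> n0 kn; have nr : 0 < n%:R :> R by rewrite ltr0n.
rewrite ler_pdivrMr ?ltr0n ?fact_gt0 // -mulrA -natrM bin_ffact.
have := ffact_ge R k n0.
have half : 1 / 2 <= 1 - k%:R ^+ 2 / n%:R :> R.
  have : k%:R ^+ 2 / n%:R <= 1 / 2 :> R.
    by rewrite ler_pdivrMr // mulrC mulrA mulr1 ler_pdivlMr // mulrC -natrX -natrM ler_nat.
  lra.
have := ler_wpM2l (exprn_ge0 k (ler0n R n)) half.
lra.
Qed.

(** After inserting the value of [p], all that is left beside constants and the number of blocks is
    [zc / w], the number of colours over the number of word tuples outside an [F]-set. *)
Lemma sim_term_eq (R : fieldType) (D u g kf w y x zc p : R) :
  g != 0 -> kf != 0 -> w != 0 -> y != 0 -> u != 0 ->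
  p * (w * y) = D * u / (g * kf) ->
  w * y * x * (kf * y) * (zc / u ^+ 2 * p ^+ 2) = x / kf * (D ^+ 2 / g ^+ 2 * zc / w).
Proof.
move=> g0 kf0 w0 y0 u0 ps.
have -> : p = D * u / (g * kf) / (w * y) by rewrite -ps mulfK // mulf_neq0.
by field; rewrite g0 kf0 w0 y0 u0.
Qed.

(** Here [E] is the factor [2 ^ e.+1] saved by the code, so [zc / Wl] is at most
    [c * (f + 1) / E]. *)
Lemma low_term_arith (R : realFieldType) (d D g f c Wl zc E N : R) :
  0 < d -> 0 < D -> 0 < g -> 0 <= f -> 0 <= c -> 0 < Wl -> 0 < E -> 0 <= N ->
  16 * f * D * c * (f + 1) / (d * g) <= E ->
  zc * E <= c * (f + 1) * Wl ->
  g * (f * (N * (D ^+ 2 / g ^+ 2 * zc / Wl))) <= d * D / 16 * N.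
Proof.
move=> d0 D0 g0 f0 c0 W0 E0 N0 h1 h2.
have {}h1 : 16 * f * D * (c * (f + 1)) <= E * (d * g).
  by move: h1; rewrite ler_pdivrMr ?mulr_gt0 // !mulrA.
have h3 : 16 * f * D * zc <= d * g * Wl.
  rewrite -(ler_pM2r E0).
  have e1 : 16 * f * D * (zc * E) <= 16 * f * D * (c * (f + 1) * Wl).
    by apply: ler_wpM2l; rewrite // !mulr_ge0 // ltW.
  have e2 : 16 * f * D * (c * (f + 1)) * Wl <= E * (d * g) * Wl.
    by apply: ler_wpM2r; rewrite // ltW.
  move: e1 e2; move: (c * (f + 1)) => v; rewrite !mulrA => e1 e2.
  apply: le_trans e1 (le_trans e2 _).
  by rewrite le_eqVlt; apply/orP; left; apply/eqP; ring.
have -> : g * (f * (N * (D ^+ 2 / g ^+ 2 * zc / Wl))) =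
    16 * f * D * zc / (g * Wl) * (D / 16 * N).
  by field; rewrite !gt_eqF.
have -> : d * D / 16 * N = d * (D / 16 * N) by ring.
apply: ler_wpM2r; first by rewrite mulr_ge0 // divr_ge0 // ltW.
by rewrite ler_pdivrMr ?mulr_gt0 // mulrA.
Qed.

Lemma half_count_arith (R : realFieldType) (d N B : R) :
  0 <= d -> 0 <= N -> N <= 2 * B -> 5 / 16 * (d * N) + d / 16 * N <= 3 / 4 * (d * B).
Proof.
move=> d0 N0 NB; have := ler_wpM2l d0 NB; have := mulr_ge0 d0 N0; lra.
Qed.

(** * The construction on multiples of a fixed number of vertices *)

Section Construction.
Variables (R : realType) (t k a : nat).
Local Notation r := (t * k - a)%N.
Hypothesis t_gt1 : (1 < t)%N.
Hypothesis k_gt1 : (1 < k)%N.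
Hypothesis a_lt_t : (a < t)%N.
Hypothesis a_small : (2 * a <= (t - 2) * k)%N.
Hypothesis a_small3 : (3 * a < (2 * t - 3) * k)%N.
Local Notation g := ('C(r, k) - max_matching_free r k (t - a - 1))%N.

Lemma r_minus_k : (2 <= r - k)%N.
Proof. move: t_gt1 k_gt1 a_small; clear; nia. Qed.

Lemma k_lt_r : (k < r)%N.
Proof. by rewrite -subn_gt0; apply: leq_trans r_minus_k. Qed.

Lemma own_count_gt0 : (0 < g)%N.
Proof.
rewrite subn_gt0; apply: max_matching_free_lt; first exact: ltnW.
rewrite subn1 prednK ?subn_gt0 //; move: k_gt1 a_lt_t; clear; nia.
Qed.

Lemma construction (eps : R) : 0 < eps ->
  exists s N : nat, (0 < s)%N /\ forall b : nat, (N <= b)%N ->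
  exists (V : finType) (H : {set {set V}}), [/\ #|V| = (s * b)%N, uniform r H,
    union_free (t + 1) H & (1 - eps) * 'C(s * b, k)%:R <= (g * #|H|)%:R :> R].
Proof.
move=> eps0.
have k0 : (0 < k)%N := ltnW k_gt1.
have g0 := own_count_gt0.
have [F [/forall_inP uF mF cF]] := exists_max_matching_free r k (t - a - 1).
pose G := [set K : {set 'I_r} | #|K| == k] :\: F.
have cG : #|G| = g.
  rewrite /G cardsD; have -> : [set K : {set 'I_r} | #|K| == k] :&: F = F.
    by apply/setIidPr/subsetP => K /uF; rewrite inE.
  by rewrite card_draws card_ord cF.
have cardF : {in F, forall K : {set 'I_r}, #|K| = k} by move=> K /uF/eqP.
have cardG : {in G, forall K : {set 'I_r}, #|K| = k}.
  by move=> K; rewrite !inE => /andP[_ /eqP].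
have disFG : [disjoint F & G].
  by rewrite disjoint_sym disjoints_subset /G setDE subsetIr.
have FG_all (K : {set 'I_r}) : #|K| = k -> (K \in F) || (K \in G).
  by move=> cK; rewrite !inE cK eqxx andbT orbN.
have F_matching : ~~ has_matching (t - a) F.
  by rewrite subn1 prednK ?subn_gt0 in mF.
have gr : 0 < g%:R :> R by rewrite ltr0n.
(* The parameters are chosen in the order [delta], [D], [c], [e], [l], [Z0], [Z],
   [N], each one large in terms of the previous ones. *)
have [delta d0 nibble] := nearly_perfect0 g0 eps0 (ler1n R 2).
have [D hD] := exists_nat_ge (16 / delta ^+ 2 + 32 * g%:R / delta + delta^-1).
have t1 : 0 < 16 / delta ^+ 2 by rewrite divr_gt0 ?exprn_gt0.
have t2 : 0 <= 32 * g%:R / delta by rewrite divr_ge0 ?mulr_ge0 // ltW.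
have t3 : 0 <= delta^-1 by rewrite invr_ge0 ltW.
have D1 : 16 <= delta * delta * D%:R.
  have : 16 / delta ^+ 2 <= D%:R by lra.
  by rewrite ler_pdivrMr ?exprn_gt0 // expr2 mulrC.
have D2 : 32 * g%:R <= delta * D%:R.
  have : 32 * g%:R / delta <= D%:R by lra.
  by rewrite ler_pdivrMr // (mulrC delta).
have D3 : 1 <= delta * D%:R.
  by rewrite mulrC -ler_pdivrMr // div1r; lra.
have Dr : 0 < D%:R :> R by lra.
have D0 : (0 < D)%N by rewrite -(ltr0n R).
(* Only a share of at most [1 / c] of the colours will be low, so few [G]-positions receive a low
   colour by accident. *)
have [c hc] := exists_nat_ge (16 * g%:R / delta).
have c0 : (0 < c)%N.
  by rewrite -(ltr0n R); apply: lt_le_trans hc; rewrite divr_gt0 // mulr_gt0.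
(* The saving [2 ^ e.+1] must outweigh [c] and the constants of the pairs with equal words; the
   summand 1 in [#|F| + 1] accounts for the successor in [Z0.+1]. *)
have [e he] := exists_nat_ge (16 * #|F|%:R * D%:R * c%:R * (#|F|%:R + 1) / (delta * g%:R) : R).
(* [K0 <= l.+1] is the condition on [kappa] in [main_term_arith], solved for [l.+1]. *)
pose K0 : R := 32 * r%:R ^+ 2 * #|coord r e.+1|%:R * (delta^-1 + 2 * g%:R) / delta.
have [l0 hl0] := exists_nat_ge K0.
pose l := l0.+1.
pose L := (r - k)%N.
have L2 : (2 <= L)%N := r_minus_k.
have cardCF : {in F, forall K : {set 'I_r}, #|~: K| = L}.
  by move=> K KF; rewrite cardsCs setCK card_ord cardF.
have [code [Z0 [hZ0 code_lt code_eq]]] := exists_code e.+1 l L2 cardCF.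
pose Z := (c * Z0.+1).-1.
have ZE : Z.+1 = (c * Z0.+1)%N by rewrite prednK // muln_gt0 c0.
pose W := #|word r e.+1 l|.
have W0 : (0 < W)%N by apply/card_gt0P; exists [ffun=> ord0].
(* Taking [#|V|] divisible by [D * Z.+1 ^ #|F|] lets [normalize] hold exactly with an integer [M];
   the factor [W] counts the words. *)
pose s := (W * (D * Z.+1 ^ #|F|))%N.
have s0 : (0 < s)%N by rewrite !muln_gt0 W0 D0 expn_gt0.
pose low (x : 'I_Z.+1) := (x < Z0)%N.
pose kappa : R := r%:R ^+ 2 * (#|coord r e.+1|%:R / l.+1%:R).
pose C := lower_order_const k Z F G D (2 * t + 2) delta.
have [N hN] := exists_nat_ge (16 * k`!%:R * C / (delta * D%:R)).
exists s, (N + 2 * k ^ 2 + 1)%N; split => // b hb.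
have b0 : (0 < b)%N by apply: leq_trans hb; rewrite addn1.
pose bb := (D * Z.+1 ^ #|F| * b)%N.
pose V : finType := (word r e.+1 l * 'I_bb)%type.
have cV : #|V| = (s * b)%N by rewrite card_prod card_ord /s /bb -/W !mulnA.
have V0 : (0 < #|V|)%N by rewrite cV muln_gt0 s0.
pose M := (g * k`! * (W * b) * #|V| ^ L.-1).-1.
have ME : M.+1 = (g * k`! * (W * b) * #|V| ^ L.-1)%N.
  by rewrite prednK // !muln_gt0 g0 fact_gt0 W0 b0 expn_gt0 V0.
have normalize : (M.+1 * (Z.+1 ^ #|F| * D) = #|G| * k`! * #|V| ^ (r - k))%N.
  rewrite ME cG -/L -(prednK (ltnW L2)) expnS {2}cV /s.
  move: (Z.+1 ^ #|F|)%N (#|V| ^ _)%N (k`!) => x y z; ring.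
pose col (K : {set 'I_r}) (phi : {ffun 'I_r -> V}) : 'I_Z.+1 := inord (code K (types phi)).
have colE K phi : K \in F -> spread phi -> val (col K phi) = code K (types phi).
  move=> KF sp; rewrite /col /= inordK // ZE.
  apply: leq_trans (code_lt K _ KF sp) _.
  by apply: leq_trans (leqnSn _) _; rewrite leq_pmull.
exists V.
have card_simN (K : {set 'I_r}) (phi : {ffun 'I_r -> V}) : K \in F -> spread phi ->
    (#|[set phi' | [&& spread phi', phi' @: K == phi @: K & same_types K phi phi']]| <=
     k`! * bb ^ L)%N.
  by move=> KF _; have := card_same_types K phi; rewrite cardF // cardCF.
have col_eq K K' phi phi' : K \in F -> K' \in F -> spread phi -> spread phi' ->
    col K phi = col K' phi' -> K = K' /\ (same_types K phi phi' \/
    (forall i j, i \notin K -> j \notin K -> agree (phi i).1 (phi' j).1)).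
  move=> KF K'F sp sp' /(congr1 val); rewrite !colE // => ce.
  have [KK' [eqt|ag]] := code_eq K K' _ _ KF K'F sp sp' ce; split => //.
    left; apply/forall_inP => i; rewrite inE => /eqt; rewrite !ffunE => ->; exact: eqxx.
  by right=> i j iK jK; have := ag i j iK jK; rewrite !ffunE.
have low_col K phi : K \in F -> spread phi -> low (col K phi).
  by move=> KF sp; rewrite /low colE //; apply: code_lt.
have gG : (0 < #|G|)%N by rewrite cG.
have q2 : (1 < 2 * t + 2)%N by rewrite addn2.
have cb : #|blocks V k| = 'C(s * b, k) by rewrite /blocks card_draws cV.
have [||H [uH ufH cH]] := exists_union_free (M := M) (col := col) (low := low) (R := R)
  (adj := fun v v' : V => agree v.1 v'.1)
  (@spread_inj r e l bb) k0 k_lt_r cardF cardG disFG V0 gG normalize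
  (card_spread R r e l bb) card_simN D0 q2 d0 D3
  FG_all low_col (@spread_not_agree r e l bb) col_eq (erefl _) (erefl _)
  F_matching t_gt1 a_small a_small3 (eps := eps).
- move=> A qr; rewrite cG in qr *.
  have [M' [MA mM le1]] := nibble _ _ _ _ _ _ qr.
  by exists M'; split=> //; move: le1; rewrite add0r.
- have n0 : 0 < #|V|%:R :> R by rewrite ltr0n.
  have kf : 0 < k`!%:R :> R by rewrite ltr0n fact_gt0.
  have Zr : 0 < Z.+1%:R :> R by rewrite ltr0n.
  have Wr : 0 < W%:R ^+ L :> R by rewrite exprn_gt0 // ltr0n.
  have dD0 : 0 < delta * D%:R by rewrite mulr_gt0.
  set N0 := #|V|%:R ^+ k / k`!%:R : R.
  have N0_ge0 : 0 <= N0 by rewrite divr_ge0 // exprn_ge0.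
  have lower : C * #|V|%:R ^+ k.-1 <= delta * D%:R / 16 * N0.
    have CN : 16 * k`!%:R * C <= delta * D%:R * #|V|%:R.
      move: hN; rewrite ler_pdivrMr // => /le_trans; apply; rewrite mulrC.
      apply: ler_wpM2l; first exact: ltW.
      rewrite ler_nat cV; apply: leq_trans (leq_pmull b s0); apply: leq_trans hb.
      by rewrite -addnA leq_addr.
    have {CN hN} := ler_wpM2r (exprn_ge0 k.-1 (ltW n0)) CN.
    have nk : #|V|%:R ^+ k = #|V|%:R * #|V|%:R ^+ k.-1 :> R by rewrite -exprS prednK.
    rewrite /N0 nk; move: (#|V|%:R : R) (delta * D%:R) C (#|V|%:R ^+ k.-1) => n d y x.
    rewrite mulrA ler_pdivlMr //; lra.
  have X_le : g%:R * (#|F|%:R * (#|V|%:R ^+ r * (k`! * bb ^ L)%:R *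
      (Z.+1%:R^-1 ^+ (2 * #|F|).-1 * M.+1%:R^-1 ^+ 2))) <= delta * D%:R / 16 * N0.
    have [->|f0] := posnP #|F|; first by rewrite mul0r mulr0 mulr_ge0 // divr_ge0 // ltW.
    have zE : Z.+1%:R^-1 ^+ (2 * #|F|).-1 = Z.+1%:R / (Z.+1%:R ^+ #|F|) ^+ 2 :> R.
      rewrite -exprM (mulnC _ 2) -[X in _ / _ ^+ X](prednK (_ : 0 < 2 * #|F|)%N) ?muln_gt0 ?f0 //.
      by rewrite exprS invfM mulrA divff ?gt_eqF // mul1r exprVn.
    have ps := p_scale R gG normalize.
    have -> : #|V|%:R ^+ r = #|V|%:R ^+ L * #|V|%:R ^+ k :> R.
      by rewrite -exprD subnK // ltnW // k_lt_r.
    have nw : #|V|%:R ^+ L = W%:R ^+ L * bb%:R ^+ L :> R.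
      by rewrite -exprMn -natrM card_prod card_ord.
    rewrite -/L nw cG in ps.
    have bb0 : bb%:R ^+ L != 0 :> R.
      by rewrite expf_neq0 // pnatr_eq0 -lt0n !muln_gt0 D0 expn_gt0 b0.
    have gn := lt0r_neq0 gr; have kn := lt0r_neq0 kf; have wn := lt0r_neq0 Wr.
    have un : Z.+1%:R ^+ #|F| != 0 :> R by rewrite expf_neq0 // lt0r_neq0.
    have := sim_term_eq (#|V|%:R ^+ k) Z.+1%:R gn kn wn bb0 un ps.
    rewrite nw zE natrM natrX => ->.
    apply: (low_term_arith (E := (2 ^ e.+1)%:R) (c := c%:R)) => //.
    - by rewrite ltr0n expn_gt0.
    - apply: le_trans he _; rewrite ler_nat; apply: leq_trans (ltnW (ltn_expl _ (ltnSn 1))) _.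
      by rewrite leq_exp2l.
    - rewrite natr1 -natrX -!natrM ler_nat ZE -!mulnA leq_pmul2l // !mulSn leq_add //.
      have eW : (2 ^ e.+1 <= W)%N.
        rewrite /W card_ffun !card_ord !card_prod !card_ord.
        apply: leq_trans (_ : l.+1 ^ e.+1 <= _)%N; first by rewrite leq_exp2r.
        by rewrite leq_exp2l // leq_pmull // muln_gt0 !(leq_trans k0 (ltnW k_lt_r)).
      by apply: leq_trans eW _; rewrite -{1}[W]expn1 leq_pexp2l // ltnW.
  have low_le : 16 * (g%:R * (Z.+1%:R^-1 * #|low|%:R)) <= delta.
    have cl : (#|low| <= Z0)%N.
      apply: leq_trans (subset_leq_card (_ : _ \subset [set inord (val i) | i : 'I_Z0])) _.
        apply/subsetP => x xl; apply/imsetP; exists (Ordinal xl) => //=.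
        by apply/val_inj; rewrite /= inordK.
      by apply: leq_trans (leq_imset_card _ _) _; rewrite card_ord.
    have cl' : #|low|%:R <= Z0.+1%:R :> R by rewrite ler_nat (leq_trans cl).
    have cr : 0 < c%:R :> R by rewrite ltr0n.
    have Z0r : 0 < Z0.+1%:R :> R by rewrite ltr0n.
    move: cl' (ler0n R #|low|); move: (#|low|%:R : R) => y yl y0.
    rewrite (mulrC _^-1) !mulrA ler_pdivrMr // ZE natrM mulrA.
    apply: ler_pM; rewrite ?mulr_ge0 ?(ltW gr) //.
    by move: hc; rewrite ler_pdivrMr // (mulrC delta).
  have kap0 : 0 <= kappa by rewrite mulr_ge0 ?exprn_ge0 // divr_ge0.
  have kap_le : 32 * kappa * (delta^-1 + 2 * g%:R) <= delta.
    have lr : 0 < l.+1%:R :> R by rewrite ltr0n.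
    have : K0 <= l.+1%:R by apply: le_trans hl0 _; rewrite ler_nat !leqW.
    rewrite /K0 /kappa ler_pdivrMr // => h.
    rewrite !mulrA -[leLHS]mulrAC ler_pdivrMr // (mulrC delta); move: h.
    by rewrite mulrA.
  have main := main_term_arith d0 Dr gr N0_ge0 kap0 D1 D2 kap_le X_le low_le.
  (* Five sixteenths for the main term and one for the lower order make [3 / 8], and
     [N0 <= 2 * #|blocks|] turns this into [3 / 4]. *)
  apply: le_trans (_ : 5 / 16 * (delta * D%:R * N0) + delta * D%:R / 16 * N0 <= _).
    by apply: lerD; [rewrite /main_term cG|].
  have := bin_ge_half R (n := s * b) (k := k); rewrite -cb -cV -/N0 => /(_ V0) half.
  have {}half : N0 <= 2 * #|blocks V k|%:R.
    apply: half; rewrite cV; apply: leq_trans (leq_pmull b s0); apply: leq_trans hb.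
    by rewrite addnAC leq_addl.
  exact: half_count_arith (ltW dD0) N0_ge0 half.
exists H; split=> //.
by rewrite cb cG in cH.
Qed.
End Construction.

(** * The limit *)

(** Embed the vertices in ['I_n]; the added vertices lie in no edge, and equal unions pull back
    along the injection. *)
Lemma max_union_free_ge (T : finType) (H : {set {set T}}) (s n r : nat) :
  (#|T| <= n)%N -> uniform r H -> union_free s H -> (#|H| <= max_union_free s n r)%N.
Proof.
move=> Tn /forall_inP uH /union_freeP ufH.
pose f (x : T) : 'I_n := widen_ord Tn (enum_rank x).
have finj : injective f by move=> x y /(congr1 val) /= /val_inj /enum_rank_inj.
have fK (E : {set T}) : f @^-1: (f @: E) = E.
  by apply/setP => x; rewrite inE mem_imset.
pose fH := [set f @: (E : {set T}) | E in H].
have pre_sub (A : {set {set 'I_n}}) : A \subset fH -> [set f @^-1: (E : {set 'I_n}) | E in A] \subset H.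
  by move=> /subsetP AH; apply/subsetP => _ /imsetP[E /AH/imsetP[E0 E0H ->] ->]; rewrite fK.
have pre_cover (A : {set {set 'I_n}}) :
    cover [set f @^-1: (E : {set 'I_n}) | E in A] = f @^-1: cover A.
  apply/setP => x; rewrite inE; apply/bigcupP/bigcupP.
    by case=> _ /imsetP[E EA ->]; rewrite inE => ?; exists E.
  by case=> E EA xE; exists (f @^-1: E); rewrite ?imset_f ?inE.
have preK (A : {set {set 'I_n}}) : A \subset fH ->
    [set f @: (E : {set T}) | E in [set f @^-1: (E : {set 'I_n}) | E in A]] = A.
  move=> /subsetP AH; rewrite -imset_comp -[RHS]imset_id; apply: eq_in_imset => E /AH.
  by case/imsetP => E0 _ -> /=; rewrite fK.
have <- : #|fH| = #|H| by rewrite card_imset //; apply: imset_inj.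
apply: leq_bigmax_cond; apply/andP; split.
  by apply/forall_inP => _ /imsetP[E EH ->]; rewrite card_imset ?uH.
apply/union_freeP => A B AH BH As Bs AB.
suff e : [set f @^-1: (E : {set 'I_n}) | E in A] = [set f @^-1: (E : {set 'I_n}) | E in B].
  by rewrite -(preK A) // e preK.
apply: ufH; rewrite ?pre_sub ?pre_cover ?AB //.
  exact: leq_trans (leq_imset_card _ _) As.
exact: leq_trans (leq_imset_card _ _) Bs.
Qed.

Section Limit.
Variables (R : realType) (t k a : nat).
Local Notation r := (t * k - a)%N.
Hypothesis t_gt1 : (1 < t)%N.
Hypothesis k_gt1 : (1 < k)%N.
Hypothesis a_lt_t : (a < t)%N.
Hypothesis a_small : (2 * a <= (t - 2) * k)%N.
Hypothesis a_small3 : (3 * a < (2 * t - 3) * k)%N.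
Local Notation g := ('C(r, k) - max_matching_free r k (t - a - 1))%N.
Local Notation U n := (max_union_free (t + 1) n r).

(** The edges with an own [k.-1]-set are estimated by [n ^ k.-1], which is where the error [1 / n]
    comes from. *)
Lemma union_free_ratio_le n : (0 < n)%N ->
  (U n)%:R / n%:R ^+ k <= 1 / k`!%:R * (1 / g%:R) + n%:R^-1 :> R.
Proof.
move=> n0; have gp : (0 < g)%N by exact: own_count_gt0.
have k0 : (0 < k)%N := ltnW k_gt1.
have nr : 0 < n%:R :> R by rewrite ltr0n.
have gr : 0 < g%:R :> R by rewrite ltr0n.
have kf : 0 < k`!%:R :> R by rewrite ltr0n fact_gt0.
have [H /andP[uH ufH] UE] : {H : {set {set 'I_n}} | uniform r H && union_free (t + 1) H &
    U n = #|H|}.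
  apply: eq_bigmax_cond; apply/card_gt0P; exists set0; apply/andP; split.
    by apply/forall_inP => E; rewrite inE.
  by apply/union_freeP => A B; rewrite !subset0 => /eqP-> /eqP->.
have := union_free_card_le k0 a_lt_t uH ufH; rewrite -UE card_ord => le1.
have le2 : (g * k`! * U n <= n ^ k + g * k`! * n ^ k.-1)%N.
  rewrite mulnAC; apply: leq_trans (leq_mul le1 (leqnn k`!)) _.
  rewrite mulnDl leq_add //.
    by rewrite bin_ffact ffact_le_expn.
  by rewrite mulnAC leq_mul // bin_le_expn.
have nk : n%:R ^+ k = n%:R * n%:R ^+ k.-1 :> R by rewrite -exprS prednK.
move: le2; rewrite -(ler_nat R) natrD !natrM !natrX nk.
have xr : 0 < n%:R ^+ k.-1 :> R by rewrite exprn_gt0.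
move: (n%:R ^+ k.-1) xr => x x0 le2.
rewrite ler_pdivrMr ?mulr_gt0 //.
have -> : (1 / k`!%:R * (1 / g%:R) + n%:R^-1) * (n%:R * x) =
   (n%:R * x + g%:R * k`!%:R * x) / (g%:R * k`!%:R) :> R by field; rewrite !gt_eqF.
by rewrite ler_pdivlMr ?mulr_gt0 // mulrC.
Qed.

(** One factor [1 - eps] is lost to blocks left uncovered, the other in passing from [n] to the
    multiple [s * (n %/ s)] and from the binomial coefficient to a power. *)
Lemma union_free_ratio_ge (eps : R) : 0 < eps -> eps <= 1 ->
  exists N, forall n, (N <= n)%N ->
  (1 - eps) * (1 - eps) * (1 / k`!%:R * (1 / g%:R)) <= (U n)%:R / n%:R ^+ k.
Proof.
move=> e0 e1; have gp : (0 < g)%N by exact: own_count_gt0.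
have gr : 0 < g%:R :> R by rewrite ltr0n.
have kf : 0 < k`!%:R :> R by rewrite ltr0n fact_gt0.
have [s [N [s0 hN]]] := construction t_gt1 k_gt1 a_lt_t a_small a_small3 e0.
have [N' hN'] := exists_nat_ge (k%:R * (s + k)%:R / eps).
(* [N'] ensures [k * (s + k) / n <= eps], and [s * N] ensures [N <= n %/ s]. *)
exists (N' + s * N + s + k + 1)%N => n hn.
have n0 : (0 < n)%N by apply: leq_trans hn; rewrite addn1.
have nr : 0 < n%:R :> R by rewrite ltr0n.
have bN : (N <= n %/ s)%N by rewrite leq_divRL // mulnC; move: hn; clear; lia.
have sb : (n < s * (n %/ s) + s)%N.
  by rewrite {1}(divn_eq n s) mulnC ltn_add2l ltn_mod.
have [V [H [cV uH ufH cH]]] := hN _ bN.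
have Vn : (#|V| <= n)%N by rewrite cV mulnC leq_trunc_div.
have HU := max_union_free_ge Vn uH ufH.
have ske : k%:R * ((s + k)%:R / n%:R) <= eps.
  rewrite mulrA ler_pdivrMr // (mulrC eps) -ler_pdivrMr //.
  apply: le_trans hN' _; rewrite ler_nat; move: hn; clear; lia.
have skn : (s + k <= n)%N by move: hn; clear; lia.
have binr : (1 - eps) * n%:R ^+ k <= k`!%:R * 'C(s * (n %/ s), k)%:R :> R.
  apply: le_trans (_ : (n - (s + k))%:R ^+ k <= _).
    have -> : (n - (s + k))%:R = n%:R * (1 - (s + k)%:R / n%:R) :> R.
      by rewrite natrB // mulrBr mulr1 mulrCA divff ?gt_eqF // mulr1.
    rewrite exprMn mulrC; apply: ler_wpM2l; first by rewrite exprn_ge0.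
    have p01 : 0 <= ((s + k)%:R / n%:R : R) <= 1.
      by rewrite divr_ge0 //= ler_pdivrMr // mul1r ler_nat.
    have := exprB_le k k p01; rewrite subnn expr0 mulrC.
    by move: ske; lra.
  rewrite -natrX -natrM ler_nat mulnC bin_ffact ffact_prod -[X in (_ ^ X)%N]card_ord.
  rewrite -prod_nat_const; apply: leq_prod => i _.
  by have := ltn_ord i; move: sb; clear; lia.
rewrite ler_pdivlMr ?exprn_gt0 //.
have -> : (1 - eps) * (1 - eps) * (1 / k`!%:R * (1 / g%:R)) * n%:R ^+ k =
  (1 - eps) * ((1 - eps) * n%:R ^+ k) / (k`!%:R * g%:R) by field; rewrite !gt_eqF.
rewrite ler_pdivrMr ?mulr_gt0 //.
apply: le_trans (_ : (1 - eps) * (k`!%:R * 'C(s * (n %/ s), k)%:R) <= _).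
  by apply: ler_wpM2l => //; rewrite subr_ge0.
rewrite [leLHS]mulrCA [leRHS]mulrCA; apply: ler_wpM2l => //.
apply: le_trans cH _; rewrite -natrM ler_nat mulnC leq_mul2r HU orbT //.
Qed.

Lemma union_free_ratio_cvg (eps : R) : 0 < eps ->
  exists N, forall n, (N <= n)%N ->
  `|1 / k`!%:R * (1 / ('C(r, k)%:R - (max_matching_free r k (t - a - 1))%:R)) -
    (U n)%:R / n%:R ^+ k| <= eps.
Proof.
move=> e0; rewrite -natrB; last first.
  by rewrite ltnW // -subn_gt0; exact: own_count_gt0.
have gp : (0 < g)%N by exact: own_count_gt0.
(* The limit is at most 1 and [(1 - d) ^ 2 >= 1 - 2 * d], so [d <= eps / 2] suffices. *)
pose d := Num.min 1 (eps / 2).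
have d0 : 0 < d by rewrite lt_min ltr01 divr_gt0.
have d1 : d <= 1 by rewrite ge_min lexx.
have d2 : d <= eps / 2 by rewrite ge_min lexx orbT.
have [N1 h1] := union_free_ratio_ge d0 d1.
have [N2 h2] := exists_nat_ge eps^-1.
exists (N1 + N2 + 1)%N => n hn.
have n0 : (0 < n)%N by move: hn; clear; lia.
have nN1 : (N1 <= n)%N by move: hn; clear; lia.
have lo := h1 n nN1.
have up := union_free_ratio_le n0.
have ninv : n%:R^-1 <= eps.
  rewrite invf_ple ?posrE ?ltr0n //; apply: le_trans h2 _.
  by rewrite ler_nat; move: hn; clear; lia.
have L0 : 0 <= 1 / k`!%:R * (1 / g%:R) :> R by rewrite mulr_ge0 ?divr_ge0.
have L1 : 1 / k`!%:R * (1 / g%:R) <= 1 :> R.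
  rewrite !mul1r -invfM -natrM invf_le1 ?ltr0n ?muln_gt0 ?fact_gt0 //.
  by rewrite ler1n muln_gt0 fact_gt0.
move: lo up L0 L1; move: (1 / k`!%:R * _) ((U n)%:R / _) => L u lo up L0 L1.
rewrite ler_norml; apply/andP; split; first by lra.
have : 2 * d * L <= eps * 1.
  by apply: ler_pM => //; [rewrite mulr_ge0 // ltW | lra].
have : 0 <= d * d * L by rewrite !mulr_ge0 // ltW.
lra.
Qed.

End Limit.

From mathcomp Require Import all_classical all_reals all_analysis.
Import numFieldNormedType.Exports.
Local Open Scope classical_set_scope.
Local Open Scope ring_scope.

Theorem theorem1p1 (R : realType) (t k a : nat)
  (ht : (2 <= t)%N) (hk : (2 <= k)%N) (ha : (a <= t - 1)%N)
  (hex : ~ ([set (3, 2 * s - 1)%N | s in [set s : nat | (2 <= s)%N]]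
        `|` [set (s + 1, s + 1)%N | s in [set s : nat | (2 <= s)%N]]
        `|` [set (s + 1, s + 2)%N | s in [set s : nat | (2 <= s)%N]]
        `|` [set (4, 7)%N]) (t + 1, t * k - a)%N) :
  (max_union_free (t + 1) n (t * k - a))%:R / (n%:R ^+ k) @[n --> \oo] -->
    (1 / (k`!)%:R *
     (1 / ('C(t * k - a, k)%:R - (max_matching_free (t * k - a) k (t - a - 1))%:R)) : R).
Proof.
have at1 : (a < t)%N by rewrite (leq_ltn_trans ha) // subn1 prednK // ltnW.
have [||| a_small a_small3] := exclusion_arith (t := t) (k := k) (a := a) ht hk ha.
- by move=> s s2 E; apply: hex; left; left; left; exists s => //; rewrite E.
- by move=> s s2 E; apply: hex; left; left; right; exists s => //; rewrite E.
- by move=> E; apply: hex; right.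
apply/cvgrPdist_le => eps eps0.
have [N hN] := union_free_ratio_cvg ht hk at1 a_small a_small3 eps0.
by exists N.
Qed.
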